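(* For all $j\ge2$, $2\le p\le\infty$ and $0\le s<\frac{j-1}{2}$ there exists an NLS-like equation, i.e. a choice of coefficients $c_{k,\alpha,b}\in\mathbb{R}$ (for $1\le k\le j$, $\alpha\in\mathbb{N}_0^{2k+1}$ with $|\alpha|=2(j-k)$, $b\in\{+,-\}^{2k+1}$) in $$i\partial_tu+(-1)^{j+1}\partial_x^{2j}u=\sum_{k=1}^{j}\ \sum_{\substack{b\in\{\pm\}^{2k+1}\\ \alpha\in\mathbb{N}_0^{2k+1},\ |\alpha|=2(j-k)}}c_{k,\alpha,b}\ \partial_x^{\alpha_1}v_{b_1}\prod_{\ell=1}^{k}\partial_x^{\alpha_{2\ell}}v_{b_{2\ell}}\,\partial_x^{\alpha_{2\ell+1}}v_{b_{2\ell+1}},\qquad v_+=u,\ v_-=\overline{u},$$ such that for the Cauchy problem for this equation with $u(t=0)=u_0$, $x\in\mathbb{R}$, the flow map $S:M^s_{2,p}(\mathbb{R})\times(-T,T)\to M^s_{2,p}(\mathbb{R})$ (for any $T>0$) cannot be uniformly continuous on bounded subsets.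
   Context: $\langle n\rangle=(1+n^2)^{1/2}$. For $n\in\mathbb{Z}$, $\widehat{\Box_nf}(\xi)=\psi(\xi-n)\hat f(\xi)$, where $\psi:\mathbb{R}\to\mathbb{R}$ is a smooth cut-off with $\operatorname{supp}\psi\subset[-\frac14,\frac54]$ and $\psi\equiv1$ on $[0,1]$. The modulation space $M^s_{2,p}(\mathbb{R})$ is the space of $u\in\mathcal{S}'(\mathbb{R})$ with $\|u\|_{M^s_{2,p}}=\big\|\langle n\rangle^s\|\Box_nu\|_{L^2(\mathbb{R})}\big\|_{\ell^p_n(\mathbb{Z})}<\infty$. The flow map is the map $S(u_0,t)=u(\cdot,t)$, where $u$ is the solution with datum $u_0$; in particular it agrees with smooth, spatially rapidly decaying classical solutions. Uniform continuity on bounded subsets is understood with respect to the data: for every bounded $B\subset M^s_{2,p}(\mathbb{R})$ and $\varepsilon>0$ there is $\delta>0$ such that $u_0,v_0\in B$, $\|u_0-v_0\|_{M^s_{2,p}}<\delta$ imply $\sup_{|t|<T}\|S(u_0,t)-S(v_0,t)\|_{M^s_{2,p}}<\varepsilon$. The claim is that this fails. *)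

(* Defs.v *)
From HB Require Import structures.
From mathcomp Require Import all_boot all_order all_algebra.
From mathcomp Require Import all_classical all_reals all_analysis.
From mathcomp Require Export complex.

Set Implicit Arguments.
Unset Strict Implicit.
Unset Printing Implicit Defensive.

Import Order.TTheory GRing.Theory Num.Theory.
Import numFieldNormedType.Exports.

Local Open Scope classical_set_scope.
Local Open Scope ring_scope.

Section ComplexCalculus.
Context {R : realType}.
Implicit Types (f : R -> R[i]) (z : R[i]).

Definition cabs z : R := Num.sqrt (complex.Re z ^+ 2 + complex.Im z ^+ 2).

Definition cexpi (x : R) : R[i] := (cos x +i* sin x)%C.

Definition re f : R -> R := fun x => complex.Re (f x).
Definition im f : R -> R := fun x => complex.Im (f x).

(* Derivatives of complex-valued functions of a real variable are taken
   componentwise; like [derive1n], [cderiv k f x] is total and is meaningful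
   when the derivatives up to order k exist. *)
Definition cderiv (k : nat) f : R -> R[i] :=
  fun x => (derive1n k (re f) x +i* derive1n k (im f) x)%C.

Definition cderivable f (x : R) : Prop :=
  derivable (re f) x 1 /\ derivable (im f) x 1.

Definition csmooth f : Prop := forall k x, cderivable (cderiv k f) x.

Definition cmeasurable f : Prop :=
  measurable_fun [set: R] (re f) /\ measurable_fun [set: R] (im f).

Definition cint f : R[i] :=
  ((\int[lebesgue_measure]_x re f x)%R +i*
   (\int[lebesgue_measure]_x im f x)%R)%C.

Definition is_schwartz f : Prop :=
  csmooth f /\
  forall m k, exists M : R, forall x, `|x| ^+ m * cabs (cderiv k f x) <= M.

Lemma is_schwartz0 : is_schwartz (fun=> 0).
Proof.
have cst0 k : derive1n k (fun=> 0 : R) = (fun=> 0).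
  by elim: k => // k IH; rewrite derive1nS IH; apply/funext => x;
     rewrite derive1_cst.
have d0 k : cderiv k (fun=> 0) = fun=> 0.
  by apply/funext => x; rewrite /cderiv /re /im /= cst0.
split=> [k x|m k].
  by rewrite d0; split; exact: derivable_cst.
exists 0 => x; rewrite d0 /cabs /= expr0n /= addr0 sqrtr0 mulr0; exact: lexx.
Qed.

End ComplexCalculus.

(* Unitary normalisation, with angular frequency, so that [fourier_inv]
   inverts [fourier] on Schwartz functions. *)
Definition fourier {R : realType} (f : R -> R[i]) : R -> R[i] :=
  fun xi => ((Num.sqrt (2 * pi))^-1)%:C%C * cint (fun x => cexpi (- (x * xi)) * f x).

Definition fourier_inv {R : realType} (f : R -> R[i]) : R -> R[i] :=
  fun x => ((Num.sqrt (2 * pi))^-1)%:C%C * cint (fun xi => cexpi (x * xi) * f xi).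

Record schwartz (R : realType) : Type :=
  Schwartz { schwartz_fun :> R -> R[i]; schwartzP : is_schwartz schwartz_fun }.

(* The default value 0 is irrelevant below: [to_schwartz] is only applied to
   (inverse) Fourier transforms of Schwartz functions and to products of
   Schwartz functions with smooth compactly supported ones, and all of these
   are Schwartz functions. *)
Definition to_schwartz {R : realType} (f : R -> R[i]) : schwartz R :=
  match pselect (is_schwartz f) with
  | left h => Schwartz h
  | right _ => Schwartz is_schwartz0
  end.

Section Distributions.
Context {R : realType}.

Definition functional : Type := schwartz R -> R[i].
Implicit Types (u v : functional) (psi : R -> R).

Definition schwartz_cvg0 (phi : nat -> schwartz R) : Prop :=
  forall (m k : nat) (e : R), 0 < e ->
    \forall i \near \oo, forall x, `|x| ^+ m * cabs (cderiv k (phi i) x) <= e.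

(* S'(R): by linearity and metrizability of S(R), continuity amounts to
   sequential continuity at 0. *)
Definition tempered u : Prop :=
  (forall (a : R[i]) (f g h : schwartz R),
     (forall x, h x = a * f x + g x) -> u h = a * u f + u g) /\
  (forall phi : nat -> schwartz R, schwartz_cvg0 phi ->
     (fun i => cabs (u (phi i))) @ \oo --> (0 : R)).

Definition distr (f : R -> R[i]) : functional :=
  fun phi => cint (fun x => f x * phi x).

Definition dfourier u : functional := fun phi => u (to_schwartz (fourier phi)).
Definition dfourier_inv u : functional :=
  fun phi => u (to_schwartz (fourier_inv phi)).
Definition dmul (g : R -> R) u : functional :=
  fun phi => u (to_schwartz (fun x => (g x)%:C%C * phi x)).

Definition is_cutoff psi : Prop :=
  [/\ forall k (x : R), derivable (derive1n k psi) x 1,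
      closure [set x | psi x != 0] `<=` [set x | - (1 / 4) <= x <= 5 / 4]
    & forall x : R, 0 <= x <= 1 -> psi x = 1].

Definition box psi (n : int) u : functional :=
  dfourier_inv (dmul (fun xi => psi (xi - n%:~R)) (dfourier u)).

Definition fun_L2norm (f : R -> R[i]) : \bar R :=
  ('N[lebesgue_measure]_2%:E[EFin \o (cabs \o f)])%E.

(* The L^2 norm of a functional: that of the (a.e. unique) square-integrable
   function representing it, and +oo (the infimum of the empty set) if there
   is none. *)
Definition L2norm u : \bar R :=
  ereal_inf [set fun_L2norm f | f in [set f : R -> R[i] |
    [/\ cmeasurable f, (fun_L2norm f < +oo)%E & u = distr f]]].

(* The l^p(Z) norm of a nonnegative sequence; only used for p >= 2. *)
Definition lpnorm (p : \bar R) (a : int -> \bar R) : \bar R :=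
  match p with
  | p'%:E => (esum [set: int] (fun n => a n `^ p') `^ p'^-1)%E
  | +oo%E => ereal_sup (range a)
  | -oo%E => 0%E
  end.

Definition japanese (n : int) : R := Num.sqrt (1 + n%:~R ^+ 2).

Definition Mnorm psi (s : R) (p : \bar R) u : \bar R :=
  lpnorm p (fun n => ((japanese n `^ s)%:E * L2norm (box psi n u))%E).

Definition Mspace psi (s : R) (p : \bar R) : set functional :=
  [set u | tempered u /\ (Mnorm psi s p u < +oo)%E].

End Distributions.
Arguments functional R : clear implicits.

(* Coefficients c k alpha b, with alpha ranging over the multi-indices of
   length 2k+1 with entries at most 2(j-k), and b i = true for the sign +. *)
Definition coefficients (R : realType) (j : nat) : Type :=
  forall k : nat, {ffun 'I_(2 * k + 1) -> 'I_(2 * (j - k)).+1} ->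
                  {ffun 'I_(2 * k + 1) -> bool} -> R.

Section NLSLike.
Context {R : realType}.

Definition vpm (b : bool) (f : R -> R[i]) : R -> R[i] :=
  fun x => if b then f x else (f x)^*%C.

Definition nonlinearity (j : nat) (c : coefficients R j) (f : R -> R[i])
    (x : R) : R[i] :=
  \sum_(1 <= k < j.+1)
    \sum_(b : {ffun 'I_(2 * k + 1) -> bool})
      \sum_(alpha : {ffun 'I_(2 * k + 1) -> 'I_(2 * (j - k)).+1} |
            (\sum_i alpha i == 2 * (j - k))%N)
        (c k alpha b)%:C%C * \prod_i cderiv (alpha i) (vpm (b i) f) x.

(* Functions of (t, x) are written u t x. *)
Definition dt (a : nat) (u : R -> R -> R[i]) : R -> R -> R[i] :=
  fun t x => cderiv a (fun t' => u t' x) t.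
Definition dx (b : nat) (u : R -> R -> R[i]) : R -> R -> R[i] :=
  fun t => cderiv b (u t).

(* Smoothness on (-T,T) x R: all the derivatives d_t^a d_x^b u exist and are
   jointly continuous. *)
Definition smooth_on_strip (T : R) (u : R -> R -> R[i]) : Prop :=
  forall (a b : nat) (t x : R), `|t| < T ->
    [/\ cderivable (dx b u t) x,
        cderivable (fun t' => dt a (dx b u) t' x) t,
        {for (t, x), continuous (fun z : R * R => complex.Re (dt a (dx b u) z.1 z.2))}
      & {for (t, x), continuous (fun z : R * R => complex.Im (dt a (dx b u) z.1 z.2))}].

Definition rapid_decay (T : R) (u : R -> R -> R[i]) : Prop :=
  forall (m a b : nat) (T' : R), T' < T ->
    exists M : R, forall t x, `|t| <= T' -> `|x| ^+ m * cabs (dt a (dx b u) t x) <= M.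

Definition classical_solution (j : nat) (c : coefficients R j) (T : R)
    (u : R -> R -> R[i]) : Prop :=
  [/\ smooth_on_strip T u,
      rapid_decay T u
    & forall t x, `|t| < T ->
        'i%C * dt 1 u t x + (-1) ^+ j.+1 * dx (2 * j) u t x
        = nonlinearity c (u t) x].

(* S : M^s_{2,p} x (-T,T) -> M^s_{2,p} agreeing with the smooth, spatially
   rapidly decaying solutions; S is total and unconstrained elsewhere. *)
Definition flow_map psi (s : R) (p : \bar R) (j : nat) (c : coefficients R j)
    (T : R) (S : functional R -> R -> functional R) : Prop :=
  (forall u0 t, Mspace psi s p u0 -> `|t| < T -> Mspace psi s p (S u0 t)) /\
  (forall u, classical_solution c T u ->
     forall t, `|t| < T -> S (distr (u 0)) t = distr (u t)).

Definition unif_continuous_on_bounded psi (s : R) (p : \bar R) (T : R)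
    (S : functional R -> R -> functional R) : Prop :=
  forall B : set (functional R), B `<=` Mspace psi s p ->
    (exists K : R, forall u, B u -> (Mnorm psi s p u <= K%:E)%E) ->
  forall e : R, 0 < e -> exists2 d : R, 0 < d &
    forall u0 v0, B u0 -> B v0 -> (Mnorm psi s p (u0 - v0)%R < d%:E)%E ->
      (ereal_sup [set Mnorm psi s p (S u0 t - S v0 t)%R | t in [set t | (`|t| < T)%R]]
       < e%:E)%E.

End NLSLike.

(* Main.v *)
Require Import Defs.
From mathcomp Require Import all_boot all_order all_algebra.
From mathcomp Require Import all_classical all_reals all_analysis.
From mathcomp Require Import measurable_realfun ring lra zify.

(* The solitons are u = e^{i k t} G(x - V t) with G(y) = e^{i N y} a sech (a y).
   With u_x = q u one has q_x = - |u|^2, and q - conj q = 2 i N and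
   |q|^2 + |u|^2 = N^2 + a^2 are constant. Hence d_x^{2j} u is, up to a
   differential polynomial in u with real coefficients independent of N and a,
   a combination of u and q u = u_x: taking this polynomial as the nonlinearity
   makes all the solitons solutions, with V of order N^(2j-1).
   Take two of them with frequencies N near n and N + eta a, and the amplitude
   a = kappa <n>^(-2s), for which both have norm of order sqrt kappa. At time 0
   they differ by O(eta sqrt kappa). The centres drift apart at a speed of order
   eta a n^(2j-2); measured in widths 1/a, the distance at a fixed time is of
   order eta n^(2j-2-4s), which is unbounded since s < (j-1)/2, so that the
   difference has norm of order sqrt kappa again. *)

Set Implicit Arguments.
Unset Strict Implicit.
Unset Printing Implicit Defensive.

Import Order.TTheory GRing.Theory Num.Theory.
Import numFieldNormedType.Exports.

Local Open Scope classical_set_scope.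
Local Open Scope ring_scope.

(** The count of factors plus derivatives governs the algebra: the terms allowed in the equation are
    those with an odd number of factors, at least 3, and total 2j+1. With p = |u|^2, everything in
    d_x^(2j) u except u q^(2j) is divisible by p, and the same holds for the value that the
    constants prescribe; in the difference u q^(2j) cancels, so no linear term survives. What has to
    become a differential polynomial is u q^m, by induction on m. Norms are estimated in frequency.
    The transform of a soliton is a unimodular factor times one fixed Schwartz function of (xi -
    N)/a, so the bounds are uniform in n and time enters through phases only. Upper bounds come from
    pointwise bounds on inverse transforms. The lower bound pairs the difference with the conjugate
    of one soliton, and the separation makes the cross term an oscillatory integral. The order of
    the choices matters: the coefficients depend on j only; kappa is fixed small, so that most of
    the mass lies where the cutoff is 1; then delta is given, eta is chosen from it, and only then
    n, from eta and the time T/2. *)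

Local Notation cRe := complex.Re.
Local Notation cIm := complex.Im.

(** * Complex-valued functions of a real variable *)

Section ComplexModulus.
Context {R : realType}.
Implicit Types (z w : R[i]) (x y : R).

Lemma cReD z w : cRe (z + w) = cRe z + cRe w. Proof. by case: z w => [? ?] []. Qed.
Lemma cImD z w : cIm (z + w) = cIm z + cIm w. Proof. by case: z w => [? ?] []. Qed.
Lemma cReN z : cRe (- z) = - cRe z. Proof. by case: z. Qed.
Lemma cImN z : cIm (- z) = - cIm z. Proof. by case: z. Qed.
Lemma cReM z w : cRe (z * w) = cRe z * cRe w - cIm z * cIm w.
Proof. by case: z w => [? ?] []. Qed.
Lemma cImM z w : cIm (z * w) = cRe z * cIm w + cIm z * cRe w.
Proof. by case: z w => [? ?] [] * /=; rewrite addrC. Qed.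
Lemma cReJ z : cRe z^*%C = cRe z. Proof. by case: z. Qed.
Lemma cImJ z : cIm z^*%C = - cIm z. Proof. by case: z. Qed.
Definition cplxE := (cReD, cImD, cReN, cImN, cReM, cImM, cReJ, cImJ).

Lemma conjcM z w : (z * w)^*%C = z^*%C * w^*%C.
Proof. exact: rmorphM. Qed.
Lemma real_complexM x y : (x * y)%:C%C = x%:C%C * y%:C%C.
Proof. exact: rmorphM. Qed.

Lemma real_complexD x y : (x + y)%:C%C = x%:C%C + y%:C%C.
Proof. exact: rmorphD. Qed.
Lemma real_complexN x : (- x)%:C%C = - x%:C%C.
Proof. exact: rmorphN. Qed.
Lemma real_complexX x n : (x ^+ n)%:C%C = x%:C%C ^+ n.
Proof. exact: rmorphXn. Qed.
Definition real_complexE := (real_complexD, real_complexN, real_complexM, real_complexX).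

Lemma cplx_ext z w : cRe z = cRe w -> cIm z = cIm w -> z = w.
Proof. by case: z w => [? ?] [? ?] /= -> ->. Qed.

Lemma cabsE z : cabs z = Normc.normc z. Proof. by case: z. Qed.
Lemma cabs_ge0 z : 0 <= cabs z. Proof. exact: sqrtr_ge0. Qed.
Lemma cabsM z w : cabs (z * w) = cabs z * cabs w.
Proof. by rewrite !cabsE Normc.normcM. Qed.
Lemma cabsD z w : cabs (z + w) <= cabs z + cabs w.
Proof. by rewrite !cabsE le_normcD. Qed.
Lemma cabsN z : cabs (- z) = cabs z.
Proof. by rewrite !cabsE normcN. Qed.
Lemma cabsJ z : cabs z^*%C = cabs z.
Proof. by rewrite /cabs cReJ cImJ sqrrN. Qed.
Lemma cabs_real x : cabs x%:C%C = `|x|.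
Proof. by rewrite /cabs /= expr0n /= addr0 sqrtr_sqr. Qed.
Lemma cabs0 : cabs (0 : R[i]) = 0.
Proof. by rewrite cabsE Normc.normc0. Qed.
Lemma cabs_expi x : cabs (cexpi x) = 1.
Proof. by rewrite /cabs /= cos2Dsin2 sqrtr1. Qed.
Lemma cabs_i : cabs ('i%C : R[i]) = 1.
Proof. by rewrite /cabs /= expr0n /= expr1n add0r sqrtr1. Qed.
Lemma le_cRe_cabs z : `|cRe z| <= cabs z.
Proof. by rewrite -sqrtr_sqr ler_sqrt ?lerDl ?addr_ge0 ?sqr_ge0. Qed.
Lemma le_cIm_cabs z : `|cIm z| <= cabs z.
Proof. by rewrite -sqrtr_sqr ler_sqrt ?lerDr ?addr_ge0 ?sqr_ge0. Qed.
Lemma cabs_le_ReIm z : cabs z <= `|cRe z| + `|cIm z|.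
Proof.
rewrite {1}[z]complexE (le_trans (cabsD _ _))// cabsM cabs_i mul1r !cabs_real.
exact: lexx.
Qed.
Lemma sqr_cabs z : cabs z ^+ 2 = cRe z ^+ 2 + cIm z ^+ 2.
Proof. by rewrite sqr_sqrtr// addr_ge0 ?sqr_ge0. Qed.
Lemma mulcJ z : z * z^*%C = (cabs z ^+ 2)%:C%C.
Proof. by rewrite sqr_cabs; apply: cplx_ext; rewrite !cplxE /=; ring. Qed.

Lemma cexpiD x y : cexpi (x + y) = cexpi x * cexpi y :> R[i].
Proof.
apply: cplx_ext; rewrite !cplxE /=; first by rewrite cosD.
by rewrite sinD; ring.
Qed.
Lemma cexpi0 : cexpi 0 = 1 :> R[i].
Proof. by rewrite /cexpi cos0 sin0. Qed.
Lemma cexpiN x : cexpi (- x) = (cexpi x)^*%C :> R[i].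
Proof. by rewrite /cexpi cosN sinN. Qed.

End ComplexModulus.

Section ComplexDerivative.
Context {R : realType}.
Implicit Types (f g : R -> R[i]) (x y : R) (d e z : R[i]).

Definition has_cderiv f x d :=
  is_derive x 1 (re f) (cRe d) /\ is_derive x 1 (im f) (cIm d).

Lemma has_cderivP f x d : has_cderiv f x d -> cderivable f x /\ cderiv 1 f x = d.
Proof.
case=> dre dim; split; first by split; [case: dre|case: dim].
by apply: cplx_ext; [case: dre => _ <-|case: dim => _ <-]; rewrite -derive1E.
Qed.

Lemma cderivableP f x : cderivable f x -> has_cderiv f x (cderiv 1 f x).
Proof. case=> dre dim.
exact: (conj (DeriveDef dre (esym (derive1E _ _))) (DeriveDef dim (esym (derive1E _ _)))). Qed.

Lemma cderiv0 f : cderiv 0 f = f.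
Proof. by apply/funext => x; apply: cplx_ext. Qed.

Lemma cderivS k f : cderiv k.+1 f = cderiv 1 (cderiv k f).
Proof. by []. Qed.

Lemma cderivD k l f : cderiv (k + l) f = cderiv k (cderiv l f).
Proof. by elim: k => [|k IH]; rewrite ?cderiv0// addSn cderivS IH. Qed.

Lemma has_cderiv_cst z x : has_cderiv (fun=> z) x 0.
Proof. by split; exact: is_derive_cst. Qed.

Lemma has_cderivD f g x d e : has_cderiv f x d -> has_cderiv g x e ->
  has_cderiv (fun y => f y + g y) x (d + e).
Proof.
case=> fr fi [gr gi]; split; rewrite ?cplxE.
  by rewrite [re _](_ : _ = re f + re g); [exact: is_deriveD|apply/funext => y; rewrite /re cplxE].
by rewrite [im _](_ : _ = im f + im g); [exact: is_deriveD|apply/funext => y; rewrite /im cplxE].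
Qed.

Lemma is_deriveMR (h k : R -> R) (x dh dk : R) :
  is_derive x 1 h dh -> is_derive x 1 k dk ->
  is_derive x 1 (fun y => h y * k y) (dh * k x + h x * dk).
Proof.
move=> hh hk; have /is_derive_eq := is_deriveM hh hk; apply.
by rewrite addrC; congr (_ + _); rewrite mulrC.
Qed.

Lemma has_cderivM f g x d e : has_cderiv f x d -> has_cderiv g x e ->
  has_cderiv (fun y => f y * g y) x (d * g x + f x * e).
Proof.
case=> fr fi [gr gi]; split.
  rewrite [re _](_ : _ = (fun y => re f y * re g y) - (fun y => im f y * im g y)).
    have /is_derive_eq := is_deriveB (is_deriveMR fr gr) (is_deriveMR fi gi).
    by apply; rewrite cReD !cReM /re /im; ring.
  by apply/funext => y; rewrite /re cReM.
rewrite [im _](_ : _ = (fun y => re f y * im g y) + (fun y => im f y * re g y)).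
  have /is_derive_eq := is_deriveD (is_deriveMR fr gi) (is_deriveMR fi gr).
  by apply; rewrite cImD !cImM /re /im; ring.
by apply/funext => y; rewrite /im cImM.
Qed.

Lemma has_cderivZ z f x d : has_cderiv f x d ->
  has_cderiv (fun y => z * f y) x (z * d).
Proof.
by move=> /(has_cderivM (has_cderiv_cst z x)); rewrite mul0r add0r.
Qed.

Lemma has_cderivN f x d : has_cderiv f x d -> has_cderiv (fun y => - f y) x (- d).
Proof.
move=> /(has_cderivZ (-1)); rewrite mulN1r.
by under [X in has_cderiv X]eq_fun do rewrite mulN1r.
Qed.

Lemma has_cderivB f g x d e : has_cderiv f x d -> has_cderiv g x e ->
  has_cderiv (fun y => f y - g y) x (d - e).
Proof. by move=> hf /has_cderivN; exact: has_cderivD. Qed.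

Lemma has_cderivJ f x d : has_cderiv f x d ->
  has_cderiv (fun y => (f y)^*%C) x d^*%C.
Proof.
case=> fr fi; split; rewrite ?cplxE.
  by rewrite [re _](_ : _ = re f)//; apply/funext => y; rewrite /re cplxE.
rewrite [im _](_ : _ = - im f); last by apply/funext => y; rewrite /im cplxE.
exact: is_deriveN.
Qed.

Lemma has_cderiv_real (h : R -> R) x (d : R) : is_derive x 1 h d ->
  has_cderiv (fun y => (h y)%:C%C) x d%:C%C.
Proof. by move=> hd; split => //=; exact: is_derive_cst. Qed.

Lemma is_derive_affine (h : R -> R) (a b x d : R) :
  is_derive (a * x + b) 1 h d -> is_derive x 1 (fun y => h (a * y + b)) (a * d).
Proof.
move=> hd; have da : is_derive x 1 (fun y : R => a * y + b) a.
  by apply: is_derive_eq; rewrite /GRing.scale/= ; ring.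
by have /is_derive_eq := @is_derive1_comp _ h (fun y => a * y + b) x _ _ hd da; apply; rewrite mulrC.
Qed.

Lemma has_cderiv_affine f (a b x : R) d : has_cderiv f (a * x + b) d ->
  has_cderiv (fun y => f (a * y + b)) x (a%:C%C * d).
Proof.
case=> fr fi; split; rewrite !cplxE /= mul0r ?subr0 ?addr0.
  exact: (is_derive_affine fr).
exact: (is_derive_affine fi).
Qed.

Lemma has_cderiv_cexpi (x : R) : has_cderiv cexpi x ('i%C * cexpi x).
Proof.
by split; rewrite !cplxE /= !(mul0r, mul1r, sub0r, add0r, addr0); apply: is_derive_eq.
Qed.

Lemma has_cderiv_expi_scale (N x : R) :
  has_cderiv (fun y => cexpi (N * y)) x ('i%C * N%:C%C * cexpi (N * x)).
Proof.
have := @has_cderiv_affine cexpi N 0 x _ (has_cderiv_cexpi _).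
rewrite addr0; under [X in has_cderiv X]eq_fun do rewrite addr0.
by rewrite mulrA [N%:C%C * _]mulrC.
Qed.

Lemma csmooth_cderiv k f : csmooth f -> csmooth (cderiv k f).
Proof. by move=> sf l x; rewrite -cderivD; exact: sf. Qed.

Lemma csmooth_has f x : csmooth f -> has_cderiv f x (cderiv 1 f x).
Proof. by move=> sf; apply: cderivableP; have := sf 0%N x; rewrite cderiv0. Qed.

Lemma has_cderiv_ext1 f g : (forall x, has_cderiv f x (g x)) -> cderiv 1 f = g.
Proof. by move=> fg; apply/funext => x; case: (has_cderivP (fg x)). Qed.

(* Coinduction principle: a class of functions stable under differentiation
   consists of smooth functions, and all their derivatives stay in it. *)
Lemma csmooth_class (P : (R -> R[i]) -> Prop) :
  (forall f, P f -> exists2 g, P g & forall x, has_cderiv f x (g x)) ->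
  forall f, P f -> csmooth f /\ forall k, P (cderiv k f).
Proof.
move=> hP f Pf.
have Pk k : P (cderiv k f).
  elim: k => [|k IH]; first by rewrite cderiv0.
  by rewrite cderivS; have [g Pg /has_cderiv_ext1 ->] := hP _ IH.
split=> // k x; have [g _ hg] := hP _ (Pk k).
by case: (has_cderivP (hg x)).
Qed.

(* The sums of products [f * g] with f in S and g in T form a class stable under
   differentiation, by the Leibniz rule. *)
Definition product_class (S T : (R -> R[i]) -> Prop) (h : R -> R[i]) :=
  exists s : seq ((R -> R[i]) * (R -> R[i])),
    (forall p, List.In p s -> S p.1 /\ T p.2) /\
    h = fun x => \sum_(p <- s) p.1 x * p.2 x.

Lemma product_classM (S T : (R -> R[i]) -> Prop) f g : S f -> T g ->
  product_class S T (fun x => f x * g x).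
Proof.
move=> Sf Tg; exists [:: (f, g)]; split.
  by move=> p [<-|[]]; exact: (conj Sf Tg).
by apply/funext => x; rewrite big_seq1.
Qed.

Lemma product_class_derive (S T : (R -> R[i]) -> Prop) :
  (forall f, S f -> csmooth f /\ S (cderiv 1 f)) ->
  (forall f, T f -> csmooth f /\ T (cderiv 1 f)) ->
  forall h, product_class S T h ->
    exists2 h', product_class S T h' & forall x, has_cderiv h x (h' x).
Proof.
move=> hS hT h [s []]; elim: s h => [|p s IH] h sP ->.
  exists (fun=> 0); first by exists [::]; split => //; apply/funext => x; rewrite big_nil.
  by move=> x; under [X in has_cderiv X]eq_fun do rewrite big_nil; exact: has_cderiv_cst.
have [|h' [s' [s'P ->]] hh'] := IH _ _ erefl; first by move=> q qs; apply: sP; right.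
have [p1 p2] := sP p (or_introl erefl).
have [sp1 dp1] := hS _ p1; have [sp2 dp2] := hT _ p2.
exists (fun x => \sum_(q <- (cderiv 1 p.1, p.2) :: (p.1, cderiv 1 p.2) :: s') q.1 x * q.2 x).
  exists ((cderiv 1 p.1, p.2) :: (p.1, cderiv 1 p.2) :: s'); split=> [q|]; last by [].
  case=> [<-|[<-|]]; last exact: s'P.
    exact: (conj dp1 p2).
  exact: (conj p1 dp2).
move=> x; rewrite !big_cons /=.
under [X in has_cderiv X]eq_fun do rewrite big_cons.
rewrite addrA; apply: has_cderivD; last exact: hh'.
by apply: has_cderivM; exact: csmooth_has.
Qed.

Lemma csmoothM f g : csmooth f -> csmooth g -> csmooth (fun x => f x * g x).
Proof.
move=> sf sg; have hs (h : R -> R[i]) : csmooth h -> csmooth h /\ csmooth (cderiv 1 h).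
  by move=> sh; exact: (conj sh (csmooth_cderiv 1 sh)).
exact: (proj1 (csmooth_class (product_class_derive hs hs) (product_classM sf sg))).
Qed.

End ComplexDerivative.

(** * Integrals *)

Section RealIntegrals.
Context {R : realType}.
Implicit Types (h k : R -> R) (a b x y M : R).

Local Notation mu := (@lebesgue_measure R).

(** The common majorant: decay is expressed below by multiples of its powers. Its primitive is
    [atan], which gives explicit constants in terms of [pi]. *)
Definition weight x : R := (1 + x ^+ 2)^-1.

Lemma weight_gt0 x : 0 < weight x.
Proof. by rewrite invr_gt0 ltr_pwDl// sqr_ge0. Qed.

Lemma weight_ge0 x : 0 <= weight x.
Proof. exact/ltW/weight_gt0. Qed.

Lemma weight_le1 x : weight x <= 1.
Proof. by rewrite invf_le1 ?lerDl ?sqr_ge0// ltr_pwDl// sqr_ge0. Qed.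

Lemma continuous_weight : continuous weight.
Proof. exact: continuous_oneDsqrV. Qed.

Lemma weightN x : weight (- x) = weight x.
Proof. by rewrite /weight sqrrN. Qed.

Lemma integral_weight : (\int[mu]_x (weight x)%:E = (pi : R)%:E)%E.
Proof.
rewrite (ge0_symfun_integralT weight_ge0 continuous_weight); last first.
  by move=> x /=; rewrite weightN.
rewrite -set_itvcy (@integral0y_oneDsqr R) -EFinM.
by congr EFin; field.
Qed.

Lemma integrable_weight : mu.-integrable [set: R] (EFin \o weight).
Proof.
apply/integrableP; split.
  by apply/measurable_EFinP; apply: continuous_measurable_fun; exact: continuous_weight.
suff -> : (\int[mu]_x `|(EFin \o weight) x| = \int[mu]_x (weight x)%:E)%E.
  by rewrite integral_weight ltry.
by apply: eq_integral => x _ /=; rewrite ger0_norm ?weight_ge0.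
Qed.

Lemma integral_affine h a b : 0 < a -> continuous h -> (forall x, 0 <= h x) ->
  (\int[mu]_x (h x)%:E = \int[mu]_x (a * h (a * x + b))%:E)%E.
Proof.
move=> a0 ch h0; pose F x := a * x + b.
have dF x : is_derive x 1 F a.
  have := @is_derive_affine _ (@id R) a b x 1 (is_derive_id _ _).
  by rewrite mulr1.
have F'E : derive1 F = (fun=> a).
  by apply/funext => x; rewrite derive1E; case: (dF x).
rewrite (@increasing_ge0_integration_by_substitutionT _ F h)//.
- by apply: eq_integral => x _; rewrite F'E mulrC.
- by move=> x y xy; rewrite /F ltrD2r ltr_pM2l.
- by rewrite F'E => x; exact: cvg_cst.
- by rewrite F'E; exact: is_cvg_cst.
- by rewrite F'E; exact: is_cvg_cst.
- exact: (cvg_comp _ _ (gt0_cvgMrNy a0 cvg_id) (cvg_addrr_Ny b)).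
- exact: (cvg_comp _ _ (gt0_cvgMry a0 cvg_id) (cvg_addrr b)).
Qed.


Lemma integrable_le h k : measurable_fun setT h -> (forall x, `|h x| <= k x) ->
  mu.-integrable [set: R] (EFin \o k) -> mu.-integrable [set: R] (EFin \o h).
Proof.
move=> mh hk; apply: le_integrable => //; first exact/measurable_EFinP.
by move=> x _ /=; rewrite lee_fin (le_trans (hk x)) ?ler_norm.
Qed.

Lemma integrable_weightZ M : mu.-integrable [set: R] (EFin \o (fun x => M * weight x)).
Proof.
rewrite (_ : _ \o _ = fun x => (M%:E * (EFin \o weight) x)%E)//.
exact: integrableZl integrable_weight.
Qed.

Lemma Rintegral_weightZ M : (\int[mu]_x (M * weight x) = M * pi)%R.
Proof.
rewrite RintegralZl//; last exact: integrable_weight.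
by rewrite /Rintegral integral_weight.
Qed.

Lemma integrable_affine h a b : 0 < a -> continuous h ->
  mu.-integrable [set: R] (EFin \o h) ->
  mu.-integrable [set: R] (EFin \o (fun x => h (a * x + b))).
Proof.
move=> a0 ch /integrableP[_ hoo].
have caff : continuous (fun x : R => h (a * x + b)).
  move=> x; apply: continuous_comp; last exact: ch.
  apply: cvgD; last exact: cvg_cst.
  by apply: cvgM; [exact: cvg_cst|exact: cvg_id].
apply/integrableP; split.
  by apply/measurable_EFinP; exact: continuous_measurable_fun caff.
have cnh : continuous (fun x => `|h x|).
  by move=> x; apply: continuous_comp; [exact: ch|exact: norm_continuous].
have := @integral_affine (fun x => `|h x|) a b a0 cnh (fun x => normr_ge0 _).
under [RHS]eq_integral do rewrite EFinM.
rewrite ge0_integralZl ?lee_fin ?ltW//; last first.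
  apply/measurable_EFinP; apply: measurableT_comp => //.
  exact: continuous_measurable_fun.
move=> E; move: hoo; rewrite /= E.
by rewrite muleC -lte_pdivlMr// => /lt_le_trans; apply; rewrite leey.
Qed.

(** The nonnegative case extends by writing [h] as the difference of [h + |h|] and [|h|], both
    nonnegative, continuous and integrable. *)
Lemma Rintegral_affine h a b : 0 < a -> continuous h ->
  mu.-integrable [set: R] (EFin \o h) ->
  (\int[mu]_x h x = a * \int[mu]_x h (a * x + b))%R.
Proof.
have nneg k : 0 < a -> continuous k -> (forall x, 0 <= k x) ->
    mu.-integrable [set: R] (EFin \o k) ->
    (\int[mu]_x k x = a * \int[mu]_x k (a * x + b))%R.
  move=> a0 ck k0 ik; rewrite -RintegralZl//; last exact: integrable_affine.
  by congr fine; exact: integral_affine.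
move=> a0 ch ih.
have cn : continuous (fun x => `|h x|).
  by move=> x; apply: continuous_comp; [exact: ch|exact: norm_continuous].
have inh : mu.-integrable [set: R] (EFin \o (fun x => `|h x|)).
  by have := integrable_abse ih.
have cs : continuous (fun x => h x + `|h x|).
  by move=> x; apply: cvgD; [exact: ch|exact: cn].
have hi : mu.-integrable [set: R] (EFin \o (fun x => h x + `|h x|)).
  have := integrableD measurableT ih inh.
  by apply: eq_integrable => // x _.
have E : (\int[mu]_x h x = \int[mu]_x (h x + `|h x|) - \int[mu]_x `|h x|)%R.
  by rewrite -RintegralB//; apply: eq_Rintegral => x _; rewrite addrK.
have E' : (\int[mu]_x h (a * x + b) =
    \int[mu]_x (h (a * x + b) + `|h (a * x + b)|) - \int[mu]_x `|h (a * x + b)|)%R.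
  rewrite -RintegralB//; first by apply: eq_Rintegral => x _; rewrite addrK.
    exact: (integrable_affine b a0 cs hi).
  exact: (integrable_affine b a0 cn inh).
rewrite E E' mulrBr; congr (_ - _); apply: nneg => // x.
by have := lerNnormlW (lexx `|h x|); rewrite -subr_ge0 opprK.
Qed.

Lemma cvg_weight0 : weight x @[x --> +oo%R] --> (0 : R).
Proof.
apply/cvgrPdist_le => e e0; near=> x.
rewrite sub0r normrN ger0_norm ?weight_ge0//.
have xe : e^-1 <= x by near: x; apply: nbhs_pinfty_ge; rewrite num_real.
have x1 : 1 <= x by near: x; apply: nbhs_pinfty_ge; rewrite num_real.
rewrite /weight invf_ple ?posrE ?ltr_pwDl ?sqr_ge0// (le_trans xe)//.
by rewrite expr2; nra.
Unshelve. all: by end_near. Qed.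

Lemma cvgy_bounded (F : R -> R) M : (forall x, `|F x| <= M * weight x) ->
  F x @[x --> +oo%R] --> (0 : R).
Proof.
move=> FM; apply: norm_cvg0.
apply: (@squeeze_cvgr _ _ _ _ (cst 0) (fun x => M * weight x)).
- by near=> x; rewrite normr_ge0 FM.
- exact: cvg_cst.
- by rewrite -(mulr0 M); apply: cvgM; [exact: cvg_cst|exact: cvg_weight0].
Unshelve. all: by end_near. Qed.

Lemma is_derive_continuous (F f : R -> R) : (forall x, is_derive x 1 F (f x)) ->
  continuous F.
Proof. by move=> dF x; apply/differentiable_continuous/derivable1_diffP; case: (dF x). Qed.

(** Adding [M * weight] makes the integrand nonnegative, as the improper fundamental theorem of
    calculus requires. The primitive becomes [F + M * atan], with limit [M * (pi / 2)] because [F]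
    vanishes at infinity. *)
Let integral_half (F f : R -> R) M : (forall x, is_derive x 1 F (f x)) ->
  continuous f -> (forall x, `|f x| <= M * weight x) ->
  (forall x, `|F x| <= M * weight x) ->
  (\int[mu]_(x in `[0%R, +oo[) (f x + M * weight x)%:E = (M * (pi / 2) - F 0)%:E)%E.
Proof.
move=> dF cf fM FM.
have dG (x : R) : is_derive x 1 (fun y => F y + M * atan y) (f x + M * weight x).
  apply: is_deriveD.
have cG := is_derive_continuous dG.
rewrite (@ge0_continuous_FTC2y _ _ (fun y => F y + M * atan y) _ (M * (pi / 2))).
- by rewrite atan0 mulr0 addr0 -EFinB.
- by move=> x _; move: (fM x); rewrite ler_norml => /andP[]; lra.
- apply: continuous_subspaceT => x; apply: cvgD; first exact: cf.
  by apply: cvgM; [exact: cvg_cst|exact: continuous_weight].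
- rewrite -[X in _ --> X]add0r; apply: cvgD; first exact: cvgy_bounded FM.
  by apply: cvgM; [exact: cvg_cst|exact: cvgy_atan].
- by move=> x _; case: (dG x).
- exact/cvg_at_right_filter/cG.
- by move=> x _; rewrite derive1E; case: (dG x).
Qed.

(** The two half-lines contribute [M * (pi / 2) - F 0] and [M * (pi / 2) + F 0] to the integral of
    [f + M * weight]. Their sum [M * pi] is the integral of [M * weight] alone. *)
Lemma Rintegral_derive0 (F f : R -> R) M : (forall x, is_derive x 1 F (f x)) ->
  continuous f -> (forall x, `|f x| <= M * weight x) ->
  (forall x, `|F x| <= M * weight x) -> (\int[mu]_x f x = 0)%R.
Proof.
move=> dF cf fM FM; pose g x := f x + M * weight x.
have cg : continuous g.
  move=> x; apply: cvgD; first exact: cf.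
  by apply: cvgM; [exact: cvg_cst|exact: continuous_weight].
have mg : measurable_fun [set: R] g by exact: continuous_measurable_fun.
have g0 x : 0 <= g x by move: (fM x); rewrite ler_norml => /andP[]; rewrite /g; lra.
(* After the reflection of the negative half-line, this is the primitive to which [integral_half]
   applies. *)
have dF' x : is_derive x 1 (fun y => - F (- y)) (f (- x)).
  have := @is_derive_affine _ F (-1) 0 x _ (dF _); rewrite addr0 !mulN1r.
  move=> /(@is_deriveN _ _ _ _ _ _ _); rewrite opprK.
  rewrite (_ : - _ = fun y => - F (- y))//.
  by apply/funext => y; rewrite fctE addr0 mulN1r.
have cN : continuous (fun x => f (- x)).
  by move=> x; apply: continuous_comp; [exact: opp_continuous|exact: cf].
have : (\int[mu]_x (g x)%:E = (M * pi)%:E)%E.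
  rewrite -(setUv [set x : R | 0 <= x]%R) ge0_integral_setU//= ; last 5 first.
    by rewrite -set_itvcy.
    by apply: measurableC; rewrite -set_itvcy.
    by apply/measurable_EFinP; rewrite setUv.
    by move=> x _; rewrite lee_fin.
    exact/disj_setPCl.
  rewrite -set_itvcy// (integral_half dF cf fM FM) setCitvr.
  rewrite integral_itv_bndo_bndc; last exact/measurable_EFinP/measurable_funTS.
  rewrite -{2}oppr0 ge0_integration_by_substitutionNy//; last exact: continuous_subspaceT.
  have := integral_half dF' cN (fun x => _) (fun x => _).
  move=> /(_ M); rewrite oppr0 => H.
  have -> : (\int[mu]_(x in `[0%R, +oo[) ((g \o -%R) x)%:E =
      \int[mu]_(x in `[0%R, +oo[) (f (- x) + M * weight x)%:E)%E.
    by apply: eq_integral => x _; rewrite /g /= weightN.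
  rewrite H => [|x|x]; [|by rewrite -(weightN x)|by rewrite normrN -(weightN x)].
  by rewrite -EFinD; congr EFin; field.
have ig : mu.-integrable [set: R] (EFin \o f).
  by apply: (integrable_le _ fM (integrable_weightZ M)); exact: continuous_measurable_fun.
move=> /(congr1 fine) /=; rewrite -/(Rintegral mu setT g).
rewrite RintegralD//; last exact: integrable_weightZ.
by rewrite Rintegral_weightZ => /(canRL (addrK _)); rewrite subrr.
Qed.

End RealIntegrals.

Section ComplexIntegrals.
Context {R : realType}.
Implicit Types (f g : R -> R[i]) (h k : R -> R) (a b x y M : R) (z : R[i]).

Local Notation mu := (@lebesgue_measure R).

Definition cintegrable f :=
  mu.-integrable [set: R] (EFin \o re f) /\ mu.-integrable [set: R] (EFin \o im f).

Definition ccontinuous f := continuous (re f) /\ continuous (im f).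

Lemma ccontinuous_measurable f : ccontinuous f -> cmeasurable f.
Proof. by move=> [cr ci]; split; exact: continuous_measurable_fun. Qed.

Lemma has_cderiv_continuous f g : (forall x, has_cderiv f x (g x)) -> ccontinuous f.
Proof.
move=> fg; split; apply: is_derive_continuous => x; first exact: (fg x).1.
exact: (fg x).2.
Qed.

Lemma csmooth_continuous f : csmooth f -> ccontinuous f.
Proof. by move=> sf; apply: has_cderiv_continuous => x; exact: csmooth_has. Qed.

Lemma ccontinuousM f g : ccontinuous f -> ccontinuous g ->
  ccontinuous (fun x => f x * g x).
Proof.
move=> [fr fi] [gr gi]; split.
  rewrite [re _](_ : _ = fun y => re f y * re g y - im f y * im g y).
    move=> x; apply: cvgB; apply: cvgM; by [exact: fr|exact: gr|exact: fi|exact: gi].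
  by apply/funext => y; rewrite /re cReM.
rewrite [im _](_ : _ = fun y => re f y * im g y + im f y * re g y).
  move=> x; apply: cvgD; apply: cvgM; by [exact: fr|exact: gr|exact: fi|exact: gi].
by apply/funext => y; rewrite /im cImM.
Qed.

Lemma cintegrable_le f k : cmeasurable f -> (forall x, cabs (f x) <= k x) ->
  mu.-integrable [set: R] (EFin \o k) -> cintegrable f.
Proof.
move=> [mr mi] fk ik; split; apply: integrable_le ik => //= x.
  exact: le_trans (le_cRe_cabs _) (fk x).
exact: le_trans (le_cIm_cabs _) (fk x).
Qed.

Lemma cintegrable_weight f M : ccontinuous f ->
  (forall x, cabs (f x) <= M * weight x) -> cintegrable f.
Proof.
move=> cf fM; apply: (cintegrable_le (ccontinuous_measurable cf) fM).
exact: integrable_weightZ.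
Qed.

Lemma eq_cint f g : (forall x, f x = g x) -> cint f = cint g.
Proof. by move=> fg; congr cint; apply/funext. Qed.

Lemma cintD f g : cintegrable f -> cintegrable g ->
  cint (fun x => f x + g x) = cint f + cint g.
Proof.
move=> [fr fi] [gr gi]; apply: cplx_ext; rewrite /cint !cplxE /= -RintegralD//;
  by apply: eq_Rintegral => x _; rewrite /re /im cplxE.
Qed.

Lemma integrableZR (r : R) h : mu.-integrable [set: R] (EFin \o h) ->
  mu.-integrable [set: R] (EFin \o (fun x => r * h x)).
Proof. by move=> ih; exact: (integrableZl measurableT r ih). Qed.

Lemma cintegrableZ z f : cintegrable f -> cintegrable (fun x => z * f x).
Proof.
move=> [fr fi]; split.
  have := integrableB measurableT (integrableZR (cRe z) fr) (integrableZR (cIm z) fi).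
  by apply: eq_integrable => // x _; rewrite /= /re cReM.
have := integrableD measurableT (integrableZR (cRe z) fi) (integrableZR (cIm z) fr).
by apply: eq_integrable => // x _; rewrite /= /im cImM.
Qed.

Lemma cintZ z f : cintegrable f -> cint (fun x => z * f x) = z * cint f.
Proof.
move=> [fr fi]; apply: cplx_ext; rewrite ?cplxE /=.
  rewrite -!RintegralZl// -RintegralB//; [|exact: integrableZR..].
  by apply: eq_Rintegral => x _; rewrite /re cReM.
rewrite -!RintegralZl// -RintegralD//; [|exact: integrableZR..].
by apply: eq_Rintegral => x _; rewrite /im cImM.
Qed.

Lemma cintN f : cintegrable f -> cint (fun x => - f x) = - cint f.
Proof.
by move=> fi; rewrite -mulN1r -cintZ//; apply: eq_cint => x; rewrite mulN1r.
Qed.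

Lemma cintegrableN f : cintegrable f -> cintegrable (fun x => - f x).
Proof.
move=> /(cintegrableZ (-1)).
by under [X in cintegrable X]eq_fun do rewrite mulN1r.
Qed.

Lemma cintB f g : cintegrable f -> cintegrable g ->
  cint (fun x => f x - g x) = cint f - cint g.
Proof. by move=> fi gi; rewrite cintD ?cintN//; exact: cintegrableN. Qed.

Lemma cintJ f : cintegrable f -> cint (fun x => (f x)^*%C) = (cint f)^*%C.
Proof.
move=> [fr fi]; apply: cplx_ext; rewrite ?cplxE /=.
  by apply: eq_Rintegral => x _; rewrite /re cReJ.
rewrite -mulN1r -RintegralZl//; apply: eq_Rintegral => x _.
by rewrite /im cImJ mulN1r.
Qed.

(** The factor 2 comes from bounding the real and imaginary parts separately; it reappears in all
    the constants below. *)
Lemma cabs_cint_le f k : cmeasurable f -> (forall x, cabs (f x) <= k x) ->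
  mu.-integrable [set: R] (EFin \o k) -> cabs (cint f) <= 2 * (\int[mu]_x k x)%R.
Proof.
move=> mf fk ik; have [fr fi] := cintegrable_le mf fk ik.
have nint h : mu.-integrable [set: R] (EFin \o h) ->
    (forall x, `|h x| <= k x) -> `|(\int[mu]_x h x)%R| <= (\int[mu]_x k x)%R.
  move=> ih hk; apply: (le_trans (le_normr_Rintegral measurableT ih)).
  by apply: le_Rintegral => //; exact: (integrable_abse ih).
rewrite (le_trans (cabs_le_ReIm _))// mulr_natl mulr2n lerD//.
  by apply: nint => // x; exact: le_trans (le_cRe_cabs _) (fk x).
by apply: nint => // x; exact: le_trans (le_cIm_cabs _) (fk x).
Qed.

Lemma cabs_cint_weight f M : ccontinuous f ->
  (forall x, cabs (f x) <= M * weight x) -> cabs (cint f) <= 2 * (M * pi).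
Proof.
move=> cf fM; rewrite -Rintegral_weightZ.
apply: cabs_cint_le => //; first exact: ccontinuous_measurable.
exact: integrable_weightZ.
Qed.

Lemma cint_affine f a b : 0 < a -> ccontinuous f -> cintegrable f ->
  cint f = a%:C%C * cint (fun x => f (a * x + b)).
Proof.
move=> a0 [cr ci] [ir ii]; apply: cplx_ext; rewrite !cplxE /= mul0r ?subr0 ?addr0.
  by rewrite (@Rintegral_affine _ _ a b).
by rewrite (@Rintegral_affine _ _ a b).
Qed.

Lemma cintegrable_affine f a b : 0 < a -> ccontinuous f -> cintegrable f ->
  cintegrable (fun x => f (a * x + b)).
Proof.
move=> a0 [cr ci] [ir ii]; split.
  exact: (integrable_affine b a0 cr ir).
exact: (integrable_affine b a0 ci ii).
Qed.

Lemma cint_derive0 (F f : R -> R[i]) M : (forall x, has_cderiv F x (f x)) ->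
  ccontinuous f -> (forall x, cabs (f x) <= M * weight x) ->
  (forall x, cabs (F x) <= M * weight x) -> cint f = 0.
Proof.
move=> Ff [cr ci] fM FM; apply: cplx_ext => /=.
  apply: (@Rintegral_derive0 _ (re F) _ M) => // x; first exact: (Ff x).1.
    exact: le_trans (le_cRe_cabs _) (fM x).
  exact: le_trans (le_cRe_cabs _) (FM x).
apply: (@Rintegral_derive0 _ (im F) _ M) => // x; first exact: (Ff x).2.
  exact: le_trans (le_cIm_cabs _) (fM x).
exact: le_trans (le_cIm_cabs _) (FM x).
Qed.

Lemma is_derive_Rintegral (K K' : R -> R -> R) M (xi : R) :
  (forall t x : R, is_derive t 1 (K^~ x) (K' t x)) -> (forall t, continuous (K t)) ->
  (forall t x, `|K t x| <= M * weight x) -> (forall t x, `|K' t x| <= M * weight x) ->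
  is_derive xi 1 (fun t => \int[mu]_x K t x)%R (\int[mu]_x K' xi x)%R.
Proof.
move=> dK cK KM K'M.
have iK t : mu.-integrable [set: R] (EFin \o K t).
  apply: (integrable_le _ (KM t) (integrable_weightZ M)).
  exact: continuous_measurable_fun.
have W0 x : 0 <= M * weight x by exact: le_trans (normr_ge0 _) (KM 0 x).
(* Any open interval around [xi] would do, since the domination is uniform in [t]. *)
have xiI : `]xi - 1, xi + 1[%classic xi by rewrite /= in_itv /=; apply/andP; split; lra.
have d1 t x : partial1of2 K t x = K' t x.
  by rewrite partial1of2E; case: (dK t x).
apply: DeriveDef.
  apply: (@derivable_under_integral _ _ _ mu K [set: R] measurableT xi _ _ xiI
    (fun t _ => iK t) _ _ W0 (integrable_weightZ M)).
    by move=> t x _ _; case: (dK t x).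
  by move=> t x _ _; rewrite d1.
rewrite -derive1E.
rewrite (@differentiation_under_integral _ _ _ mu K [set: R] measurableT xi _ _ xiI
    (fun t _ => iK t) _ _ W0 (integrable_weightZ M)).
- by apply: eq_Rintegral => x _; rewrite d1.
- by move=> t x _ _; case: (dK t x).
- by move=> t x _ _; rewrite d1.
Qed.

Lemma has_cderiv_cint (K K' : R -> R -> R[i]) M (xi : R) :
  (forall t x, has_cderiv (K^~ x) t (K' t x)) -> (forall t, ccontinuous (K t)) ->
  (forall t x, cabs (K t x) <= M * weight x) ->
  (forall t x, cabs (K' t x) <= M * weight x) ->
  has_cderiv (fun t => cint (K t)) xi (cint (K' xi)).
Proof.
move=> dK cK KM K'M; split.
  apply: (@is_derive_Rintegral (fun t => re (K t)) (fun t => re (K' t)) M).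
  - by move=> t x; exact: (dK t x).1.
  - by move=> t; case: (cK t).
  - by move=> t x; exact: le_trans (le_cRe_cabs _) (KM t x).
  - by move=> t x; exact: le_trans (le_cRe_cabs _) (K'M t x).
apply: (@is_derive_Rintegral (fun t => im (K t)) (fun t => im (K' t)) M).
- by move=> t x; exact: (dK t x).2.
- by move=> t; case: (cK t).
- by move=> t x; exact: le_trans (le_cIm_cabs _) (KM t x).
- by move=> t x; exact: le_trans (le_cIm_cabs _) (K'M t x).
Qed.

(** The product of two weights has the finite iterated integral [pi ^+ 2], so Tonelli gives
    integrability on the plane and Fubini applies. *)
Lemma Rintegral_fubini (h : R -> R -> R) M :
  measurable_fun [set: R * R] (fun w : R * R => h w.1 w.2) ->
  (forall x y, `|h x y| <= M * weight x * weight y) ->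
  (\int[mu]_x \int[mu]_y h x y = \int[mu]_y \int[mu]_x h x y)%R.
Proof.
move=> mh hM.
pose H (w : R * R) := (h w.1 w.2)%:E.
have mH : measurable_fun [set: R * R] H by exact/measurable_EFinP.
have M0 : 0 <= M.
  have := hM 0 0; rewrite /weight expr0n addr0 invr1 !mulr1.
  exact: le_trans.
have iH : (mu \x mu)%E.-integrable [set: R * R] H.
  apply/integrable12ltyP => //.
  apply: (@le_lt_trans _ _ (\int[mu]_x (M * pi * weight x)%:E)%E).
    apply: ge0_le_integral => //.
    - by move=> x _; apply: integral_ge0.
    - apply: (@measurable_fun_fubini_tonelli_F _ _ _ _ _ mu (fun w => `|H w|%E)) => //.
      exact: measurableT_comp.
    - apply/measurable_EFinP; apply: continuous_measurable_fun => x.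
      by apply: cvgM; [exact: cvg_cst|exact: continuous_weight].
    - move=> x _; apply: (@le_trans _ _ (\int[mu]_y (M * weight x * weight y)%:E)%E).
        apply: ge0_le_integral => //.
        + by apply: measurableT_comp => //; apply: measurableT_comp => //.
        + apply/measurable_EFinP; apply: continuous_measurable_fun => y.
          by apply: cvgM; [exact: cvg_cst|exact: continuous_weight].
        + by move=> y _; rewrite lee_fin; exact: hM.
      under eq_integral do rewrite EFinM.
      rewrite ge0_integralZl ?integral_weight ?lee_fin ?mulr_ge0 ?weight_ge0//.
      + by rewrite mulrAC.
      + by apply/measurable_EFinP; apply: continuous_measurable_fun; exact: continuous_weight.
      + by move=> y _; rewrite lee_fin weight_ge0.
  under eq_integral do rewrite EFinM.
  rewrite ge0_integralZl ?integral_weight ?lee_fin ?mulr_ge0 ?pi_ge0 ?ltry//.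
  + by apply/measurable_EFinP; apply: continuous_measurable_fun; exact: continuous_weight.
  + by move=> y _; rewrite lee_fin weight_ge0.
have ix x : mu.-integrable [set: R] (EFin \o h x).
  apply: (integrable_le _ (hM x) (integrable_weightZ _)).
  by apply: (measurableT_comp mh (pair1_measurable x)).
have iy y : mu.-integrable [set: R] (EFin \o h^~ y).
  apply: (@integrable_le _ (h^~ y) _ _ _ (integrable_weightZ (M * weight y))).
    by apply: (measurableT_comp mh (pair2_measurable y)).
  by move=> x; rewrite (le_trans (hM x y))// mulrAC.
rewrite /Rintegral; congr fine.
rewrite (_ : (\int[mu]_x _)%E = (\int[mu]_x \int[mu]_y H (x, y))%E).
  rewrite (_ : (\int[mu]_y (fine _)%:E)%E = (\int[mu]_y \int[mu]_x H (x, y))%E).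
    exact: Fubini.
  apply: eq_integral => y _; rewrite fineK//.
  by apply: integrable_fin_num => //; exact: iy.
apply: eq_integral => x _; rewrite fineK//.
by apply: integrable_fin_num => //; exact: ix.
Qed.

Lemma cint_fubini (H : R -> R -> R[i]) M :
  measurable_fun [set: R * R] (fun w : R * R => cRe (H w.1 w.2)) ->
  measurable_fun [set: R * R] (fun w : R * R => cIm (H w.1 w.2)) ->
  (forall x y, cabs (H x y) <= M * weight x * weight y) ->
  cint (fun x => cint (H x)) = cint (fun y => cint (H^~ y)).
Proof.
move=> mr mi HM; apply: cplx_ext => /=.
  apply: (@Rintegral_fubini (fun x y => cRe (H x y)) M) => // x y.
  exact: le_trans (le_cRe_cabs _) (HM x y).
apply: (@Rintegral_fubini (fun x y => cIm (H x y)) M) => // x y.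
exact: le_trans (le_cIm_cabs _) (HM x y).
Qed.

End ComplexIntegrals.

(** * Schwartz functions and the Fourier transform *)

Section SchwartzFunctions.
Context {R : realType}.
Implicit Types (f g : R -> R[i]) (a b x y M : R) (z : R[i]).

Definition rapid f := forall m, exists M : R, forall x, (1 + `|x|) ^+ m * cabs (f x) <= M.

(** The multipliers of the Schwartz space. Cutoffs, plane waves, coordinates and Schwartz functions
    are all of this kind. *)
Definition tame f := csmooth f /\
  forall k, exists m (M : R), forall x, cabs (cderiv k f x) <= M * (1 + `|x|) ^+ m.

Lemma one_plus_norm_ge1 x : 1 <= 1 + `|x|.
Proof. by rewrite lerDl. Qed.
Local Hint Resolve one_plus_norm_ge1 : core.

Lemma exprD1_le x m : (1 + `|x|) ^+ m <= 2 ^+ m * (1 + `|x| ^+ m).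
Proof.
have x0 : 0 <= `|x| by [].
have [x1|x1] := leP `|x| 1.
  apply: (@le_trans _ _ (2 ^+ m)); first by rewrite lerXn2r ?nnegrE ?addr_ge0//; lra.
  by rewrite ler_peMr ?exprn_ge0// lerDl exprn_ge0.
apply: (@le_trans _ _ (2 ^+ m * `|x| ^+ m)).
  rewrite -exprMn lerXn2r ?nnegrE ?addr_ge0 ?mulr_ge0//; lra.
by rewrite ler_pM2l ?exprn_gt0// lerDr.
Qed.

Lemma is_schwartzP f : is_schwartz f <-> csmooth f /\ forall k, rapid (cderiv k f).
Proof.
split=> -[sf rf]; (split; first exact: sf).
  move=> k m; have [M0 h0] := rf 0%N k; have [Mm hm] := rf m k.
  exists (2 ^+ m * (M0 + Mm)) => x.
  apply: (@le_trans _ _ (2 ^+ m * (1 + `|x| ^+ m) * cabs (cderiv k f x))).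
    by rewrite ler_wpM2r ?cabs_ge0// exprD1_le.
  rewrite -mulrA ler_pM2l ?exprn_gt0// mulrDl lerD//.
  by have := h0 x; rewrite expr0.
move=> m k; have [M h] := rf k m; exists M => x; apply: le_trans (h x).
by rewrite ler_wpM2r ?cabs_ge0// lerXn2r ?nnegrE ?addr_ge0// lerDr.
Qed.

Lemma rapid_weight f m : rapid f ->
  exists2 M : R, 0 <= M & forall x, cabs (f x) <= M * weight x ^+ m.
Proof.
move=> /(_ (m.*2)) [M h]; exists M.
  by have := h 0; apply: le_trans; rewrite mulr_ge0 ?cabs_ge0// exprn_ge0// addr_ge0.
move=> x; rewrite /weight exprVn ler_pdivlMr ?exprn_gt0 ?ltr_pwDl ?sqr_ge0//.
rewrite (le_trans _ (h x))// mulrC ler_wpM2r ?cabs_ge0//.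
rewrite -mul2n exprM lerXn2r ?nnegrE ?exprn_ge0 ?addr_ge0 ?sqr_ge0//.
rewrite -(real_normK (num_real x)); have := normr_ge0 x; nra.
Qed.

Lemma schwartz_smooth f : is_schwartz f -> csmooth f.
Proof. by case. Qed.

Lemma schwartz_cderiv k f : is_schwartz f -> is_schwartz (cderiv k f).
Proof.
move=> /is_schwartzP[sf rf]; apply/is_schwartzP; split; first exact: csmooth_cderiv.
by move=> l; rewrite -cderivD; exact: rf.
Qed.

Lemma schwartz_rapid f : is_schwartz f -> rapid f.
Proof. by move=> /is_schwartzP[_ /(_ 0%N)]; rewrite cderiv0. Qed.

Lemma schwartz_weight f : is_schwartz f ->
  exists2 M : R, 0 <= M & forall x, cabs (f x) <= M * weight x.
Proof. by move=> /schwartz_rapid/(@rapid_weight _ 1). Qed.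

Lemma schwartz_bounded f : is_schwartz f ->
  exists2 M : R, 0 <= M & forall x, cabs (f x) <= M.
Proof.
move=> /schwartz_weight[M M0 h]; exists M => // x.
by rewrite (le_trans (h x))// ler_piMr// weight_le1.
Qed.

Lemma schwartz_continuous f : is_schwartz f -> ccontinuous f.
Proof. by case=> /csmooth_continuous. Qed.

Lemma schwartz_integrable f : is_schwartz f -> cintegrable f.
Proof.
move=> sf; have [M _ h] := schwartz_weight sf.
exact: cintegrable_weight (schwartz_continuous sf) h.
Qed.

(** In a class stable under differentiation the decay of the members is already the decay of all
    their derivatives, so no formula for higher derivatives has to be written. *)
Lemma schwartz_class (P : (R -> R[i]) -> Prop) :
  (forall f, P f -> exists2 g, P g & forall x, has_cderiv f x (g x)) ->
  (forall f, P f -> rapid f) -> forall f, P f -> is_schwartz f.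
Proof.
move=> hP rP f Pf; have [sf Pk] := csmooth_class hP Pf.
by apply/is_schwartzP; split=> // k; exact: rP.
Qed.

Lemma rapidD f g : rapid f -> rapid g -> rapid (fun x => f x + g x).
Proof.
move=> rf rg m; have [M h] := rf m; have [M' h'] := rg m; exists (M + M') => x.
apply: (@le_trans _ _ ((1 + `|x|) ^+ m * (cabs (f x) + cabs (g x)))).
  by rewrite ler_wpM2l ?exprn_ge0 ?addr_ge0// cabsD.
by rewrite mulrDr lerD.
Qed.

Lemma rapidM f g m M : rapid f -> (forall x, cabs (g x) <= M * (1 + `|x|) ^+ m) ->
  rapid (fun x => f x * g x).
Proof.
move=> rf hg l; have [M' h'] := rf (l + m)%N; exists (M' * M) => x.
have M0 : 0 <= M.
  have := hg 0; rewrite normr0 addr0 expr1n mulr1; apply: le_trans; exact: cabs_ge0.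
rewrite cabsM; apply: (@le_trans _ _ ((1 + `|x|) ^+ l * (cabs (f x) * (M * (1 + `|x|) ^+ m)))).
  by rewrite ler_wpM2l ?exprn_ge0 ?addr_ge0// ler_wpM2l ?cabs_ge0.
by rewrite [leLHS](_ : _ = (1 + `|x|) ^+ (l + m) * cabs (f x) * M) ?ler_wpM2r// exprD; ring.
Qed.

Lemma schwartzD f g : is_schwartz f -> is_schwartz g -> is_schwartz (fun x => f x + g x).
Proof.
pose P h := exists f g : R -> R[i], [/\ is_schwartz f, is_schwartz g & h = fun x => f x + g x].
move=> sf sg; apply: (@schwartz_class P); last by exists f, g.
  move=> _ [f1 [g1 [sf1 sg1 ->]]]; exists (fun x => cderiv 1 f1 x + cderiv 1 g1 x).
    exists (cderiv 1 f1), (cderiv 1 g1); split; [exact: schwartz_cderiv..|by []].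
  by move=> x; apply: has_cderivD; apply: csmooth_has; exact: schwartz_smooth.
by move=> _ [f1 [g1 [sf1 sg1 ->]]]; apply: rapidD; exact: schwartz_rapid.
Qed.

Lemma tame_smooth f : tame f -> csmooth f /\ tame (cderiv 1 f).
Proof.
case=> sf tf; split; [exact: sf|split; first exact: csmooth_cderiv].
move=> k; rewrite -cderivD; exact: tf.
Qed.

Lemma schwartzM f g : is_schwartz f -> tame g -> is_schwartz (fun x => f x * g x).
Proof.
move=> sf tg; apply: (@schwartz_class (product_class is_schwartz tame)).
- apply: product_class_derive => h; last exact: tame_smooth.
  by move=> sh; exact: (conj (schwartz_smooth sh) (schwartz_cderiv 1 sh)).
- move=> _ [s [sP ->]]; elim: s sP => [|p s IH] sP.
    move=> m; exists 0 => x; rewrite big_nil cabs0 mulr0; exact: lexx.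
  have [p1 [_ /(_ 0%N)[m [M p2]]]] := sP p (or_introl erefl).
  have := rapidD (rapidM (schwartz_rapid p1) p2) (IH (fun q qs => sP q (or_intror qs))).
  move=> h l; have [K hK] := h l; exists K => x.
  by rewrite big_cons; move: (hK x); rewrite cderiv0.
- exact: product_classM.
Qed.

Lemma tame_of_class (P : (R -> R[i]) -> Prop) :
  (forall f, P f -> exists2 g, P g & forall x, has_cderiv f x (g x)) ->
  (forall f, P f -> exists m (M : R), forall x, cabs (f x) <= M * (1 + `|x|) ^+ m) ->
  forall f, P f -> tame f.
Proof.
move=> hP bP f Pf; have [sf Pk] := csmooth_class hP Pf.
by split=> // k; exact: bP.
Qed.

Lemma schwartz_tame f : is_schwartz f -> tame f.
Proof.
move=> sf; split=> [|k]; first exact: schwartz_smooth.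
have [M _ h] := schwartz_bounded (schwartz_cderiv k sf).
by exists 0%N, M => x; rewrite expr0 mulr1.
Qed.

Lemma tame_affine_fun z z' : tame (fun x => z + z' * x%:C%C).
Proof.
pose P h := exists z z' : R[i], h = fun x : R => z + z' * x%:C%C.
apply: (@tame_of_class P); last by exists z, z'.
  move=> _ [w [w' ->]]; exists (fun=> w'); first by exists w', 0; apply/funext => x; rewrite mul0r addr0.
  move=> x; rewrite -[w' in has_cderiv _ _ w']add0r; apply: has_cderivD; first exact: has_cderiv_cst.
  rewrite -[w' in has_cderiv _ _ w']mulr1; apply: has_cderivZ.
  by have := @has_cderiv_real _ (@id R) x 1 (is_derive_id _ _).
move=> _ [w [w' ->]]; exists 1%N, (cabs w + cabs w') => x.
rewrite (le_trans (cabsD _ _))// cabsM cabs_real expr1 mulrDl !mulrDr !mulr1.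
rewrite [leRHS](_ : _ = cabs w + cabs w' * `|x| + (cabs w * `|x| + cabs w')); last by ring.
by rewrite lerDl addr_ge0 ?mulr_ge0 ?cabs_ge0.
Qed.

Lemma tame_cst z : tame (fun=> z).
Proof.
have := tame_affine_fun z 0.
by under [X in tame X]eq_fun do rewrite mul0r addr0.
Qed.

Lemma tame_id : tame (fun x => x%:C%C).
Proof.
have := tame_affine_fun 0 1.
by under [X in tame X]eq_fun do rewrite mul1r add0r.
Qed.

Lemma tame_expi (N : R) : tame (fun x => cexpi (N * x)).
Proof.
pose P h := exists z : R[i], h = fun x : R => z * cexpi (N * x).
apply: (@tame_of_class P); last by exists 1; apply/funext => x; rewrite mul1r.
  move=> _ [w ->]; exists (fun x => w * ('i%C * N%:C%C * cexpi (N * x))).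
    by exists (w * ('i%C * N%:C%C)); apply/funext => x; rewrite !mulrA.
  by move=> x; apply: has_cderivZ; exact: has_cderiv_expi_scale.
by move=> _ [w ->]; exists 0%N, (cabs w) => x; rewrite cabsM cabs_expi expr0.
Qed.

Lemma schwartzZ z f : is_schwartz f -> is_schwartz (fun x => z * f x).
Proof.
move=> sf; have := schwartzM sf (tame_cst z).
by under [X in is_schwartz X]eq_fun do rewrite mulrC.
Qed.

Lemma schwartzB f g : is_schwartz f -> is_schwartz g -> is_schwartz (fun x => f x - g x).
Proof.
move=> sf /(schwartzZ (-1)); under [X in is_schwartz X]eq_fun do rewrite mulN1r.
exact: schwartzD.
Qed.

Lemma schwartzJ f : is_schwartz f -> is_schwartz (fun x => (f x)^*%C).
Proof.
pose P h := exists2 f : R -> R[i], is_schwartz f & h = fun x => (f x)^*%C.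
move=> sf; apply: (@schwartz_class P); last by exists f.
  move=> _ [f1 sf1 ->]; exists (fun x => (cderiv 1 f1 x)^*%C).
    by exists (cderiv 1 f1) => //; exact: schwartz_cderiv.
  by move=> x; apply: has_cderivJ; apply: csmooth_has; exact: schwartz_smooth.
move=> _ [f1 sf1 ->] m; have [M h] := schwartz_rapid sf1 m.
by exists M => x; rewrite cabsJ.
Qed.

Lemma schwartz_affine f a b : a != 0 -> is_schwartz f ->
  is_schwartz (fun x => f (a * x + b)).
Proof.
pose P h := exists2 f : R -> R[i], is_schwartz f & h = fun x => f (a * x + b).
move=> a0 sf; apply: (@schwartz_class P); last by exists f.
  move=> _ [f1 sf1 ->]; exists (fun x => a%:C%C * cderiv 1 f1 (a * x + b)).
    exists (fun x => a%:C%C * cderiv 1 f1 x) => //; apply: schwartzZ.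
    exact: schwartz_cderiv.
  by move=> x; apply: has_cderiv_affine; apply: csmooth_has; exact: schwartz_smooth.
move=> _ [f1 sf1 ->] m; have [M h] := schwartz_rapid sf1 m.
(* From [|x| <= |a|^-1 (|a x + b| + |b|)] one gets [1 + |x| <= C (1 + |a x + b|)]. *)
pose C := 1 + `|a|^-1 * (1 + `|b|).
have C0 : 0 <= C by rewrite addr_ge0// mulr_ge0 ?invr_ge0 ?addr_ge0.
exists (C ^+ m * M) => x.
apply: le_trans (_ : C ^+ m * ((1 + `|a * x + b|) ^+ m * cabs (f1 (a * x + b))) <= _); last first.
  by rewrite ler_wpM2l ?exprn_ge0.
rewrite mulrA ler_wpM2r ?cabs_ge0// -exprMn lerXn2r ?nnegrE ?addr_ge0 ?mulr_ge0 ?addr_ge0//.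
have na : 0 < `|a| by rewrite normr_gt0.
have : `|x| <= `|a|^-1 * (`|a * x + b| + `|b|).
  rewrite ler_pdivlMl// -normrM -{1}(addrK b (a * x)).
  exact: ler_normB.
rewrite /C; set y := `|a * x + b|; have y0 : 0 <= y by exact: normr_ge0.
have d0 := normr_ge0 b; have c0 : 0 <= `|a|^-1 by rewrite invr_ge0.
have := mulr_ge0 (mulr_ge0 c0 y0) d0; have := mulr_ge0 c0 y0.
by move: (`|a|^-1) (`|b|) c0 d0 => c d c0 d0; nra.
Qed.

End SchwartzFunctions.

Section FourierTransform.
Context {R : realType}.
Implicit Types (f g : R -> R[i]) (a b x y M eps xi : R) (z : R[i]).

(** The sign [eps], equal to -1 or 1, treats the Fourier transform and its inverse at once, up to
    the factor [fconst]. *)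
Definition fkernel eps f xi := cint (fun x => cexpi (eps * (x * xi)) * f x).

Lemma cabs_fkernel f eps xi M : ccontinuous f -> (forall x, cabs (f x) <= M * weight x) ->
  cabs (fkernel eps f xi) <= 2 * (M * pi).
Proof.
move=> cf fM; apply: cabs_cint_weight; last by move=> x; rewrite cabsM cabs_expi mul1r.
have := ccontinuousM (csmooth_continuous (tame_expi (eps * xi)).1) cf.
by under [X in ccontinuous X]eq_fun do rewrite mulrAC -mulrA.
Qed.

Lemma fkernel_integrand eps f xi :
  (fun x => cexpi (eps * (x * xi)) * f x) = fun x => f x * cexpi (eps * xi * x).
Proof. by apply/funext => x; rewrite mulrC mulrAC mulrA. Qed.

Lemma schwartz_integrand eps f xi : is_schwartz f ->
  is_schwartz (fun x => cexpi (eps * (x * xi)) * f x).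
Proof. by move=> sf; rewrite fkernel_integrand; apply: schwartzM => //; exact: tame_expi. Qed.

Lemma schwartz_mulx f : is_schwartz f -> is_schwartz (fun x => x%:C%C * f x).
Proof.
move=> sf; have := schwartzM sf tame_id.
by under [X in is_schwartz X]eq_fun do rewrite mulrC.
Qed.

Lemma has_cderiv_fkernel eps f xi : is_schwartz f ->
  has_cderiv (fkernel eps f) xi
    (fkernel eps (fun x => 'i%C * eps%:C%C * (x%:C%C * f x)) xi).
Proof.
move=> sf; pose g x := 'i%C * eps%:C%C * (x%:C%C * f x).
have sg : is_schwartz g by apply: schwartzZ; exact: schwartz_mulx.
have [M M0 fM] := schwartz_weight sf; have [M' M'0 gM'] := schwartz_weight sg.
apply: (@has_cderiv_cint _ (fun t x => cexpi (eps * (x * t)) * f x)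
  (fun t x => cexpi (eps * (x * t)) * g x) (M + M')).
- move=> t x; have := has_cderivM (has_cderiv_expi_scale (eps * x) t) (has_cderiv_cst (f x) t).
  rewrite mulr0 addr0 real_complexM -mulrA => h.
  under [X in has_cderiv X]eq_fun do rewrite mulrA.
  suff -> : cexpi (eps * (x * t)) * g x =
    'i%C * (eps%:C%C * x%:C%C) * (cexpi (eps * x * t) * f x) by [].
  by rewrite /g [eps * (x * t)]mulrA; ring.
- by move=> t; apply: schwartz_continuous; exact: schwartz_integrand.
- move=> t x; rewrite cabsM cabs_expi mul1r (le_trans (fM x))// ler_wpM2r ?weight_ge0//.
  by rewrite lerDl.
- move=> t x; rewrite cabsM cabs_expi mul1r (le_trans (gM' x))// ler_wpM2r ?weight_ge0//.
  by rewrite lerDr.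
Qed.

(** Integration by parts: [F'] below is the derivative of the decaying function [F], so its two
    terms have opposite integrals. *)
Lemma fkernel_cderiv eps f xi : is_schwartz f ->
  fkernel eps (cderiv 1 f) xi = - ('i%C * (eps * xi)%:C%C * fkernel eps f xi).
Proof.
move=> sf; have sf' := schwartz_cderiv 1 sf.
pose F x := cexpi (eps * (x * xi)) * f x.
pose F' x := 'i%C * (eps * xi)%:C%C * F x + cexpi (eps * (x * xi)) * cderiv 1 f x.
have sF : is_schwartz F by exact: schwartz_integrand.
have sK := schwartz_integrand eps xi sf'.
have sF' : is_schwartz F' by apply: schwartzD => //; exact: schwartzZ.
have [M M0 FM] := schwartz_weight sF; have [M' M'0 F'M] := schwartz_weight sF'.
have : cint F' = 0.
  apply: (@cint_derive0 _ F F' (M + M')).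
  - move=> x; have := has_cderivM (has_cderiv_expi_scale (eps * xi) x) (csmooth_has x (schwartz_smooth sf)).
    rewrite (_ : (fun y => _) = F); last by apply/funext => y; rewrite /F mulrAC mulrA.
    by rewrite /F' /F [x * xi]mulrC [eps * (xi * x)]mulrA mulrA.
  - exact: schwartz_continuous.
  - by move=> x; rewrite (le_trans (F'M x))// ler_wpM2r ?weight_ge0// lerDr.
  - by move=> x; rewrite (le_trans (FM x))// ler_wpM2r ?weight_ge0// lerDl.
rewrite (cintD (schwartz_integrable (schwartzZ _ sF)) (schwartz_integrable sK)).
rewrite cintZ; last exact: schwartz_integrable.
by move=> /eqP; rewrite addrC addr_eq0 => /eqP.
Qed.

Lemma cabs_fkernel_cderivn eps f xi m : `|eps| = 1 -> is_schwartz f ->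
  `|xi| ^+ m * cabs (fkernel eps f xi) = cabs (fkernel eps (cderiv m f) xi).
Proof.
move=> e1 sf; elim: m => [|m IH]; first by rewrite expr0 mul1r cderiv0.
rewrite cderivS fkernel_cderiv; last exact: schwartz_cderiv.
by rewrite cabsN !cabsM cabs_i cabs_real normrM e1 !mul1r -IH exprS mulrA.
Qed.

(** Differentiating a transform multiplies the function by [x], so transforms of Schwartz functions
    form a stable class. Decay of order [m] follows by trading powers of [xi] for derivatives of the
    function. *)
Lemma schwartz_fkernel eps f : `|eps| = 1 -> is_schwartz f -> is_schwartz (fkernel eps f).
Proof.
pose P h := exists2 f : R -> R[i], is_schwartz f & h = fkernel eps f.
move=> e1 sf; apply: (@schwartz_class _ P); last by exists f.
  move=> _ [f1 sf1 ->]; eexists; last by move=> x; exact: has_cderiv_fkernel.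
  by eexists => //; apply: schwartzZ; exact: schwartz_mulx.
move=> _ [f1 sf1 ->] m.
have [M0 _ h0] := schwartz_weight sf1.
have [M1 _ h1] := schwartz_weight (schwartz_cderiv m sf1).
exists (2 ^+ m * (2 * (M0 * pi) + 2 * (M1 * pi))) => xi.
apply: (@le_trans _ _ (2 ^+ m * (1 + `|xi| ^+ m) * cabs (fkernel eps f1 xi))).
  by rewrite ler_wpM2r ?cabs_ge0// exprD1_le.
rewrite -mulrA ler_pM2l ?exprn_gt0// mulrDl mul1r cabs_fkernel_cderivn// lerD//.
  by apply: cabs_fkernel => //; exact: schwartz_continuous.
by apply: cabs_fkernel => //; apply: schwartz_continuous; exact: schwartz_cderiv.
Qed.

Lemma measurable_fst_comp (h : R -> R) : continuous h ->
  measurable_fun [set: R * R] (fun w : R * R => h w.1).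
Proof.
by move=> ch; apply: (measurableT_comp (continuous_measurable_fun ch)); exact: measurable_fst.
Qed.

Lemma measurable_snd_comp (h : R -> R) : continuous h ->
  measurable_fun [set: R * R] (fun w : R * R => h w.2).
Proof.
by move=> ch; apply: (measurableT_comp (continuous_measurable_fun ch)); exact: measurable_snd.
Qed.

(** The multiplication formula, by Fubini. It is the one duality between a function and its
    transform on which the computation of the boxes and the lower bound rest. *)
Lemma fkernel_mult eps f g : is_schwartz f -> is_schwartz g ->
  cint (fun x => f x * fkernel eps g x) = cint (fun x => fkernel eps f x * g x).
Proof.
move=> sf sg.
have [M M0 fM] := schwartz_weight sf; have [M' M'0 gM'] := schwartz_weight sg.
have [fr fi] := schwartz_continuous sf; have [gr gi] := schwartz_continuous sg.
pose H x y := f x * (cexpi (eps * (y * x)) * g y).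
have LE x : f x * fkernel eps g x = cint (H x).
  by rewrite -cintZ//; apply: schwartz_integrable; exact: schwartz_integrand.
have RE y : fkernel eps f y * g y = cint (H^~ y).
  rewrite mulrC -cintZ//; last by apply: schwartz_integrable; exact: schwartz_integrand.
  by apply: eq_cint => x; rewrite /H [y * x]mulrC; ring.
rewrite (eq_cint LE) (eq_cint RE).
have mxy : measurable_fun [set: R * R] (fun w : R * R => eps * (w.2 * w.1)).
  apply: measurable_funM; first exact: measurable_cst.
  by apply: measurable_funM; [exact: measurable_snd|exact: measurable_fst].
have mc : measurable_fun [set: R * R] (fun w : R * R => cos (eps * (w.2 * w.1))).
  exact: (measurableT_comp (continuous_measurable_fun (@continuous_cos R)) mxy).
have ms : measurable_fun [set: R * R] (fun w : R * R => sin (eps * (w.2 * w.1))).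
  exact: (measurableT_comp (continuous_measurable_fun (@continuous_sin R)) mxy).
have mfr := measurable_fst_comp fr; have mfi := measurable_fst_comp fi.
have mgr := measurable_snd_comp gr; have mgi := measurable_snd_comp gi.
apply: (@cint_fubini _ H (M * M')).
- rewrite (_ : (fun w => _) = fun w : R * R =>
    re f w.1 * (cos (eps * (w.2 * w.1)) * re g w.2 - sin (eps * (w.2 * w.1)) * im g w.2) -
    im f w.1 * (cos (eps * (w.2 * w.1)) * im g w.2 + sin (eps * (w.2 * w.1)) * re g w.2)).
    by apply: measurable_funB; apply: measurable_funM => //;
      [apply: measurable_funB|apply: measurable_funD]; exact: measurable_funM.
  by apply/funext => w; rewrite /H !(cReM, cImM).
- rewrite (_ : (fun w => _) = fun w : R * R =>
    re f w.1 * (cos (eps * (w.2 * w.1)) * im g w.2 + sin (eps * (w.2 * w.1)) * re g w.2) +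
    im f w.1 * (cos (eps * (w.2 * w.1)) * re g w.2 - sin (eps * (w.2 * w.1)) * im g w.2)).
    by apply: measurable_funD; apply: measurable_funM => //;
      [apply: measurable_funD|apply: measurable_funB]; exact: measurable_funM.
  by apply/funext => w; rewrite /H !(cReM, cImM).
- move=> x y; rewrite !cabsM cabs_expi mul1r.
  rewrite [leRHS](_ : _ = (M * weight x) * (M' * weight y)); last by ring.
  by rewrite ler_pM ?cabs_ge0.
Qed.

Definition fconst : R[i] := ((Num.sqrt (2 * pi))^-1)%:C%C.

Lemma fconst_real : 0 < (Num.sqrt (2 * pi : R))^-1.
Proof. by rewrite invr_gt0 sqrtr_gt0 mulr_gt0// pi_gt0. Qed.

Lemma fourierE f xi : fourier f xi = fconst * fkernel (-1) f xi.
Proof. by rewrite /fourier; congr (_ * _); apply: eq_cint => x; rewrite mulN1r. Qed.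

Lemma fourier_invE f xi : fourier_inv f xi = fconst * fkernel 1 f xi.
Proof.
by rewrite /fourier_inv; congr (_ * _); apply: eq_cint => x; rewrite mul1r [xi * x]mulrC.
Qed.

Lemma schwartz_fourier f : is_schwartz f -> is_schwartz (fourier f).
Proof.
move=> sf; rewrite (_ : fourier f = fun x => fconst * fkernel (-1) f x).
  by apply: schwartzZ; apply: schwartz_fkernel => //; rewrite normrN normr1.
by apply/funext => x; rewrite fourierE.
Qed.

Lemma schwartz_fourier_inv f : is_schwartz f -> is_schwartz (fourier_inv f).
Proof.
move=> sf; rewrite (_ : fourier_inv f = fun x => fconst * fkernel 1 f x).
  by apply: schwartzZ; apply: schwartz_fkernel => //; rewrite normr1.
by apply/funext => x; rewrite fourier_invE.
Qed.

Lemma cint_fourier f g : is_schwartz f -> is_schwartz g ->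
  cint (fun x => f x * fourier g x) = cint (fun x => fourier f x * g x).
Proof.
move=> sf sg; have e1 : `|-1 : R| = 1 by rewrite normrN normr1.
have sgk := schwartz_fkernel e1 sg; have sfk := schwartz_fkernel e1 sf.
under eq_cint do rewrite fourierE mulrCA.
under [RHS]eq_cint do rewrite fourierE -mulrA.
rewrite !cintZ ?fkernel_mult//; apply: schwartz_integrable; apply: schwartzM => //.
  exact: schwartz_tame.
exact: schwartz_tame.
Qed.

Lemma cint_fourier_inv f g : is_schwartz f -> is_schwartz g ->
  cint (fun x => f x * fourier_inv g x) = cint (fun x => fourier_inv f x * g x).
Proof.
move=> sf sg; have e1 : `|1 : R| = 1 by rewrite normr1.
have sgk := schwartz_fkernel e1 sg; have sfk := schwartz_fkernel e1 sf.
under eq_cint do rewrite fourier_invE mulrCA.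
under [RHS]eq_cint do rewrite fourier_invE -mulrA.
rewrite !cintZ ?fkernel_mult//; apply: schwartz_integrable; apply: schwartzM => //.
  exact: schwartz_tame.
exact: schwartz_tame.
Qed.

Lemma fourier_inv_conj f xi : is_schwartz f ->
  fourier_inv (fun x => (f x)^*%C) xi = (fourier f xi)^*%C.
Proof.
move=> sf; rewrite /fourier_inv /fourier conjcM conjc_real -cintJ; last first.
  apply: schwartz_integrable; have := schwartz_integrand (-1) xi sf.
  by under [X in is_schwartz X]eq_fun do rewrite mulN1r.
congr (_ * _); apply: eq_cint => x.
by rewrite conjcM cexpiN conjcK [xi * x]mulrC.
Qed.

Lemma fourier_modulation N f xi :
  fourier (fun x => cexpi (N * x) * f x) xi = fourier f (xi - N).
Proof.
rewrite /fourier; congr (_ * _); apply: eq_cint => x.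
by rewrite mulrA -cexpiD; congr (cexpi _ * _); ring.
Qed.

Lemma fourier_affine a y f xi : 0 < a -> is_schwartz f ->
  fourier (fun x => a%:C%C * f (a * (x - y))) xi = cexpi (- (y * xi)) * fourier f (xi / a).
Proof.
move=> a0 sf; rewrite /fourier mulrCA; congr (_ * _).
have sF : is_schwartz (fun x => cexpi (- (x * (xi / a))) * f x).
  have := schwartz_integrand (-1) (xi / a) sf.
  by under [X in is_schwartz X]eq_fun do rewrite mulN1r.
rewrite -cintZ; last exact: schwartz_integrable.
have sG : is_schwartz (fun x => cexpi (- (y * xi)) * (cexpi (- (x * (xi / a))) * f x)).
  exact: schwartzZ.
rewrite (cint_affine (- (a * y)) a0 (schwartz_continuous sG) (schwartz_integrable sG)).
rewrite -cintZ; last first.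
  apply: cintegrable_affine a0 (schwartz_continuous sG) (schwartz_integrable sG).
apply: eq_cint => x; rewrite mulrCA; congr (_ * _).
rewrite mulrA -cexpiD (_ : a * x + - (a * y) = a * (x - y)); last by ring.
congr (cexpi _ * _); have an0 : a != 0 by rewrite gt_eqF.
by field.
Qed.

Lemma to_schwartzE f : is_schwartz f -> to_schwartz f = f :> (R -> R[i]).
Proof. by move=> sf; rewrite /to_schwartz; case: pselect. Qed.

(** The transform, the cutoff and the inverse transform act on the test function by definition; the
    multiplication formula moves them to [f] one after the other. Each test function met on the way
    is Schwartz, so [to_schwartz] never takes its default value. *)
Lemma box_distr psi n f : tame (fun xi => (psi (xi - n%:~R))%:C%C) -> is_schwartz f ->
  box psi n (distr f) =
  distr (fourier_inv (fun xi => (psi (xi - n%:~R))%:C%C * fourier f xi)).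
Proof.
move=> tpsi sf; apply/funext => phi.
have sphi := schwartzP phi.
have sfi := schwartz_fourier_inv sphi.
have smul g : is_schwartz g -> is_schwartz (fun xi => (psi (xi - n%:~R))%:C%C * g xi).
  move=> sg; have := schwartzM sg tpsi.
  by under [X in is_schwartz X]eq_fun do rewrite mulrC.
have sff := schwartz_fourier sf.
rewrite /box /dfourier_inv /dmul /dfourier /distr (to_schwartzE sfi).
rewrite (to_schwartzE (smul _ sfi)) (to_schwartzE (schwartz_fourier (smul _ sfi))).
rewrite cint_fourier//; last exact: smul.
rewrite -cint_fourier_inv//; last exact: smul.
by apply: eq_cint => x; rewrite mulrCA mulrA.
Qed.

Lemma tempered_distr f : is_schwartz f -> tempered (distr f).
Proof.
move=> sf; have sm (g : schwartz R) : is_schwartz (fun x => f x * g x).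
  by apply: schwartzM => //; apply: schwartz_tame; exact: schwartzP.
split=> [z g h k kE|phi phi0].
  rewrite /distr -cintZ; last exact: schwartz_integrable.
  rewrite -cintD; [|by apply: schwartz_integrable; exact: schwartzZ|exact: schwartz_integrable].
  by apply: eq_cint => x; rewrite kE; ring.
have [M M0 fM] := schwartz_weight sf.
apply/cvgrPdist_le => e e0.
have C0 : 0 < 2 * (M * pi) + 1 :> R by rewrite ltr_wpDl// mulr_ge0// mulr_ge0// pi_ge0.
have d0 : 0 < e / (2 * (M * pi) + 1) by rewrite divr_gt0.
have := phi0 0%N 0%N _ d0; apply: filterS => i hi.
rewrite sub0r normrN ger0_norm ?cabs_ge0//.
have /le_trans -> // : cabs (distr f (phi i)) <= 2 * (M * (e / (2 * (M * pi) + 1)) * pi).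
  apply: cabs_cint_weight; first exact: schwartz_continuous.
  move=> x; rewrite cabsM mulrAC ler_pM ?cabs_ge0//.
  by have := hi x; rewrite expr0 mul1r cderiv0.
rewrite [leLHS](_ : _ = e * (2 * (M * pi) / (2 * (M * pi) + 1))); last by ring.
by rewrite ler_piMr ?(ltW e0)// ler_pdivrMr// mul1r lerDl.
Qed.

End FourierTransform.

(** * Upper bounds for the modulation norm *)

Section Cutoff.
Context {R : realType}.
Variables (psi : R -> R) (hpsi : is_cutoff psi).

(** The strict inequalities describe an open set, so vanishing passes from each derivative to the
    next. *)
Lemma cutoff_eq0 k x : x < - (1 / 4) \/ 5 / 4 < x -> derive1n k psi x = 0.
Proof.
have [_ supp _] := hpsi.
elim: k x => [|k IH] x hx.
  apply/eqP; apply: contraPT hx => psix.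
  have := supp x (@subset_closure _ [set y | psi y != 0] x psix) => /= /andP[x1 x2].
  by case; lra.
rewrite derive1nS derive1E (@near_eq_derive _ _ _ _ (cst 0)) ?derive_cst//.
case: hx => hx; near=> y; apply: IH; [left|right].
- by near: y; exact: lt_nbhsl.
- by near: y; exact: lt_nbhsr.
Unshelve. all: by end_near. Qed.

Lemma cutoff_bounded k : exists2 M : R, 0 <= M & forall x, `|derive1n k psi x| <= M.
Proof.
have [dpsi _ _] := hpsi.
have cn : continuous (fun x => `|derive1n k psi x|).
  move=> x; apply: continuous_comp; last exact: norm_continuous.
  exact/differentiable_continuous/derivable1_diffP/dpsi.
have le : - (1 / 4) <= 5 / 4 :> R by lra.
have [c _ hc] := @EVT_max R (fun x => `|derive1n k psi x|) _ _ le (continuous_subspaceT cn).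
exists `|derive1n k psi c| => // x.
have [x1|x1] := ltP x (- (1 / 4)); first by rewrite cutoff_eq0 ?normr0//; left.
have [x2|x2] := ltP (5 / 4) x; first by rewrite cutoff_eq0 ?normr0//; right.
by apply: hc; rewrite in_itv /= x1 x2.
Qed.

Lemma has_cderiv_cutoff k c x :
  has_cderiv (fun y => (derive1n k psi (y - c))%:C%C) x (derive1n k.+1 psi (x - c))%:C%C.
Proof.
have [dpsi _ _] := hpsi; apply: has_cderiv_real.
have := @is_derive_affine _ (derive1n k psi) 1 (- c) x (derive1n k.+1 psi (x - c)).
rewrite !mul1r => h; have {}h : is_derive x 1 (fun y => derive1n k psi (1 * y - c)) (derive1n k.+1 psi (x - c)).
  by apply: h; apply: DeriveDef; [exact: dpsi|rewrite derive1nS derive1E].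
by under [X in is_derive _ _ X]eq_fun do rewrite -[X in X - c]mul1r.
Qed.

Lemma tame_cutoff c : tame (fun x => (psi (x - c))%:C%C).
Proof.
pose P h := exists k, h = fun y : R => (derive1n k psi (y - c))%:C%C.
apply: (@tame_of_class _ P); last by exists 0%N.
  move=> _ [k ->]; exists (fun y => (derive1n k.+1 psi (y - c))%:C%C); first by exists k.+1.
  by move=> x; exact: has_cderiv_cutoff.
move=> _ [k ->]; have [M _ hM] := cutoff_bounded k; exists 0%N, M => x.
by rewrite expr0 mulr1 cabs_real.
Qed.

End Cutoff.

Section Norms.
Context {R : realType}.
Implicit Types (f g : R -> R[i]) (a b x y M K : R).

Local Notation mu := (@lebesgue_measure R).

Lemma integral_weight_affine a b : 0 < a ->
  (\int[mu]_x (a * weight (a * x + b))%:E = (pi : R)%:E)%E.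
Proof.
move=> a0; rewrite -integral_weight.
by rewrite (integral_affine b a0 (@continuous_weight R) (@weight_ge0 R)).
Qed.

Lemma sqr_fun_L2norm f :
  (fun_L2norm f = (\int[mu]_x ((cabs (f x)) ^+ 2)%:E) `^ 2^-1)%E.
Proof.
rewrite /fun_L2norm unlock; congr (_ `^ _)%E; apply: eq_integral => x _ /=.
by rewrite ger0_norm ?cabs_ge0// powR_mulrn ?cabs_ge0.
Qed.

(** The bump [a * weight (a * x + b)] has integral [pi] for all [a] and [b], so neither the scale
    nor the centre enters the bound. *)
Lemma fun_L2norm_le f a b K : 0 < a -> 0 <= K ->
  measurable_fun [set: R] (fun x => cabs (f x)) ->
  (forall x, cabs (f x) ^+ 2 <= K ^+ 2 * (a * weight (a * x + b))) ->
  (fun_L2norm f <= (K * Num.sqrt pi)%:E)%E.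
Proof.
move=> a0 K0 mf fK; rewrite sqr_fun_L2norm.
have aw0 x : 0 <= a * weight (a * x + b) by rewrite mulr_ge0 ?weight_ge0 ?ltW.
have caw : continuous (fun x : R => a * weight (a * x + b)).
  move=> x; apply: cvgM; first exact: cvg_cst.
  apply: (@continuous_comp _ _ _ (fun x : R => a * x + b) weight); last exact: continuous_weight.
  apply: cvgD; last exact: cvg_cst.
  by apply: cvgM; [exact: cvg_cst|exact: cvg_id].
have -> : K * Num.sqrt pi = (K ^+ 2 * pi) `^ 2^-1.
  rewrite powR12_sqrt ?mulr_ge0 ?sqr_ge0 ?pi_ge0// sqrtrM ?sqr_ge0//.
  by rewrite sqrtr_sqr ger0_norm.
rewrite -poweR_EFin; apply: gt0_ler_poweR; rewrite ?invr_ge0 ?in_itv//=.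
- by rewrite leey andbT integral_ge0// => x _; rewrite lee_fin sqr_ge0.
- by rewrite leey andbT lee_fin mulr_ge0 ?sqr_ge0 ?pi_ge0.
apply: (@le_trans _ _ (\int[mu]_x ((K ^+ 2)%:E * (a * weight (a * x + b))%:E))%E).
  apply: ge0_le_integral => //.
  - by move=> x _; rewrite lee_fin sqr_ge0.
  - by apply/measurable_EFinP; exact: measurable_funX.
  - by apply: measurable_funeM; apply/measurable_EFinP; exact: continuous_measurable_fun.
  - by move=> x _; rewrite -EFinM lee_fin.
rewrite ge0_integralZl ?integral_weight_affine ?lee_fin ?sqr_ge0//.
  by apply/measurable_EFinP; exact: continuous_measurable_fun.
by move=> x _; rewrite lee_fin.
Qed.

Lemma measurable_cabs f : cmeasurable f -> measurable_fun [set: R] (fun x => cabs (f x)).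
Proof.
move=> [mr mi]; apply: (measurableT_comp (continuous_measurable_fun (@sqrt_continuous R))).
by apply: measurable_funD; exact: measurable_funX.
Qed.

Lemma L2norm_distr_le f K : cmeasurable f -> (fun_L2norm f <= K%:E)%E ->
  (L2norm (distr f) <= K%:E)%E.
Proof.
move=> mf fK; apply: ge_ereal_inf; exists (fun_L2norm f) => //; exists f => //.
by split=> //; exact: le_lt_trans fK (ltry _).
Qed.

(** This does the work of a Plancherel bound for a bump of height [K] and width [a]. Its mass, of
    order [K a], bounds the inverse transform; the mass of its derivative, of order [K], bounds
    [|x|] times the inverse transform. Together they give a square of order [K^2 a] times the
    normalised bump [a * weight (a * x)]. *)
Lemma L2norm_fourier_inv_le (h : R -> R[i]) a N K : 0 < a -> 0 <= K -> is_schwartz h ->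
  (forall xi, cabs (h xi) <= K * weight ((xi - N) / a)) ->
  (forall xi, cabs (cderiv 1 h xi) <= K / a * weight ((xi - N) / a)) ->
  (L2norm (distr (fourier_inv h)) <= (2 * pi * K * Num.sqrt a)%:E)%E.
Proof.
move=> a0 K0 sh hK h'K.
have bound (g : R -> R[i]) L xi : is_schwartz g -> 
    (forall xi, cabs (g xi) <= L * weight ((xi - N) / a)) ->
    cabs (fkernel 1 g xi) <= 2 * (L * a * pi).
  move=> sg gL.
  have L0 : 0 <= L.
    have := le_trans (cabs_ge0 _) (gL N).
    by rewrite subrr mul0r /weight expr0n addr0 invr1 mulr1.
  have ia : 0 < a^-1 by rewrite invr_gt0.
  have iw : mu.-integrable [set: R] (EFin \o (fun x => L * weight ((x - N) / a))).
    have := integrable_affine (- (N / a)) ia (@continuous_weight R) (@integrable_weight R).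
    move=> /(integrableZR L); apply: eq_integrable => // x _ /=.
    by congr (L * weight _)%:E; ring.
  have := @cabs_cint_le _ (fun x => cexpi (1 * (x * xi)) * g x) _ _ _ iw.
  move=> /(_ _ _)/le_trans; apply.
  - by apply: ccontinuous_measurable; apply: schwartz_continuous; exact: schwartz_integrand.
  - by move=> x; rewrite cabsM cabs_expi mul1r.
  rewrite ler_pM2l// RintegralZl//; last first.
    have := integrable_affine (- (N / a)) ia (@continuous_weight R) (@integrable_weight R).
    by apply: eq_integrable => // x _ /=; congr (weight _)%:E; ring.
  have := Rintegral_affine (- (N / a)) ia (@continuous_weight R) (@integrable_weight R).
  rewrite [X in X = _]/Rintegral integral_weight /= => E.
  rewrite -mulrA ler_wpM2l// E mulVKf ?gt_eqF//.
  by rewrite le_eqVlt; apply/orP; left; apply/eqP; apply: eq_Rintegral => x _; congr weight; ring.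
have sh' := schwartz_cderiv 1 sh.
have sf := schwartz_fourier_inv sh.
have mf := ccontinuous_measurable (schwartz_continuous sf).
apply: L2norm_distr_le => //.
have spi : 0 < Num.sqrt (pi : R) by rewrite sqrtr_gt0 pi_gt0.
rewrite [X in X%:E](_ : _ = (2 * Num.sqrt pi * K * Num.sqrt a) * Num.sqrt pi); last first.
  by rewrite -{1}(sqr_sqrtr (pi_ge0 R)) expr2; ring.
apply: (fun_L2norm_le (b := 0) a0); [by rewrite !mulr_ge0// sqrtr_ge0|exact: measurable_cabs|].
move=> x; rewrite addr0 fourier_invE cabsM /fconst cabs_real (ger0_norm (ltW fconst_real)).
have := bound h K x sh hK; have := bound _ (K / a) x sh' h'K.
rewrite divfK ?gt_eqF// -(@cabs_fkernel_cderivn _ 1 h x 1)//; last exact: normr1.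
rewrite expr1; move: (cabs (fkernel 1 h x)) (cabs_ge0 (fkernel 1 h x)) => F F0 F1 F2.
have p0 : 0 < (pi : R) by exact: pi_gt0.
rewrite exprMn exprVn sqr_sqrtr ?mulr_ge0 ?(ltW p0)//.
rewrite !exprMn !sqr_sqrtr ?(ltW p0) ?(ltW a0)//.
have E1 : F ^+ 2 <= (2 * (K * a * pi)) ^+ 2.
  by rewrite lerXn2r ?nnegrE// !mulr_ge0 ?(ltW a0) ?(ltW p0).
have E2 : (`|x| * F) ^+ 2 <= (2 * (K * pi)) ^+ 2.
  by rewrite lerXn2r ?nnegrE ?mulr_ge0 ?(ltW p0).
rewrite exprMn real_normK ?num_real// in E2.
have w0 : 0 < 1 + (a * x) ^+ 2 by rewrite ltr_pwDl ?sqr_ge0.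
(* The 8 is 4 + 4: the bound [E1] is added to the bound [E2] multiplied by [a ^+ 2]. *)
rewrite [leRHS](_ : _ = (2 * pi)^-1 * (8 * pi ^+ 2 * K ^+ 2 * a ^+ 2 / (1 + (a * x) ^+ 2))).
  rewrite ler_pM2l ?invr_gt0 ?mulr_gt0// ler_pdivlMr//.
  have := ler_wpM2l (sqr_ge0 a) E2.
  by rewrite !exprMn in E1 *; lra.
clear bound F1 F2 spi E1 E2; rewrite /weight.
by move: (1 + _) (pi : R) w0 p0 => W P w0 p0; field; rewrite (gt_eqF w0) (gt_eqF p0).
Qed.


(** Telescoping, from [1 / (1 + x^2) <= 4 / ((x + 1) (x + 2))] for [x >= 0]. *)
Lemma weight_series n : \sum_(0 <= i < n) weight (i%:R : R) <= 4 - 4 / n.+1%:R.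
Proof.
elim: n => [|n IH]; first by rewrite big_nil; lra.
rewrite big_nat_recr//=.
have n0 : 0 <= (n%:R : R) by [].
have : weight (n%:R : R) <= 4 / n.+1%:R - 4 / n.+2%:R.
  rewrite -!natr1 /weight; move: n0; move: (n%:R : R) => x x0.
  have x1 : 0 < x + 1 by lra.
  have x2 : 0 < x + 1 + 1 by lra.
  rewrite [leRHS](_ : _ = 4 / ((x + 1) * (x + 1 + 1))); last by field; rewrite !gt_eqF.
  rewrite ler_pdivlMr ?mulr_gt0// mulrC ler_pdivrMr ?ltr_pwDl ?sqr_ge0//.
  by nra.
by move=> /(lerD IH)/le_trans; apply; rewrite addrA subrK.
Qed.

(** After recentring, the integers split into the images of [Posz] and [Negz], each contributing at
    most [4 * c]; [Negz n] has absolute value [n.+1], where the weight is only smaller than at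
    [n]. *)
Lemma esum_weight (n0 : int) (c : R) : 0 <= c ->
  (\esum_(n in [set: int]) (c * weight ((n - n0)%:~R : R))%:E <= (8 * c)%:E)%E.
Proof.
move=> c0.
rewrite (@reindex_esum _ _ _ [set: int] _ (fun n => n + n0)); last first.
  split=> //; first by move=> x y _ _ /addIr.
  by move=> x _; exists (x - n0) => //; rewrite subrK.
under eq_esum do rewrite addrK.
have w0 (n : int) : (0 <= (c * weight (n%:~R : R))%:E)%E by rewrite lee_fin mulr_ge0 ?weight_ge0.
have nat4 (e : nat -> int) : injective e -> (forall n, `|e n| = n :> nat \/ `|e n| = n.+1 :> nat)%N ->
    (\esum_(n in range e) (c * weight (n%:~R : R))%:E <= (c * 4)%:E)%E.
  move=> ei en; rewrite esum_image; last by move=> x y _ _; exact: ei.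
  rewrite -nneseries_esumT//; apply: lime_le; first exact: is_cvg_nneseries.
  apply: nearW => n; rewrite sumEFin lee_fin -mulr_sumr ler_wpM2l//.
  apply: le_trans (_ : \sum_(0 <= i < n) weight (i%:R : R) <= _); last first.
    by rewrite (le_trans (weight_series n))// gerBl divr_ge0.
  apply: ler_sum => i _; rewrite /weight lef_pV2 ?posrE ?ltr_pwDl ?sqr_ge0// lerD2l.
  have -> : ((e i)%:~R : R) ^+ 2 = (`|e i|%N%:R) ^+ 2.
    by rewrite -[RHS]real_normK ?num_real// -[LHS]real_normK ?num_real// -intr_norm normr_nat -abszE pmulrn.
  by rewrite lerXn2r ?nnegrE// ler_nat; case: (en i) => ->.
rewrite (esumID (range Posz))// setTI.
rewrite (_ : _ `&` ~` _ = range Negz); last first.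
  apply/seteqP; split=> [[n [_ []]|n _]|_ [n _ <-]] /=; first by exists n.
    by exists n.
  by split=> // -[].
rewrite (_ : 8 * c = c * 4 + c * 4); last by ring.
rewrite EFinD; apply: leeD; apply: nat4.
- by move=> x y [].
- by move=> n; left.
- by move=> x y [].
- by move=> n; right.
Qed.

Lemma lpnorm_le (p : \bar R) (b : int -> \bar R) (n0 : int) K : (2%:E <= p)%E ->
  0 <= K -> (forall n, 0 <= b n)%E ->
  (forall n, b n <= (K * weight ((n - n0)%:~R : R))%:E)%E -> (lpnorm p b <= (8 * K)%:E)%E.
Proof.
move=> p2 K0 b0 bK; case: p p2 => [p||] //= p2; last first.
  apply: ge_ereal_sup => _ [n _ <-]; apply: (le_trans (bK n)); rewrite lee_fin.
  by have := weight_le1 ((n - n0)%:~R : R); have := weight_ge0 ((n - n0)%:~R : R); nra.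
have {}p2 : 2 <= p by rewrite -lee_fin.
have p0 : 0 < p by lra.
have ip0 : 0 <= p^-1 by rewrite invr_ge0 ltW.
have le1 : (\esum_(n in [set: int]) (b n `^ p) <= ((8 * K) `^ p)%:E)%E.
  apply: (@le_trans _ _ (\esum_(n in [set: int]) (K `^ p * weight ((n - n0)%:~R : R))%:E)%E).
    apply: le_esum => n _.
    apply: (@le_trans _ _ ((K * weight ((n - n0)%:~R : R))%:E `^ p)%E).
      apply: gt0_ler_poweR => //; first exact: ltW.
        by rewrite in_itv /= leey andbT.
      by rewrite in_itv /= leey andbT lee_fin mulr_ge0// weight_ge0.
    rewrite poweR_EFin powRM ?weight_ge0// lee_fin ler_wpM2l ?powR_ge0//.
    rewrite -[leRHS]powRr1 ?weight_ge0//; apply: ger_powR; last by lra.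
    by rewrite weight_gt0 weight_le1.
  apply: (le_trans (esum_weight n0 (powR_ge0 K p))).
  rewrite powRM// lee_fin ler_wpM2r ?powR_ge0// -{1}[8]powRr1//.
  by apply: ler_powR; lra.
apply: (@le_trans _ _ (((8 * K) `^ p)%:E `^ p^-1)%E).
  apply: gt0_ler_poweR => //.
    by rewrite in_itv /= leey andbT; apply: esum_ge0 => n _; exact: poweR_ge0.
  by rewrite in_itv /= leey andbT lee_fin powR_ge0.
by rewrite poweR_EFin -powRrM mulfV ?gt_eqF// powRr1// mulr_ge0.
Qed.


Lemma japanese_ge1 (n : int) : 1 <= japanese n :> R.
Proof. by rewrite -[leLHS]sqrtr1 ler_sqrt ?lerDl ?sqr_ge0// addr_ge0 ?sqr_ge0. Qed.

Lemma japanese_gt0 (n : int) : 0 < japanese n :> R.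
Proof. exact: lt_le_trans (japanese_ge1 n). Qed.

(** Peetre's inequality, with the exponent rounded up to an integer so that the loss is cancelled
    exactly by [l] factors [weight]. *)
Lemma japanese_peetre (s : R) (n n0 : int) l : 0 <= s -> s <= l%:R ->
  japanese n `^ s <= 2 ^+ l * japanese n0 `^ s * (1 + ((n - n0)%:~R : R) ^+ 2) ^+ l.
Proof.
move=> s0 sl; pose d : R := 1 + ((n - n0)%:~R) ^+ 2.
have d1 : 1 <= d by rewrite lerDl sqr_ge0.
have d0 : 0 <= d by lra.
have le : japanese n <= 2 * d * japanese n0 :> R.
  rewrite -[2 * d]ger0_norm ?mulr_ge0// -sqrtr_sqr -sqrtrM ?sqr_ge0// ler_sqrt; last first.
    by rewrite mulr_ge0 ?sqr_ge0// addr_ge0 ?sqr_ge0.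
  apply: (@le_trans _ _ (2 * d * (1 + (n0%:~R : R) ^+ 2))).
    rewrite /d intrB; move: (n%:~R : R) (n0%:~R : R) => x y.
    have := sqr_ge0 (x - 2 * y); have := mulr_ge0 (sqr_ge0 (x - y)) (sqr_ge0 y).
    by rewrite !expr2; lra.
  by rewrite ler_wpM2r ?addr_ge0 ?sqr_ge0// expr2; nra.
apply: (@le_trans _ _ ((2 * d * japanese n0) `^ s)).
  by apply: ge0_ler_powR => //; rewrite nnegrE ?mulr_ge0// ltW// japanese_gt0.
have j0 : 0 <= japanese n0 :> R by exact/ltW/japanese_gt0.
rewrite powRM ?mulr_ge0// [leRHS]mulrAC.
rewrite ler_wpM2r ?powR_ge0// -/d -exprMn -powR_mulrn ?mulr_ge0//.
by apply: ler_powR => //; lra.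
Qed.

(** To be used with [D = n - n0] and [e = xi - N]: on the support of the cutoff [xi - n] lies in
    [-1/4, 5/4], and [N - n0] in [0, 1], whence the distance 5/4. *)
Lemma sqr_dist_le (e D : R) : (D - e) ^+ 2 <= (5 / 4) ^+ 2 -> 1 + D ^+ 2 <= 5 * (1 + e ^+ 2).
Proof. by move=> h; have h2 := sqr_ge0 (2 * e - D); rewrite !expr2 in h h2 *; nra. Qed.

(** Of the [m = l + 2] weights, one gives the integrability in [xi] within a box. The others become
    weights of [n - n0]: [l] of them pay for Peetre's inequality and the last one sums over [n].
    Since [C] is chosen before [a], [N], [n0] and [w], the bound serves both single solitons and
    differences of two. *)
Lemma Mnorm_le (psi : R -> R) (s : R) : is_cutoff psi -> 0 <= s ->
  exists m, exists2 C : R, 0 <= C &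
    forall (p : \bar R) (a N : R) (n0 : int) (A0 : R) (w H : R -> R[i]), (2%:E <= p)%E ->
      0 < a <= 1 -> n0%:~R <= N <= n0%:~R + 1 -> 0 <= A0 ->
      is_schwartz w -> is_schwartz H ->
      (forall xi, fourier w xi = H ((xi - N) / a)) ->
      (forall y, cabs (H y) <= A0 * weight y ^+ m) ->
      (forall y, cabs (cderiv 1 H y) <= A0 * weight y ^+ m) ->
      (Mnorm psi s p (distr w) <= (C * A0 * (japanese n0 `^ s * Num.sqrt a))%:E)%E.
Proof.
move=> hpsi s0; have [l sl] : exists l, s <= l%:R.
  by exists (Num.truncn s).+1; exact/ltW/truncnS_gt.
have [M0 M00 hM0] := cutoff_bounded hpsi 0; have [M1 M10 hM1] := cutoff_bounded hpsi 1.
(* The factor 8 comes from the sum over [n], [2 ^+ l] from Peetre's inequality, [2 * pi] from the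
   bound on each box, [5 ^+ l.+1] from comparing distances. *)
pose Cp := M0 + M1; pose C := 8 * (2 ^+ l * (2 * pi * Cp * 5 ^+ l.+1)).
have Cp0 : 0 <= Cp by rewrite addr_ge0.
have C0 : 0 <= C.
  by rewrite /C !mulr_ge0 ?exprn_ge0 ?pi_ge0.
exists l.+2, C => //.
move=> p a N n0 A0 w H p2 /andP[a0 a1] /andP[N1 N2] A00 sw sH wH HA H'A.
have ia : 0 < a^-1 by rewrite invr_gt0.
pose K n := Cp * A0 * 5 ^+ l.+1 * weight ((n - n0)%:~R : R) ^+ l.+1.
have K0 n : 0 <= K n by rewrite /K !mulr_ge0 ?exprn_ge0 ?weight_ge0.
have boxle n : (L2norm (box psi n (distr w)) <= (2 * pi * K n * Num.sqrt a)%:E)%E.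
  rewrite box_distr//; last exact: tame_cutoff.
  pose Psi xi := (psi (xi - n%:~R))%:C%C.
  pose G xi := H ((xi - N) / a).
  have GE : (fun xi => (psi (xi - n%:~R))%:C%C * fourier w xi) = fun xi => Psi xi * G xi.
    by apply/funext => xi; rewrite wH.
  rewrite GE.
  have affE xi : (xi - N) / a = a^-1 * xi + (- (N / a)) by ring.
  have sG : is_schwartz G.
    have := schwartz_affine (- (N / a)) (lt0r_neq0 ia) sH.
    by under [X in is_schwartz X]eq_fun do rewrite -affE.
  have sPG : is_schwartz (fun xi => Psi xi * G xi).
    have := schwartzM sG (tame_cutoff hpsi n%:~R).
    by under [X in is_schwartz X]eq_fun do rewrite mulrC.
  have dPG (xi : R) : has_cderiv (fun xi => Psi xi * G xi) xi
      ((derive1n 1 psi (xi - n%:~R))%:C%C * G xi + Psi xi * (a^-1%:C%C * cderiv 1 H ((xi - N) / a))).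
    apply: has_cderivM; first exact: (has_cderiv_cutoff hpsi 0).
    have := @has_cderiv_affine _ H a^-1 (- (N / a)) xi _ (csmooth_has _ (schwartz_smooth sH)).
    by under [X in has_cderiv X]eq_fun do rewrite -affE; rewrite -affE.
  (* Decay in frequency becomes decay in [n]: the left side vanishes off the support of the cutoff,
     and on it [xi - N] is within 5/4 of [n - n0]. Dividing [xi - N] by [a <= 1] only lowers the
     weight. *)
  have key (xi : R) : (`|psi (xi - n%:~R)| + `|derive1n 1 psi (xi - n%:~R)|) * weight ((xi - N) / a) ^+ l.+1 <=
      Cp * (5 ^+ l.+1 * weight ((n - n0)%:~R : R) ^+ l.+1).
    have rhs0 : 0 <= Cp * (5 ^+ l.+1 * weight ((n - n0)%:~R : R) ^+ l.+1).
      by rewrite !mulr_ge0 ?exprn_ge0 ?weight_ge0.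
    have [x1|x1] := ltP (xi - n%:~R) (- (1 / 4)).
      rewrite (cutoff_eq0 hpsi 1 (or_introl x1)) (cutoff_eq0 hpsi 0 (or_introl x1) : psi _ = 0).
      by rewrite normr0 addr0 mul0r.
    have [x2|x2] := ltP (5 / 4) (xi - n%:~R).
      rewrite (cutoff_eq0 hpsi 1 (or_intror x2)) (cutoff_eq0 hpsi 0 (or_intror x2) : psi _ = 0).
      by rewrite normr0 addr0 mul0r.
    rewrite ler_pM ?addr_ge0 ?exprn_ge0 ?weight_ge0//; first by rewrite lerD.
    rewrite -exprMn lerXn2r ?nnegrE ?mulr_ge0 ?weight_ge0// /weight.
    rewrite ler_pdivlMr ?ltr_pwDl ?sqr_ge0// mulrC ler_pdivrMr ?ltr_pwDl ?sqr_ge0//.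
    apply: (@le_trans _ _ (5 * (1 + (xi - N) ^+ 2))).
      rewrite intrB; move: (n%:~R : R) (n0%:~R : R) x1 x2 N1 N2 => y z x1 x2 N1 N2.
      apply: sqr_dist_le; rewrite -real_normK ?num_real// lerXn2r ?nnegrE// ler_norml.
      by apply/andP; split; lra.
    rewrite ler_pM2l// lerD2l exprMn ler_peMr ?sqr_ge0// exprVn invf_ge1 ?exprn_gt0//.
    by rewrite exprn_ile1// ltW.
  apply: (L2norm_fourier_inv_le (N := N) a0 (K0 n) sPG).
    move=> xi; rewrite cabsM cabs_real.
    apply: (@le_trans _ _ (`|psi (xi - n%:~R)| * (A0 * weight ((xi - N) / a) ^+ l.+1 * weight ((xi - N) / a)))).
      by rewrite ler_wpM2l// /G -mulrA -exprSr.
    rewrite [leLHS](_ : _ = A0 * (`|psi (xi - n%:~R)| * weight ((xi - N) / a) ^+ l.+1) * weight ((xi - N) / a)); last by ring.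
    rewrite ler_wpM2r ?weight_ge0// /K [leRHS](_ : _ = A0 * (Cp * (5 ^+ l.+1 * weight ((n - n0)%:~R : R) ^+ l.+1))); last by ring.
    rewrite ler_wpM2l// (le_trans _ (key xi))// ler_wpM2r ?exprn_ge0 ?weight_ge0//.
    by rewrite lerDl.
  move=> xi; rewrite (has_cderiv_ext1 dPG).
  rewrite (le_trans (cabsD _ _))// !cabsM !cabs_real (ger0_norm (ltW ia)).
  set p0 := `|psi _|; set p1 := `|derive1n 1 psi _|; set W := weight ((xi - N) / a).
  have W0 : 0 <= W by exact: weight_ge0.
  have p00 : 0 <= p0 by exact: normr_ge0.
  have p10 : 0 <= p1 by exact: normr_ge0.
  (* The term where the cutoff is differentiated lacks the factor [a^-1] of the other one; inserting
     it is harmless since [a <= 1]. *)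
  apply: (@le_trans _ _ (p1 * (a^-1 * (A0 * W ^+ l.+2)) + p0 * (a^-1 * (A0 * W ^+ l.+2)))).
    rewrite lerD ?ler_wpM2l//; last by rewrite ltW.
    have Wn0 : 0 <= A0 * W ^+ l.+2 by apply: mulr_ge0 => //; exact: exprn_ge0.
    apply: (le_trans (HA _)); rewrite -/W; apply: ler_peMl => //.
    by rewrite invf_ge1.
  rewrite [leLHS](_ : _ = A0 / a * ((p0 + p1) * W ^+ l.+1) * W); last by rewrite exprSr; ring.
  rewrite ler_wpM2r// [leRHS](_ : _ = A0 / a * (Cp * (5 ^+ l.+1 * weight ((n - n0)%:~R : R) ^+ l.+1))); last by rewrite /K; ring.
  by apply: ler_wpM2l; [rewrite mulr_ge0 // ltW|exact: key].
rewrite /Mnorm.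
have -> : C * A0 * (japanese n0 `^ s * Num.sqrt a) =
    8 * (2 ^+ l * (2 * pi * (Cp * A0 * 5 ^+ l.+1) * (japanese n0 `^ s * Num.sqrt a))).
  by rewrite /C; ring.
apply: (lpnorm_le (n0 := n0) p2).
- by rewrite !mulr_ge0 ?exprn_ge0 ?pi_ge0 ?powR_ge0 ?sqrtr_ge0.
- by move=> n; rewrite mule_ge0 ?lee_fin ?powR_ge0//; apply: le_ereal_inf_tmp => _ [f _ <-]; exact: Lnorm_ge0.
- move=> n; apply: (@le_trans _ _ ((japanese n `^ s)%:E * (2 * pi * K n * Num.sqrt a)%:E)%E).
    by rewrite lee_wpmul2l// lee_fin powR_ge0.
  rewrite -EFinM lee_fin.
  apply: (@le_trans _ _ ((2 ^+ l * japanese n0 `^ s * (1 + ((n - n0)%:~R : R) ^+ 2) ^+ l) * (2 * pi * K n * Num.sqrt a))).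
    apply: ler_wpM2r; last exact: japanese_peetre.
    by apply: mulr_ge0; [apply: mulr_ge0; [rewrite mulr_ge0 ?pi_ge0|exact: K0]|exact: sqrtr_ge0].
  rewrite /K /weight; set d := 1 + _; rewrite [d^-1 ^+ l.+1]exprS; have d0 : 0 < d by rewrite ltr_pwDl ?sqr_ge0.
  rewrite le_eqVlt; apply/orP; left; apply/eqP.
  have E : d ^+ l * d^-1 ^+ l = 1 by rewrite -exprMn mulfV ?gt_eqF// expr1n.
  rewrite [LHS](_ : _ = d ^+ l * d^-1 ^+ l * (2 ^+ l * (2 * pi * (Cp * A0 * 5 ^+ l.+1) *
    (japanese n0 `^ s * Num.sqrt a)) * d^-1)); last by ring.
  by rewrite E mul1r.
Qed.

End Norms.

(** * Differential polynomials of a soliton profile *)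

Section DifferentialPolynomials.
Context {R : realType}.
Implicit Types (f u q : R -> R[i]) (x : R).

(* A monomial is a list of factors [d^e v_b], encoded as pairs (e, b). *)
Definition mono (m : seq (nat * bool)) f x : R[i] :=
  \prod_(e <- m) cderiv e.1 (vpm e.2 f) x.

Definition dpeval (l : seq (R * seq (nat * bool))) f x : R[i] :=
  \sum_(t <- l) t.1%:C%C * mono t.2 f x.

(* par: parity of the number of factors; s: lower bound on this number;
   W: number of factors plus number of derivatives. *)
Definition wf_mono (par : bool) (s W : nat) (m : seq (nat * bool)) : bool :=
  [&& odd (size m) == par, (s <= size m)%N & (\sum_(e <- m) e.1 + size m == W)%N].

(** The bridge between the finite functions indexing [coefficients] and lists, for which the product
    of monomials is concatenation. *)
Definition mono_graph (j k : nat) (alpha : {ffun 'I_(2 * k + 1) -> 'I_(2 * (j - k)).+1})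
    (b : {ffun 'I_(2 * k + 1) -> bool}) : seq (nat * bool) :=
  [seq (nat_of_ord (alpha i), b i) | i : 'I_(2 * k + 1)].

Lemma mono_graph_inj j k (alpha alpha' : {ffun 'I_(2 * k + 1) -> 'I_(2 * (j - k)).+1}) b b' :
  mono_graph alpha b = mono_graph alpha' b' -> alpha = alpha' /\ b = b'.
Proof.
move=> /eq_in_map E; split; apply/ffunP => i.
  by apply/val_inj; have [] := E i (mem_enum _ i).
by have [] := E i (mem_enum _ i).
Qed.

Lemma mono_graphE j k (alpha : {ffun 'I_(2 * k + 1) -> 'I_(2 * (j - k)).+1}) b f x :
  mono (mono_graph alpha b) f x = \prod_i cderiv (alpha i) (vpm (b i) f) x.
Proof. by rewrite /mono /mono_graph big_map big_enum. Qed.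

Lemma size_mono_graph j k (alpha : {ffun 'I_(2 * k + 1) -> 'I_(2 * (j - k)).+1}) b :
  size (mono_graph alpha b) = (2 * k + 1)%N.
Proof. by rewrite size_map -cardE card_ord. Qed.

(** Odd length at least 3 means [2 k + 1] factors with [k >= 1], and the total [2 j + 1] then leaves
    [2 (j - k)] derivatives. A single exponent is at most the sum, so it fits in the ordinal
    type. *)
Lemma mono_graph_surj j (m : seq (nat * bool)) : wf_mono true 3 (2 * j).+1 m ->
  exists k, [/\ (1 <= k)%N, (k <= j)%N &
    exists alpha : {ffun 'I_(2 * k + 1) -> 'I_(2 * (j - k)).+1},
    exists b : {ffun 'I_(2 * k + 1) -> bool},
      (\sum_i alpha i == 2 * (j - k))%N /\ mono_graph alpha b = m].
Proof.
move=> /and3P[/eqP od s3 /eqP W].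
have sz : size m = (2 * (size m)./2 + 1)%N.
  by have := odd_double_half (size m); rewrite od -muln2; lia.
move: (size m)./2 sz => k sz; exists k.
have sumE : (\sum_(e <- m) e.1 = 2 * (j - k))%N by lia.
split; [lia|lia|].
have bound (i : 'I_(2 * k + 1)) : ((nth (0, true) m i).1 < (2 * (j - k)).+1)%N.
  rewrite ltnS -sumE (big_nth (0%N, true)) big_mkord.
  have im : (i < size m)%N by rewrite sz.
  by rewrite (bigD1 (Ordinal im))//= leq_addr.
exists [ffun i => Ordinal (bound i)], [ffun i : 'I_(2 * k + 1) => (nth (0%N, true) m i).2]; split.
  apply/eqP; transitivity (\sum_(e <- m) e.1)%N; last exact: sumE.
  rewrite (big_nth (0%N, true)) big_mkord sz.
  by apply: eq_bigr => i _; rewrite ffunE.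
apply: (@eq_from_nth _ (0%N, true)); first by rewrite size_mono_graph.
move=> i; rewrite size_mono_graph => ik.
rewrite (nth_map (Ordinal ik)); last by rewrite -cardE card_ord.
by rewrite !ffunE /= nth_enum_ord// -surjective_pairing.
Qed.

(** The coefficient at an index collects every occurrence of its monomial in [l], repetitions
    included. After exchanging the sums, each term of [l] meets exactly one index, by
    [mono_graph_surj] and [mono_graph_inj]. *)
Lemma nonlinearity_dpeval (j : nat) (l : seq (R * seq (nat * bool))) :
  all (fun t => wf_mono true 3 (2 * j).+1 t.2) l ->
  exists c : coefficients R j, forall f x, nonlinearity c f x = dpeval l f x.
Proof.
move=> wl; pose c : coefficients R j := fun k alpha b =>
  \sum_(t <- l) t.1 * (mono_graph alpha b == t.2)%:R.
exists c => f x.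
have cE k (alpha : {ffun 'I_(2 * k + 1) -> 'I_(2 * (j - k)).+1}) b :
    (c k alpha b)%:C%C * \prod_i cderiv (alpha i) (vpm (b i) f) x =
    \sum_(t <- l) t.1%:C%C * ((mono_graph alpha b == t.2)%:R * mono t.2 f x).
  rewrite /c rmorph_sum mulr_suml; apply: eq_bigr => t _.
  rewrite rmorphM -mulrA; congr (_ * _); rewrite rmorph_nat.
  by have [<-|_] := eqVneq; rewrite ?mul0r// mono_graphE.
rewrite /nonlinearity.
under eq_bigr do under eq_bigr do under eq_bigr do rewrite cE.
under eq_bigr do under eq_bigr do rewrite exchange_big /=.
under eq_bigr do rewrite exchange_big /=.
rewrite exchange_big /= /dpeval big_seq [RHS]big_seq; apply: eq_bigr => t tl.
have [k [k1 kj [al [bt [sal grE]]]]] := mono_graph_surj (allP wl _ tl).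
under eq_bigr do under eq_bigr do rewrite -mulr_sumr -mulr_suml.
under eq_bigr do rewrite -mulr_sumr -mulr_suml.
rewrite -mulr_sumr -mulr_suml; congr (_ * _).
rewrite -[RHS]mul1r; congr (_ * _).
have kin : k \in index_iota 1 j.+1 by rewrite mem_index_iota k1.
rewrite (bigD1_seq k) ?iota_uniq//= [X in _ + X]big1_seq ?addr0; last first.
  move=> k' /andP[k'k _]; apply: big1 => b' _; apply: big1 => al' _.
  case: eqP => // E; move: k'k; have := congr1 size E.
  by rewrite -grE !size_mono_graph => ?; rewrite (_ : k' = k) ?eqxx//; lia.
rewrite (bigD1 bt)//= [X in _ + X]big1 ?addr0; last first.
  move=> b' b'b; apply: big1 => al' _; case: eqP => // E.
  by move: E; rewrite -grE => /mono_graph_inj[_ bE]; rewrite bE eqxx in b'b.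
rewrite (bigD1 al)//= grE eqxx [X in _ + X]big1 ?addr0// => al' /andP[_ al'n].
case: eqP => // E; move: E; rewrite -grE => /mono_graph_inj[aE _].
by rewrite aE eqxx in al'n.
Qed.

(* For the soliton [u = e^{i N x} a sech (a x)], [q = i N - a tanh (a x)]. *)
Definition soliton_pair u q :=
  [/\ csmooth u, forall x, has_cderiv u x (q x * u x) &
      forall x, has_cderiv q x (- (u x * (u x)^*%C))].

(** The list is quantified before the soliton, so its real coefficients are common to all
    frequencies, amplitudes and times. *)
Definition dpoly par s W (F : (R -> R[i]) -> (R -> R[i]) -> R -> R[i]) :=
  exists2 l, all (fun t => wf_mono par s W t.2) l &
    forall u q, soliton_pair u q -> forall x, F u q x = dpeval l u x.

Lemma dpoly_ext par s W F G : dpoly par s W F ->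
  (forall u q, soliton_pair u q -> forall x, F u q x = G u q x) -> dpoly par s W G.
Proof. by case=> l wl Fl FG; exists l => // u q sq x; rewrite -FG// Fl. Qed.

Lemma dpoly_weaken par s s' W F : (s <= s')%N -> dpoly par s' W F -> dpoly par s W F.
Proof.
move=> ss [l wl Fl]; exists l => //; apply: sub_all wl => t /and3P[p1 p2 p3].
by apply/and3P; split=> //; exact: leq_trans p2.
Qed.

Lemma dpoly0 par s W : dpoly par s W (fun _ _ _ => 0).
Proof. by exists [::] => // u q _ x; rewrite /dpeval big_nil. Qed.

Lemma dpolyD par s W F G : dpoly par s W F -> dpoly par s W G ->
  dpoly par s W (fun u q x => F u q x + G u q x).
Proof.
move=> [l wl Fl] [l' wl' Gl]; exists (l ++ l'); first by rewrite all_cat wl.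
by move=> u q sq x; rewrite /dpeval big_cat /= (Fl _ _ sq) (Gl _ _ sq).
Qed.

Lemma dpolyZ par s W (r : R) F : dpoly par s W F ->
  dpoly par s W (fun u q x => r%:C%C * F u q x).
Proof.
move=> [l wl Fl]; exists [seq (r * t.1, t.2) | t <- l]; first by rewrite all_map.
move=> u q sq x; rewrite (Fl _ _ sq) /dpeval big_map mulr_sumr; apply: eq_bigr => t _.
by rewrite real_complexM mulrA.
Qed.

Lemma dpolyM par par' s s' W W' F G : dpoly par s W F -> dpoly par' s' W' G ->
  dpoly (par (+) par') (s + s') (W + W') (fun u q x => F u q x * G u q x).
Proof.
move=> [l wl Fl] [l' wl' Gl].
exists [seq (t.1 * t'.1, t.2 ++ t'.2) | t <- l, t' <- l'].
  apply/allP => _ /allpairsP[[t t'] /= [tl tl' ->]] /=.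
  have /and3P[/eqP p1 p2 /eqP p3] := allP wl _ tl.
  have /and3P[/eqP p1' p2' /eqP p3'] := allP wl' _ tl'.
  rewrite /wf_mono size_cat oddD p1 p1' eqxx leq_add//= big_cat /=.
  by rewrite -p3 -p3' addnACA.
move=> u q sq x; rewrite (Fl _ _ sq) (Gl _ _ sq) /dpeval mulr_suml.
rewrite big_allpairs_dep /=; apply: eq_bigr => t _; rewrite mulr_sumr.
apply: eq_bigr => t' _; rewrite real_complexM /mono big_cat /=.
by rewrite mulrACA.
Qed.

Lemma cderivJ k f : csmooth f -> cderiv k (fun x => (f x)^*%C) = fun x => (cderiv k f x)^*%C.
Proof.
move=> sf; elim: k => [|k IH]; first by rewrite !cderiv0.
rewrite cderivS IH; apply: has_cderiv_ext1 => x; apply: has_cderivJ.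
exact/csmooth_has/csmooth_cderiv.
Qed.

Lemma dpolyJ par s W F : dpoly par s W F ->
  dpoly par s W (fun u q x => (F u q x)^*%C).
Proof.
move=> [l wl Fl]; exists [seq (t.1, [seq (e.1, ~~ e.2) | e <- t.2]) | t <- l].
  apply/allP => _ /mapP[t tl ->] /=; have /and3P[p1 p2 p3] := allP wl _ tl.
  by rewrite /wf_mono size_map p1 p2 big_map.
move=> u q sq x; rewrite (Fl _ _ sq) /dpeval big_map rmorph_sum; apply: eq_bigr => t _ /=.
rewrite conjcM conjc_real; congr (_ * _).
have [su _ _] := sq.
rewrite /mono big_map rmorph_prod; apply: eq_bigr => e _.
rewrite [LHS](_ : _ = (cderiv e.1 (vpm e.2 u) x)^*%C)//.
have Jx : cderiv e.1 (vpm false u) x = (cderiv e.1 u x)^*%C.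
  by rewrite (_ : vpm false u = fun y => (u y)^*%C)// cderivJ.
by case: (e.2); [exact: esym Jx|rewrite Jx conjcK].
Qed.

Lemma dpoly_cderiv m : dpoly true 1 m.+1 (fun u q x => cderiv m u x).
Proof.
exists [:: (1, [:: (m, true)])].
  by rewrite /= /wf_mono /= big_seq1 /= addn1 eqxx.
by move=> u q _ x; rewrite /dpeval big_seq1 /= /mono big_seq1 /= mul1r.
Qed.

Definition pbinomial (m n l : nat) u q x : R[i] :=
  q x ^+ m * (- (q x)^*%C) ^+ n * (u x * (u x)^*%C) ^+ l.

(* Real combinations of the monomials [q^m r^n p^l], where [r = - q^*] and
   [p = |u|^2], with [l >= l0] and weight [m + n + 2 l = w]. *)
Inductive wpoly (l0 w : nat) : ((R -> R[i]) -> (R -> R[i]) -> R -> R[i]) -> Prop :=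
| wpoly0 : wpoly l0 w (fun _ _ _ => 0)
| wpolyD (c : R) m n l h : (l0 <= l)%N -> (m + n + 2 * l = w)%N -> wpoly l0 w h ->
    wpoly l0 w (fun u q x => c%:C%C * pbinomial m n l u q x + h u q x).

Lemma wpoly_ext l0 w h h' : wpoly l0 w h -> (forall u q x, h u q x = h' u q x) -> wpoly l0 w h'.
Proof.
move=> hh E; suff -> : h' = h by [].
by apply/funext => u; apply/funext => q; apply/funext => x.
Qed.

Lemma wpoly_mono l0 w c m n l : (l0 <= l)%N -> (m + n + 2 * l = w)%N ->
  wpoly l0 w (fun u q x => c%:C%C * pbinomial m n l u q x).
Proof.
move=> ll mnl; apply: (wpoly_ext (wpolyD c ll mnl (wpoly0 l0 w))) => u q x.
by rewrite addr0.
Qed.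

Lemma wpoly_add l0 w h h' : wpoly l0 w h -> wpoly l0 w h' ->
  wpoly l0 w (fun u q x => h u q x + h' u q x).
Proof.
move=> hh hh'; elim: hh => [|c m n l h1 ll mnl _ IH].
  by apply: (wpoly_ext hh') => u q x; rewrite add0r.
by apply: (wpoly_ext (wpolyD c ll mnl IH)) => u q x; rewrite addrA.
Qed.

Lemma wpoly_mul l0 w h c m n l : wpoly l0 w h ->
  wpoly (l0 + l) (w + (m + n + 2 * l)) (fun u q x => c%:C%C * pbinomial m n l u q x * h u q x).
Proof.
elim=> [|c' m' n' l' h1 ll mnl _ IH].
  by apply: (wpoly_ext (wpoly0 _ _)) => u q x; rewrite mulr0.
have ll' : (l0 + l <= l + l')%N by lia.
have mnl' : ((m + m') + (n + n') + 2 * (l + l') = w + (m + n + 2 * l))%N by lia.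
apply: (wpoly_ext (wpolyD (c * c') ll' mnl' IH)) => u q x.
by rewrite /pbinomial real_complexM !exprD; ring.
Qed.

Lemma wpolyZ l0 w h c : wpoly l0 w h -> wpoly l0 w (fun u q x => c%:C%C * h u q x).
Proof.
move=> /(wpoly_mul c 0 0 0); rewrite muln0 !addn0 => hh.
by apply: (wpoly_ext hh) => u q x; rewrite /pbinomial !expr0 !mulr1.
Qed.

Lemma wpoly_mulq l0 w h : wpoly l0 w h -> wpoly l0 w.+1 (fun u q x => q x * h u q x).
Proof.
move=> /(wpoly_mul 1 1 0 0); rewrite muln0 !addn0 addn1 => hh.
by apply: (wpoly_ext hh) => u q x; rewrite /pbinomial !expr0 expr1 !mulr1 mul1r.
Qed.

Lemma wpoly_mulr l0 w h : wpoly l0 w h ->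
  wpoly l0 w.+1 (fun u q x => - (q x)^*%C * h u q x).
Proof.
move=> /(wpoly_mul 1 0 1 0); rewrite muln0 !addn0 add0n addn1 => hh.
by apply: (wpoly_ext hh) => u q x; rewrite /pbinomial !expr0 expr1 !mulr1 !mul1r.
Qed.

Lemma wpoly_mulp l0 w h : wpoly l0 w h ->
  wpoly l0.+1 w.+2 (fun u q x => u x * (u x)^*%C * h u q x).
Proof.
move=> /(wpoly_mul 1 0 0 1); rewrite muln1 !add0n addn1 addn2 => hh.
by apply: (wpoly_ext hh) => u q x; rewrite /pbinomial !expr0 expr1 !mul1r.
Qed.

Lemma wpoly_weaken l0 l1 w h : (l0 <= l1)%N -> wpoly l1 w h -> wpoly l0 w h.
Proof.
move=> le; elim=> [|c m n l h1 ll mnl _ IH]; first exact: wpoly0.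
by apply: wpolyD => //; exact: leq_trans ll.
Qed.

Lemma has_cderivX f x d n : has_cderiv f x d ->
  has_cderiv (fun y => f y ^+ n) x (n%:R * f x ^+ n.-1 * d).
Proof.
move=> fd; elim: n => [|n IH]; first by rewrite !mul0r; exact: has_cderiv_cst.
under [X in has_cderiv X]eq_fun do rewrite exprS.
have := has_cderivM fd IH; rewrite [X in has_cderiv _ _ X](_ : _ = n.+1%:R * f x ^+ n * d)//.
case: n {IH} => [|n] /=; first by rewrite !expr0; ring.
by rewrite -[n.+2%:R]natr1 exprS; ring.
Qed.

(** From [q' = - p], [r' = p] and [p' = (q - r) p]: each derivative raises the weight by one and
    leaves a factor [p] in every term, even when [h] has terms without [p]. *)
Lemma wpoly_derive l0 w h : wpoly l0 w h ->
  exists2 h', wpoly 1 w.+1 h' &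
    forall u q, soliton_pair u q -> forall x, has_cderiv (h u q) x (h' u q x).
Proof.
elim=> [|c m n l h1 ll mnl _ [h1' wh1' dh1]].
  by exists (fun _ _ _ => 0) => [|u q _ x]; [exact: wpoly0|exact: has_cderiv_cst].
have dp u q : soliton_pair u q -> forall x,
    has_cderiv (fun y => u y * (u y)^*%C) x ((q x + (q x)^*%C) * (u x * (u x)^*%C)).
  move=> [_ du _] x; have := has_cderivM (du x) (has_cderivJ (du x)).
  by rewrite conjcM [X in has_cderiv _ _ X](_ : _ = (q x + (q x)^*%C) * (u x * (u x)^*%C))//; ring.
have dr u q : soliton_pair u q -> forall x,
    has_cderiv (fun y => - (q y)^*%C) x (u x * (u x)^*%C).
  move=> [_ _ dq] x; have := has_cderivN (has_cderivJ (dq x)).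
  by rewrite rmorphN /= opprK conjcM conjcK mulrC.
pose T u q (x : R) := c%:C%C * (
    (- m%:R * pbinomial m.-1 n l.+1 u q x + n%:R * pbinomial m n.-1 l.+1 u q x)
    + l%:R * (pbinomial m.+1 n l u q x - pbinomial m n.+1 l u q x)).
exists (fun u q x => T u q x + h1' u q x); last first.
  move=> u q sq x; apply: has_cderivD; last exact: dh1.
  rewrite /T; apply: has_cderivZ; have [_ _ dq] := sq.
  have := has_cderivM (has_cderivM (has_cderivX m (dq x)) (has_cderivX n (dr _ _ sq x)))
    (has_cderivX l (dp _ _ sq x)).
  congr has_cderiv; rewrite /pbinomial !exprS.
  have lE : l%:R * (u x * (u x)^*%C) ^+ l = l%:R * (u x * (u x)^*%C) ^+ l.-1 * (u x * (u x)^*%C).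
    by case: (l) => [|l']; rewrite ?mul0r// exprSr mulrA.
  rewrite mulrBr ![l%:R * (_ * _ ^+ l)]mulrCA lE.
  by move: ((u x * (u x)^*%C) ^+ l.-1) => pl; ring.
apply: wpoly_add => //.
apply: (wpoly_ext (h := fun u q x => (((- c * m%:R)%:C%C * pbinomial m.-1 n l.+1 u q x +
  (c * n%:R)%:C%C * pbinomial m n.-1 l.+1 u q x) +
  ((c * l%:R)%:C%C * pbinomial m.+1 n l u q x + (- c * l%:R)%:C%C * pbinomial m n.+1 l u q x)))); last first.
  by move=> u q x; rewrite /T !real_complexM !rmorphN !rmorph_nat /=; ring.
apply: wpoly_add; apply: wpoly_add.
(* When an exponent is 0, its predecessor is truncated, but the coefficient in front is then 0 as
   well. *)
- case: m mnl @T => [|m] mnl _; last by apply: wpoly_mono; lia.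
  by apply: (wpoly_ext (wpoly0 _ _)) => u q x; rewrite mulr0 mul0r.
- case: n mnl @T => [|n] mnl _; last by apply: wpoly_mono; lia.
  by apply: (wpoly_ext (wpoly0 _ _)) => u q x; rewrite mulr0 mul0r.
- case: l ll mnl @T => [|l] ll mnl _; last by apply: wpoly_mono; lia.
  by apply: (wpoly_ext (wpoly0 _ _)) => u q x; rewrite mulr0 mul0r.
- case: l ll mnl @T => [|l] ll mnl _; last by apply: wpoly_mono; lia.
  by apply: (wpoly_ext (wpoly0 _ _)) => u q x; rewrite mulr0 mul0r.
Qed.

(** From [u' = q u], the only way to avoid a factor [p] is to differentiate [u] each time, which
    gives [q ^+ m]; differentiating [q] or [h] always produces [p]. *)
Lemma cderiv_soliton m : exists2 h, wpoly 1 m h &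
  forall u q, soliton_pair u q -> forall x, cderiv m u x = u x * (q x ^+ m + h u q x).
Proof.
elim: m => [|m [h wh hE]].
  exists (fun _ _ _ => 0) => [|u q _ x]; first exact: wpoly0.
  by rewrite cderiv0 expr0 addr0 mulr1.
have [h' wh' dh] := wpoly_derive wh.
exists (fun u q x => q x * h u q x + (h' u q x + (- m%:R)%:C%C * pbinomial m.-1 0 1 u q x)).
  apply: wpoly_add; first exact: wpoly_mulq.
  apply: wpoly_add => //.
  case: m {wh hE wh' dh} => [|m]; last by apply: wpoly_mono; lia.
  by apply: (wpoly_ext (wpoly0 _ _)) => u q x; rewrite oppr0 mul0r.
move=> u q sq x; have [_ du dq] := sq.
rewrite cderivS (_ : cderiv m u = fun x => u x * (q x ^+ m + h u q x)); last first.
  by apply/funext => y; exact: hE.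
have [_ ->] := has_cderivP (has_cderivM (du x)
  (has_cderivD (has_cderivX m (dq x)) (dh _ _ sq x))).
by rewrite /pbinomial expr0 expr1 rmorphN rmorph_nat exprS; ring.
Qed.

(* On a soliton [q - q^*] and [q * q^* + p], with [p = |u|^2], are constants, and
   [schar] solves the linear recurrence with roots [i N + a] and [i N - a]. *)
Fixpoint schar (m : nat) (q p : R[i]) : R[i] :=
  match m with
  | 0 => 1
  | S m' => match m' with
           | 0 => q
           | S m'' => (q - q^*%C) * schar m' q p - (- (q * q^*%C) - p) * schar m'' q p
           end
  end.

(** Modulo [p] the recurrence has the roots [q] and [r], and the initial values 1 and [q] select the
    solution [q ^+ m]. Since it has two steps, the induction carries two consecutive indices. *)
Lemma schar_wpoly m : exists2 h, wpoly 1 m h &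
  forall u q x, schar m (q x) (u x * (u x)^*%C) = q x ^+ m + h u q x.
Proof.
suff : (exists2 h, wpoly 1 m h &
  forall u q x, schar m (q x) (u x * (u x)^*%C) = q x ^+ m + h u q x) /\
  (exists2 h, wpoly 1 m.+1 h &
  forall u q x, schar m.+1 (q x) (u x * (u x)^*%C) = q x ^+ m.+1 + h u q x) by case.
elim: m => [|m [[h wh hE] [h1 wh1 hE1]]].
  split; exists (fun _ _ _ => 0); try exact: wpoly0; move=> u q x; by rewrite addr0 ?expr0 ?expr1.
split; first by exists h1.
exists (fun u q x => (q x * h1 u q x + - (q x)^*%C * h1 u q x) +
  ((-1)%:C%C * (q x * (- (q x)^*%C * h u q x)) +
   (u x * (u x)^*%C * h u q x + 1%:C%C * pbinomial m 0 1 u q x))).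
  apply: wpoly_add; first by apply: wpoly_add; [exact: wpoly_mulq|exact: wpoly_mulr].
  apply: wpoly_add; first by apply: wpolyZ; apply: wpoly_mulq; exact: wpoly_mulr.
  apply: wpoly_add; last by apply: wpoly_mono; lia.
  by apply: (@wpoly_weaken 1 2) => //; exact: wpoly_mulp.
move=> u q x; rewrite [LHS]/= -/(schar m.+1 (q x) _) hE1 hE /pbinomial expr0 expr1.
by rewrite rmorphN rmorph1 !exprS; ring.
Qed.

Lemma dpoly_modulus l : dpoly true 1 (2 * l).+1 (fun u q x => u x * (u x * (u x)^*%C) ^+ l).
Proof.
elim: l => [|l IH].
  apply: (dpoly_ext (dpoly_cderiv 0)) => u q _ x.
  by rewrite cderiv0 expr0 mulr1.
have du := dpoly_cderiv 0.
have := dpolyM (dpolyM du (dpolyJ du)) IH.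
rewrite (_ : 1 + 1 + (2 * l).+1 = (2 * l.+1).+1)%N; last by lia.
move=> h; apply: (dpoly_weaken (s' := 1 + 1 + 1)) => //; apply: (dpoly_ext h) => u q _ x.
by rewrite cderiv0 exprS; ring.
Qed.

(** As [l >= 1], up to sign [u q^m r^n p^l] is the product of [u q^m], the conjugate of [u q^n] and
    [u p^(l-1)]: at least three factors. The power of [p] takes at least 2 of the weight
    [w <= M + 1], which forces [m] and [n] below [M]. *)
Lemma dpoly_wpoly M w h :
  (forall k, (k < M)%N -> dpoly true 1 k.+1 (fun u q x => u x * q x ^+ k)) ->
  (w <= M.+1)%N -> wpoly 1 w h -> dpoly true 3 w.+1 (fun u q x => u x * h u q x).
Proof.
move=> XM wM; elim=> [|c m n l h1 l1 mnl _ IH].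
  by apply: (dpoly_ext (dpoly0 _ _ _)) => u q _ x; rewrite mulr0.
have mM : (m < M)%N by lia.
have nM : (n < M)%N by lia.
have := dpolyM (dpolyM (XM m mM) (dpolyJ (XM n nM))) (dpoly_modulus l.-1).
rewrite (_ : m.+1 + n.+1 + (2 * l.-1).+1 = w.+1)%N; last by lia.
move=> /(dpolyZ (c * (-1) ^+ n)) hm.
apply: (dpoly_ext (dpolyD hm IH)) => u q _ x.
case: l l1 mnl hm => // l _ _ _ /=.
rewrite /pbinomial real_complexM rmorphXn rmorphN rmorph1 conjcM rmorphXn /=.
by rewrite [(- (q x)^*%C) ^+ n]exprNn [_ ^+ l.+1]exprS; ring.
Qed.

(** Strong induction: [u q^m] is the derivative of order [m] of [u] minus [u h], and since [h] is
    divisible by [p] it involves smaller powers of [q] and its conjugate only. *)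
Lemma dpoly_qX m : dpoly true 1 m.+1 (fun u q x => u x * q x ^+ m).
Proof.
have [M mM] := ubnP m; elim: M m mM => // M IH m mM.
have [h wh hE] := cderiv_soliton m.
have hm := dpoly_weaken (isT : (1 <= 3)%N) (dpoly_wpoly IH (ltnW mM) wh).
apply: (dpoly_ext (dpolyD (dpoly_cderiv m) (dpolyZ (-1) hm))) => u q sq x.
by rewrite (hE _ _ sq) rmorphN rmorph1; ring.
Qed.

(** The derivative of order [2 j] and [u] times [schar] share the leading part [u q^(2j)]. Their
    difference is divisible by [p], hence at least cubic, and is an admissible nonlinearity. *)
Lemma soliton_coefficients (j : nat) : exists c : coefficients R j,
  forall u q, soliton_pair u q -> forall x,
    (-1) ^+ j.+1 * cderiv (2 * j) u x - nonlinearity c u x =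
    (-1) ^+ j.+1 * (u x * schar (2 * j) (q x) (u x * (u x)^*%C)).
Proof.
have [h wh hE] := cderiv_soliton (2 * j); have [h2 wh2 h2E] := schar_wpoly (2 * j).
have wd := wpolyZ ((-1) ^+ j.+1) (wpoly_add wh (wpolyZ (-1) wh2)).
have [l wl lE] := dpoly_wpoly (fun k _ => dpoly_qX k) (leqnSn (2 * j)) wd.
have [c cE] := nonlinearity_dpeval wl; exists c => u q sq x.
rewrite cE -(lE _ _ sq) (hE _ _ sq) h2E rmorphXn rmorphN rmorph1 /=.
by move: ((-1) ^+ j.+1) => e; ring.
Qed.

End DifferentialPolynomials.

(** * Solitons *)

Section HyperbolicSecant.
Context {R : realType}.
Implicit Types (x y : R).

Definition sech x : R := 2 / (expR x + expR (- x)).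
Definition tanh x : R := (expR x - expR (- x)) / (expR x + expR (- x)).

Lemma cosh_gt0 x : 0 < expR x + expR (- x).
Proof. by rewrite addr_gt0 ?expR_gt0. Qed.

Lemma sech_gt0 x : 0 < sech x.
Proof. by rewrite divr_gt0 ?cosh_gt0. Qed.

Lemma sech2Dtanh2 x : sech x ^+ 2 + tanh x ^+ 2 = 1.
Proof.
have E : expR x * expR (- x) = 1 by rewrite expRN mulfV// gt_eqF ?expR_gt0.
have D := cosh_gt0 x; rewrite /sech /tanh !exprMn exprVn -mulrDl.
apply: (canLR (mulfK _)); first by rewrite expf_neq0 ?gt_eqF.
by move: E; move: (expR x) (expR (- x)) => p q E; rewrite mul1r !expr2; lra.
Qed.

Lemma is_derive_expRN x : is_derive x 1 (fun y => expR (- y)) (- expR (- x)).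
Proof.
have := @is_derive_affine _ expR (-1) 0 x (expR (-1 * x + 0)) (is_derive_expR _).
rewrite addr0 !mulN1r => h.
by under [X in is_derive _ _ X]eq_fun do rewrite -mulN1r -[_ * _]addr0.
Qed.

Lemma is_derive_inv_cosh x :
  is_derive x 1 (fun y => (expR y + expR (- y))^-1) (- (expR x - expR (- x)) / (expR x + expR (- x)) ^+ 2).
Proof.
have dc : is_derive x 1 (fun y : R => expR y + expR (- y)) (expR x - expR (- x)).
  exact: (is_deriveD (is_derive_expR x) (is_derive_expRN x)).
have := @is_deriveV _ (fun y => expR y + expR (- y)) x _ _ (lt0r_neq0 (cosh_gt0 x)) dc.
move=> /is_derive_eq; apply.
by rewrite -[LHS]/(- (_ ^- 2) * _) mulNr mulrC mulNr.
Qed.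

Lemma is_derive_sech x : is_derive x 1 sech (- (sech x * tanh x)).
Proof.
have := is_deriveMR (is_derive_cst (2 : R) x 1) (is_derive_inv_cosh x).
move=> /is_derive_eq; apply; rewrite /sech /tanh mul0r add0r.
by have := cosh_gt0 x; move: (expR x + _) (expR x - _) => d e d0; field; rewrite gt_eqF.
Qed.

Lemma is_derive_tanh x : is_derive x 1 tanh (sech x ^+ 2).
Proof.
have dn : is_derive x 1 (fun y : R => expR y - expR (- y)) (expR x + expR (- x)).
  have := is_deriveB (is_derive_expR x) (is_derive_expRN x).
  by rewrite opprK.
have := is_deriveMR dn (is_derive_inv_cosh x).
move=> /is_derive_eq; apply.
have E : expR x * expR (- x) = 1 by rewrite expRN mulfV// gt_eqF ?expR_gt0.
rewrite mulfV ?gt_eqF ?cosh_gt0//; have := sech2Dtanh2 x; rewrite /tanh.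
move: (sech x ^+ 2) => s; rewrite exprMn exprVn => h.
by rewrite mulrA mulrN -expr2 mulNr; lra.
Qed.

Lemma normr_tanh_le1 x : `|tanh x| <= 1.
Proof.
rewrite -(@ler_sqr _ `|_|) ?nnegrE// expr1n real_normK ?num_real//.
by rewrite -(sech2Dtanh2 x) lerDr sqr_ge0.
Qed.

Lemma sech_le x : sech x <= 2 * expR (- `|x|).
Proof.
rewrite /sech ler_pM2l// (expRN `|x|) lef_pV2 ?posrE ?expR_gt0 ?cosh_gt0//.
by have [x0|x0] := ger0P x; rewrite ?lerDl ?lerDr expR_ge0.
Qed.

(** Raise [1 + |x| <= m (1 + |x| / m) <= m exp (|x| / m)] to the power [m], for [m >= 1]. *)
Lemma pow_expRN_bounded m : exists M : R, forall x, (1 + `|x|) ^+ m * expR (- `|x|) <= M.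
Proof.
case: m => [|m].
  by exists 1 => x; rewrite expr0 mul1r expR_le1 oppr_le0.
exists (m.+1%:R ^+ m.+1) => x; rewrite expRN ler_pdivrMr ?expR_gt0//.
have m0 : 0 < m.+1%:R :> R by rewrite ltr0n.
rewrite -[X in expR X](@divfK _ m.+1%:R) ?gt_eqF// expRM_natr -exprMn.
apply: lerXn2r; rewrite ?nnegrE ?addr_ge0// ?mulr_ge0 ?expR_ge0//.
have := expR_ge1Dx (`|x| / m.+1%:R); rewrite -(ler_pM2l m0).
apply: le_trans; rewrite mulrDr mulr1 mulrCA mulfV ?gt_eqF// mulr1 lerD2r.
by rewrite ler1n.
Qed.

(** The functions [sech] times a polynomial in [tanh] are stable under differentiation, because the
    derivative of [tanh] is [1 - tanh^2]. They decay like [sech], as [tanh] is bounded. *)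
Lemma schwartz_sech : is_schwartz (fun x => (sech x)%:C%C).
Proof.
pose P h := exists p : {poly R}, h = fun x : R => (sech x * p.[tanh x])%:C%C.
apply: (@schwartz_class _ P); last first.
- by exists 1; apply/funext => x; rewrite hornerC mulr1.
- move=> _ [p ->] m; have [M hM] := pow_expRN_bounded m.
  exists (2 * M * \sum_(i < size p) `|p`_i|) => x; rewrite cabs_real normrM.
  rewrite (gtr0_norm (sech_gt0 x)) mulrA; have s0 := ltW (sech_gt0 x).
  apply: ler_pM; rewrite ?mulr_ge0 ?exprn_ge0 ?addr_ge0//.
    rewrite mulrC; apply: (@le_trans _ _ (2 * expR (- `|x|) * (1 + `|x|) ^+ m)).
      by rewrite ler_wpM2r ?exprn_ge0 ?addr_ge0// sech_le.
    by rewrite -mulrA ler_pM2l// mulrC.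
  rewrite horner_coef (le_trans (ler_norm_sum _ _ _))// ler_sum// => i _.
  by rewrite normrM ler_piMr// normrX exprn_ile1// normr_tanh_le1.
- move=> _ [p ->].
  exists (fun x => (sech x * (- 'X * p + (1 - 'X^2) * p^`()).[tanh x])%:C%C); first by eexists.
  move=> x; apply: has_cderiv_real.
  have dp : is_derive x 1 (fun y => p.[tanh y]) (p^`().[tanh x] * sech x ^+ 2).
    exact: (@is_derive1_comp _ (horner p) tanh x _ _ (is_derive_poly p _) (is_derive_tanh x)).
  have := is_deriveMR (is_derive_sech x) dp => /is_derive_eq; apply.
  rewrite hornerD !hornerM hornerN hornerX hornerD hornerN hornerXn hornerC.
  rewrite (_ : 1 - tanh x ^+ 2 = sech x ^+ 2); last by rewrite -(sech2Dtanh2 x) addrK.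
  by move: (sech x) (tanh x) => s t; ring.
Qed.

End HyperbolicSecant.

(** * Travelling waves with a Schwartz profile *)

Section TravelingWaves.
Context {R : realType}.
Implicit Types (g : R -> R[i]) (kap V T : R).

Definition wave kap V g : R -> R -> R[i] := fun t x => cexpi (kap * t) * g (x - V * t).

(** The time derivative read on the profile. All mixed derivatives of a wave are thus waves with the
    same phase and speed and another Schwartz profile. *)
Definition wave_dt kap V g : R -> R[i] :=
  fun y => 'i%C * kap%:C%C * g y - V%:C%C * cderiv 1 g y.

Lemma schwartz_wave_dt kap V g : is_schwartz g -> is_schwartz (wave_dt kap V g).
Proof.
move=> sg; apply: schwartzB; apply: schwartzZ => //; exact: schwartz_cderiv.
Qed.

Lemma has_cderiv_shift g (y x : R) d : has_cderiv g (x - y) d -> has_cderiv (fun x => g (x - y)) x d.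
Proof.
move=> gd; have := @has_cderiv_affine _ g 1 (- y) x d; rewrite !mul1r => /(_ gd).
by under [X in has_cderiv X]eq_fun do rewrite mul1r.
Qed.

Lemma wave_dx kap V g b t : csmooth g -> dx b (wave kap V g) t = wave kap V (cderiv b g) t.
Proof.
move=> sg; rewrite /dx; elim: b => [|b IH]; first by rewrite !cderiv0.
rewrite cderivS IH; apply: has_cderiv_ext1 => x; apply: has_cderivZ.
by apply: has_cderiv_shift; exact/csmooth_has/csmooth_cderiv.
Qed.

Lemma has_cderiv_wave kap V g t x : csmooth g ->
  has_cderiv (fun t => wave kap V g t x) t (wave kap V (wave_dt kap V g) t x).
Proof.
move=> sg; have dg := @has_cderiv_affine _ g (- V) x t _ (csmooth_has _ sg).
have := has_cderivM (has_cderiv_expi_scale kap t) dg.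
have E s : - V * s + x = x - V * s by ring.
under [X in has_cderiv X]eq_fun do rewrite E.
rewrite E [X in has_cderiv _ _ X](_ : _ = wave kap V (wave_dt kap V g) t x)//.
by rewrite /wave /wave_dt (rmorphN (real_complex R)); ring.
Qed.

Lemma iter_wave_dt kap V g a : is_schwartz g -> is_schwartz (iter a (wave_dt kap V) g).
Proof. by move=> sg; elim: a => //= a; exact: schwartz_wave_dt. Qed.

Lemma wave_dtn kap V g a : is_schwartz g ->
  dt a (wave kap V g) = wave kap V (iter a (wave_dt kap V) g).
Proof.
move=> sg; apply/funext => t; apply/funext => x; rewrite /dt; move: t.
suff : cderiv a (fun t => wave kap V g t x) =
    fun t => wave kap V (iter a (wave_dt kap V) g) t x by move=> ->.
elim: a => [|a IH]; first by rewrite cderiv0.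
rewrite cderivS IH; apply: has_cderiv_ext1 => t.
by apply: has_cderiv_wave; apply: schwartz_smooth; exact: iter_wave_dt.
Qed.

Lemma wave_dt_dx kap V g a b : is_schwartz g ->
  dt a (dx b (wave kap V g)) = wave kap V (iter a (wave_dt kap V) (cderiv b g)).
Proof.
move=> sg; rewrite -wave_dtn; last exact: schwartz_cderiv.
congr dt; apply/funext => t; exact/wave_dx/schwartz_smooth.
Qed.

Lemma continuous_comp2 (h : R -> R) (k : R * R -> R) : continuous h -> continuous k ->
  continuous (fun z => h (k z)).
Proof. by move=> ch ck z; apply: continuous_comp; [exact: ck|exact: ch]. Qed.

Lemma smooth_wave kap V g T : is_schwartz g -> smooth_on_strip T (wave kap V g).
Proof.
move=> sg a b t x _; have sb := schwartz_cderiv b sg.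
have sab := iter_wave_dt kap V a sb.
have [cr ci] := schwartz_continuous sab.
have ckt : continuous (fun z : R * R => kap * z.1).
  by move=> z; apply: cvgM; [exact: cvg_cst|exact: cvg_fst].
have csh : continuous (fun z : R * R => z.2 - V * z.1).
  move=> z; apply: cvgB; first exact: cvg_snd.
  by apply: cvgM; [exact: cvg_cst|exact: cvg_fst].
have c1 := continuous_comp2 (@continuous_cos R) ckt.
have c2 := continuous_comp2 (@continuous_sin R) ckt.
have c3 := continuous_comp2 cr csh; have c4 := continuous_comp2 ci csh.
split.
- rewrite (wave_dx _ _ _ _ (schwartz_smooth sg)).
  apply: (has_cderivP (d := wave kap V (cderiv b.+1 g) t x) _).1.
  apply: has_cderivZ; apply: has_cderiv_shift; exact: (csmooth_has _ (schwartz_smooth sb)).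
- rewrite (wave_dt_dx _ _ _ _ sg).
  exact: (has_cderivP (has_cderiv_wave kap V t x (schwartz_smooth sab))).1.
- rewrite (wave_dt_dx _ _ _ _ sg).
  rewrite (_ : (fun z => _) = fun z : R * R =>
    cos (kap * z.1) * re (iter a (wave_dt kap V) (cderiv b g)) (z.2 - V * z.1) -
    sin (kap * z.1) * im (iter a (wave_dt kap V) (cderiv b g)) (z.2 - V * z.1)).
    by apply: cvgB; apply: cvgM; [exact: c1|exact: c3|exact: c2|exact: c4].
  by apply/funext => z; rewrite /wave cReM.
- rewrite (wave_dt_dx _ _ _ _ sg).
  rewrite (_ : (fun z => _) = fun z : R * R =>
    cos (kap * z.1) * im (iter a (wave_dt kap V) (cderiv b g)) (z.2 - V * z.1) +
    sin (kap * z.1) * re (iter a (wave_dt kap V) (cderiv b g)) (z.2 - V * z.1)).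
    by apply: cvgD; apply: cvgM; [exact: c1|exact: c4|exact: c2|exact: c3].
  by apply/funext => z; rewrite /wave cImM.
Qed.

Lemma rapid_wave kap V g T : is_schwartz g -> rapid_decay T (wave kap V g).
Proof.
move=> sg m a b T' _; rewrite (wave_dt_dx _ _ _ _ sg).
have sab := iter_wave_dt kap V a (schwartz_cderiv b sg).
have [M hM] := schwartz_rapid sab m.
(* For [|t| <= T'] the wave has moved by at most [|V| |T'|], so [|x|] is at most the first factor's
   base times [1 + |y|]. *)
exists ((1 + `|V| * `|T'|) ^+ m * M) => t x tT.
rewrite /wave cabsM cabs_expi mul1r; set y := x - V * t.
have c0 : 0 <= 1 + `|V| * `|T'| by rewrite addr_ge0// mulr_ge0.
apply: (@le_trans _ _ ((1 + `|V| * `|T'|) ^+ m * ((1 + `|y|) ^+ m * cabs (iter a (wave_dt kap V) (cderiv b g) y)))).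
  rewrite mulrA -exprMn ler_wpM2r ?cabs_ge0// lerXn2r ?nnegrE ?mulr_ge0 ?addr_ge0//.
  have xE : x = y + V * t by rewrite /y subrK.
  have : `|x| <= `|y| + `|V| * `|T'|.
    rewrite {1}xE (le_trans (ler_normD _ _))// lerD2l normrM ler_wpM2l//.
    by rewrite (le_trans tT)// ler_norm.
  have := mulr_ge0 (mulr_ge0 (normr_ge0 V) (normr_ge0 T')) (normr_ge0 y).
  by move: `|V| `|T'| `|y| `|x| => v t' y' x'; lra.
by rewrite ler_wpM2l ?exprn_ge0.
Qed.

End TravelingWaves.

(** * The solitons as solutions, and the dependence of their speed on the frequency *)

Section Solitons.
Context {R : realType}.
Implicit Types (N a h y : R).

(** The imaginary part is stored divided by [- a], so both components are polynomials in [N] and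
    [a ^+ 2] and the velocity needs no division. *)
Fixpoint zpow (N a : R) (m : nat) : R * R :=
  if m is m'.+1 then
    let: (c, v) := zpow N a m' in (N * c - a ^+ 2 * v, N * v + c)
  else (1, 0).

(* [(N - i a)^m = zre m - i a * zim m]. *)
Definition zre N a m := (zpow N a m).1.
Definition zim N a m := (zpow N a m).2.

Lemma zreS N a m : zre N a m.+1 = N * zre N a m - a ^+ 2 * zim N a m.
Proof. by rewrite /zre /zim /=; case: (zpow N a m). Qed.
Lemma zimS N a m : zim N a m.+1 = N * zim N a m + zre N a m.
Proof. by rewrite /zre /zim /=; case: (zpow N a m). Qed.

(** On the soliton the coefficients of the recurrence are the constants [2 i N] and [- (N^2 + a^2)],
    so its roots are [i (N - i a)] and [i (N + i a)]. The right side is the combination of their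
    powers with initial values 1 and [i N - a tanh y]. *)
Lemma schar_sech N a y m :
  schar m ('i%C * N%:C%C - (a * tanh y)%:C%C) ((a * sech y) ^+ 2)%:C%C =
  'i%C ^+ m * ((zre N a m)%:C%C + 'i%C * (a * tanh y * zim N a m)%:C%C).
Proof.
pose q : R[i] := 'i%C * N%:C%C - (a * tanh y)%:C%C.
pose p : R[i] := ((a * sech y) ^+ 2)%:C%C.
have i2 : 'i%C * 'i%C = -1 :> R[i] by rewrite -expr2 sqr_i.
suff : schar m q p = 'i%C ^+ m * ((zre N a m)%:C%C + 'i%C * (a * tanh y * zim N a m)%:C%C) /\
  schar m.+1 q p = 'i%C ^+ m.+1 * ((zre N a m.+1)%:C%C + 'i%C * (a * tanh y * zim N a m.+1)%:C%C) by case.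
elim: m => [|m [IH IH1]].
  rewrite expr0 expr1 /schar; split; apply: cplx_ext; rewrite /q /zre /zim /=; ring.
split=> //.
rewrite (_ : schar m.+2 q p = (q - q^*%C) * schar m.+1 q p - (- (q * q^*%C) - p) * schar m q p)//.
rewrite IH IH1.
have E1 : q - q^*%C = 2 * ('i%C * N%:C%C).
  by apply: cplx_ext; rewrite /q /= ; ring.
have E2 : - (q * q^*%C) - p = - (N ^+ 2 + a ^+ 2)%:C%C.
  have hs : sech y ^+ 2 = 1 - tanh y ^+ 2 by rewrite -(sech2Dtanh2 y) addrK.
  rewrite /q /p (exprMn 2 a) hs; move: (tanh y) => t.
  by apply: cplx_ext => /=; ring.
rewrite E1 E2 !(zimS, zreS) ['i%C ^+ m.+2]exprS ['i%C ^+ m.+1]exprS.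
move: ('i%C ^+ m) (zre N a m) (zim N a m) (a * tanh y) => im c v t.
rewrite !real_complexE.
move: i2; move: ('i%C : R[i]) => I i2.
move: (N%:C%C) (a%:C%C) (c%:C%C) (v%:C%C) (t%:C%C) => N' a' c' v' t'.
rewrite [LHS](_ : _ = I * I * (2 * N' * im * (N' * c' - a' ^+ 2 * v' + I * (t' * (N' * v' + c')))) +
  (N' ^+ 2 + a' ^+ 2) * im * (c' + I * (t' * v'))); last by ring.
rewrite [RHS](_ : _ = I * I * (im * (N' * (N' * c' - a' ^+ 2 * v') - a' ^+ 2 * (N' * v' + c') +
  I * (t' * (N' * (N' * v' + c') + (N' * c' - a' ^+ 2 * v')))))); last by ring.
by rewrite i2; ring.
Qed.

Definition profile N a y : R[i] := cexpi (N * y) * (a * sech (a * y))%:C%C.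

Lemma schwartz_bump a : a != 0 -> is_schwartz (fun y => (a * sech (a * y))%:C%C).
Proof.
move=> a0; have := schwartzZ a%:C%C (schwartz_affine 0 a0 schwartz_sech).
by under [X in is_schwartz X]eq_fun do rewrite -real_complexM addr0.
Qed.

Lemma schwartz_profile N a : a != 0 -> is_schwartz (profile N a).
Proof.
move=> /schwartz_bump sb; have := schwartzM sb (tame_expi N).
by under [X in is_schwartz X]eq_fun do rewrite mulrC.
Qed.

Lemma is_derive_scale (f : R -> R) a y d : is_derive (a * y) 1 f d ->
  is_derive y 1 (fun y => f (a * y)) (a * d).
Proof.
move=> fd; have := @is_derive_affine _ f a 0 y d; rewrite addr0 => /(_ fd).
by under [X in is_derive _ _ X]eq_fun do rewrite addr0.
Qed.

Lemma is_deriveZR (f : R -> R) a y d : is_derive y 1 f d -> is_derive y 1 (fun y => a * f y) (a * d).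
Proof.
move=> fd; have := is_deriveMR (is_derive_cst a y 1) fd.
by move=> /is_derive_eq; apply; rewrite mul0r add0r.
Qed.

Lemma has_cderiv_profile N a y :
  has_cderiv (profile N a) y (('i%C * N%:C%C - (a * tanh (a * y))%:C%C) * profile N a y).
Proof.
have db := has_cderiv_real (is_deriveZR a (is_derive_scale (is_derive_sech (a * y)))).
have := has_cderivM (has_cderiv_expi_scale N y) db.
rewrite [X in has_cderiv _ _ X](_ : _ = ('i%C * N%:C%C - (a * tanh (a * y))%:C%C) * profile N a y)//.
by rewrite /profile !real_complexE; ring.
Qed.

Lemma sqr_wave N a kap V t x :
  wave kap V (profile N a) t x * (wave kap V (profile N a) t x)^*%C =
  ((a * sech (a * (x - V * t))) ^+ 2)%:C%C.
Proof.
rewrite mulcJ /wave /profile; congr ((_)%:C)%C.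
by rewrite cabsM cabsM cabs_expi cabs_expi !mul1r cabs_real real_normK// num_real.
Qed.

Lemma soliton_wave N a kap V t : a != 0 ->
  soliton_pair (wave kap V (profile N a) t)
    (fun x => 'i%C * N%:C%C - (a * tanh (a * (x - V * t)))%:C%C).
Proof.
move=> a0; have sp := schwartz_profile N a0.
have du x : has_cderiv (wave kap V (profile N a) t) x
    (('i%C * N%:C%C - (a * tanh (a * (x - V * t)))%:C%C) * wave kap V (profile N a) t x).
  rewrite /wave mulrCA; apply: has_cderivZ; apply: has_cderiv_shift.
  exact: has_cderiv_profile.
split; [|exact: du|].
  apply: csmoothM; first exact: (tame_cst _).1.
  have := schwartz_smooth (schwartz_affine (- (V * t)) (oner_neq0 R) sp).
  by under [X in csmooth X]eq_fun do rewrite mul1r.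
move=> x; rewrite sqr_wave.
have dt : has_cderiv (fun y => (a * tanh (a * y))%:C%C) (x - V * t) (a * (a * sech (a * (x - V * t)) ^+ 2))%:C%C.
  apply: has_cderiv_real; apply: is_deriveZR; apply: is_derive_scale; exact: is_derive_tanh.
rewrite (_ : - _ = 0 - (a * (a * sech (a * (x - V * t)) ^+ 2))%:C%C); last first.
  by rewrite sub0r exprMn expr2 mulrA.
exact: (has_cderivB (has_cderiv_cst ('i%C * N%:C%C) x) (has_cderiv_shift dt)).
Qed.

(** Since [(-1)^(j+1) i^(2j) = -1], the equation reads [i u_t = (K + i a V tanh) u], with [V = zim]
    and [K = zre]. A wave of speed [V] and phase [kap] satisfies
    [i u_t = (V N - kap + i a V tanh) u]; the [tanh] terms dictate the speed, the others give
    [kap = V N - K]. *)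
Lemma soliton_solution (j : nat) : exists c : coefficients R j,
  forall T N a, a != 0 ->
    classical_solution c T
      (wave (zim N a (2 * j) * N - zre N a (2 * j)) (zim N a (2 * j)) (profile N a)).
Proof.
have [c cE] := @soliton_coefficients R j; exists c => T N a a0.
set V := zim N a _; set K := zre N a _; set kap := V * N - K.
have sp := schwartz_profile N a0.
split; [exact: smooth_wave|exact: rapid_wave|move=> t x _].
have := cE _ _ (soliton_wave N kap V t a0) x.
rewrite sqr_wave schar_sech -/V -/K => /eqP; rewrite subr_eq => /eqP E.
rewrite /dx {}E wave_dtn//= addrA.
suff -> : 'i%C * wave kap V (wave_dt kap V (profile N a)) t x =
    - ((-1) ^+ j.+1 * (wave kap V (profile N a) t x *
      ('i%C ^+ (2 * j) * (K%:C%C + 'i%C * (a * tanh (a * (x - V * t)) * V)%:C%C)))).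
  by rewrite addNr add0r.
rewrite /wave /wave_dt (has_cderiv_ext1 (fun y => has_cderiv_profile N a y)).
have i2 : 'i%C * 'i%C = -1 :> R[i] by rewrite -expr2 sqr_i.
rewrite exprM sqr_i exprS.
have sj : (-1) ^+ j * (-1) ^+ j = 1 :> R[i] by rewrite -expr2 sqrr_sign.
move: (tanh _) (profile _ _ _) (cexpi _) => th g e.
rewrite /kap !real_complexE.
move: i2 sj; move: ('i%C : R[i]) ((-1) ^+ j) => I s i2 sj.
rewrite [LHS](_ : _ = e * g * (I * I * (V%:C%C * N%:C%C - K%:C%C) -
  (I * I) * (V%:C%C * N%:C%C) + I * (V%:C%C * a%:C%C * th%:C%C))); last by ring.
rewrite [RHS](_ : _ = s * s * (e * g * (K%:C%C + I * (a%:C%C * th%:C%C * V%:C%C)))); last by ring.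
by rewrite i2 sj; ring.
Qed.

(** With [c = zre] and [v = zim] at the power [m], the ratio [n v / c] is about [m] for large [n];
    the hypothesis allows twice that. The conclusion makes [v] small enough against [n c] to pass
    this slack on to the power [m + 1]. *)
Lemma ratio_step (n c v m : R) : 0 < n -> 0 <= c -> 0 <= v -> 0 <= m ->
  n * v <= 2 * m * c -> 4 * m * (m + 1) <= n ^+ 2 -> 2 * (m + 1) * v <= n * c.
Proof.
move=> n0 c0 v0 m0 nv mn; rewrite -(ler_pM2l n0).
have h1 : (2 * (m + 1)) * (n * v) <= (2 * (m + 1)) * (2 * m * c).
  by rewrite ler_wpM2l// mulr_ge0// addr_ge0.
have h2 : 4 * m * (m + 1) * c <= n ^+ 2 * c by rewrite ler_wpM2r.
by rewrite expr2 in h2; lra.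
Qed.

(* The group velocity of the soliton is [zim N a (2 j)]: this bounds its discrete
   derivative in N from below. *)
Lemma velocity_gap M (N a h : R) : 2 * M.+1%:R <= N -> 0 < a <= 1 -> 0 <= h ->
  forall m, (m.+2 <= M)%N ->
    h * (N / 2) ^+ m <= zim (N + h) a m.+2 - zim N a m.+2.
Proof.
move=> NM /andP[a0 a1] h0; pose N' := N + h.
have N2 : 2 <= N.
  by apply: le_trans NM; rewrite ler_peMr// ler1n.
have N0 : 0 < N by lra.
pose b := a ^+ 2; have bE : a ^+ 2 = b by [].
have b0 : 0 <= b by rewrite exprn_ge0// ltW.
have b1 : b <= 1 by rewrite exprn_ile1// ltW.
clearbody b.
have NM2 : 4 * M%:R * (M%:R + 1) <= N ^+ 2 :> R.
  have M0 : 0 <= M%:R :> R by []; move: NM; rewrite -[M.+1%:R]natr1 expr2 => NM.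
  by have := ler_pM _ _ NM NM; rewrite !mulr_ge0 ?addr_ge0// => /(_ isT isT); lra.
have mbound m : (m <= M)%N -> 4 * m%:R * (m%:R + 1) <= N ^+ 2 :> R.
  move=> mM; apply: le_trans NM2; have mM' : m%:R <= M%:R :> R by rewrite ler_nat.
  by rewrite -!mulrA ler_pM2l// ler_pM ?addr_ge0// lerD2r.
(* By [ratio_step], the term [a ^+ 2 * zim] removed from [N1 * zre] is at most half of it, whence
   the growth by a factor [N / 2] at each step. *)
have I1 N1 : N <= N1 -> forall m, (m <= M)%N ->
    [/\ (N / 2) ^+ m <= zre N1 a m, 0 <= zim N1 a m & N1 * zim N1 a m <= 2 * m%:R * zre N1 a m].
  move=> NN1; elim=> [_|m IH mM].
    by rewrite /zre /zim /= expr0 !mulr0 mul0r; split.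
  have [c0 v0 vc] := IH (ltnW mM).
  have c0' : 0 <= zre N1 a m by apply: le_trans c0; rewrite exprn_ge0// divr_ge0// ltW.
  have mb := mbound m (ltnW mM); rewrite zreS zimS bE exprS -[m.+1%:R]natr1.
  have m0 : 0 <= m%:R :> R by [].
  have N10 : 0 < N1 by lra.
  have mb1 : 4 * m%:R * (m%:R + 1) <= N1 ^+ 2.
    by apply: (le_trans mb); rewrite lerXn2r ?nnegrE// ltW.
  have key := ratio_step N10 c0' v0 m0 vc mb1.
  move: (zre N1 a m) (zim N1 a m) (m%:R : R) c0 c0' v0 vc m0 key => c v n c0 c0' v0 vc n0 key.
  have bv : b * v <= v by rewrite ler_piMl.
  have nv : 0 <= n * v by rewrite mulr_ge0.
  split.
  - have h1 : N / 2 * (N / 2) ^+ m <= N1 / 2 * c.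
      by rewrite ler_pM ?exprn_ge0 ?divr_ge0 ?(ltW N0)// ler_pM2r ?invr_gt0.
    by apply: (le_trans h1); lra.
  - by rewrite addr_ge0// mulr_ge0// ltW.
  - have h1 : N1 * (N1 * v) <= N1 * (2 * n * c) by rewrite ler_pM2l.
    have h2 : (2 * (n + 1)) * (b * v) <= (2 * (n + 1)) * v.
      by rewrite ler_wpM2l// mulr_ge0// addr_ge0.
    by lra.
(* The differences in [N] obey the recurrences of [zre] and [zim] with source terms [h * zre N'] and
   [h * zim N']. These are nonnegative by [I1] and satisfy the same ratio bound, so the invariant
   persists for [Dc] and [Dv]. *)
pose Dc m := zre N' a m - zre N a m; pose Dv m := zim N' a m - zim N a m.
have NN' : N <= N' by rewrite lerDl.
have DcS m : Dc m.+1 = N * Dc m + h * zre N' a m - b * Dv m.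
  by rewrite /Dc /Dv !zreS bE /N'; ring.
have DvS m : Dv m.+1 = N * Dv m + h * zim N' a m + Dc m.
  by rewrite /Dc /Dv !zimS /N'; ring.
have I2 m : (m <= M)%N -> [/\ 0 <= Dc m, 0 <= Dv m & N * Dv m <= 2 * m%:R * Dc m] /\
    h * (N / 2) ^+ m <= Dc m.+1.
  elim: m => [_|m IH mM].
    split; first by rewrite /Dc /Dv /zre /zim /= !subrr !mulr0; split.
    by rewrite DcS /Dc /Dv /zre /zim /= !subrr !mulr0 expr0 add0r subr0.
  have [[c0 v0 vc] _] := IH (ltnW mM).
  have [c'0 v'0 vc'] := I1 _ NN' m (ltnW mM).
  have [c''0 _ _] := I1 _ NN' m.+1 mM.
  have m0 : 0 <= m%:R :> R by [].
  have key := ratio_step N0 c0 v0 m0 vc (mbound m (ltnW mM)).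
  have c'0' : 0 <= zre N' a m by apply: le_trans c'0; rewrite exprn_ge0// divr_ge0// ltW.
  have inv : [/\ 0 <= Dc m.+1, 0 <= Dv m.+1 & N * Dv m.+1 <= 2 * m.+1%:R * Dc m.+1].
    rewrite DcS DvS -[m.+1%:R]natr1.
    move: (zre N' a m) (zim N' a m) (m%:R : R) (Dc m) (Dv m) m0 c0 v0 vc c'0' v'0 vc' key.
    move=> c' v' n dc dv n0 dc0 dv0 vc c'0' v'0 vc' key.
    have bv : b * dv <= dv by rewrite ler_piMl.
    have nv : 0 <= n * dv by rewrite mulr_ge0.
    have hc : 0 <= h * c' by rewrite mulr_ge0.
    have hv : 0 <= h * v' by rewrite mulr_ge0.
    have Ndc : 0 <= N * dc by rewrite mulr_ge0// ltW.
    have Ndv : 0 <= N * dv by rewrite mulr_ge0// ltW.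
    split; [lra|lra|].
    have h1 : N * (N * dv) <= N * (2 * n * dc) by rewrite ler_pM2l.
    have h2 : (2 * (n + 1)) * (b * dv) <= (2 * (n + 1)) * dv.
      by rewrite ler_wpM2l// mulr_ge0// addr_ge0.
    have h3 : h * (N * v') <= h * (2 * n * c').
      by rewrite ler_wpM2l// (le_trans _ vc')// ler_wpM2r.
    by lra.
  split=> //; have [C0 V0 VC] := inv.
  have key' := ratio_step N0 C0 V0 (ler0n _ _) VC (mbound m.+1 mM).
  rewrite [leRHS]DcS.
  have bv : b * Dv m.+1 <= Dv m.+1 by rewrite ler_piMl.
  have hc : h * (N / 2) ^+ m.+1 <= h * zre N' a m.+1 by rewrite ler_wpM2l.
  have nv : 0 <= m.+1%:R * Dv m.+1 by rewrite mulr_ge0.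
  by move: (Dv m.+1) (Dc m.+1) (m.+1%:R : R) bv C0 V0 key' nv => dv dc n bv C0 V0 key' nv; lra.
(* In the recurrence for [Dv m.+2] the terms in [Dv m.+1] and [zim N'] are nonnegative, and
   [Dc m.+1] already has the required size. *)
move=> m mM; have [[_ v0 _] _] := I2 m.+1 (ltnW mM).
have [_ le] := I2 m (ltnW (ltnW mM)); apply: (le_trans le).
have [_ v'0 _] := I1 _ NN' m.+1 (ltnW mM).
rewrite -/(Dv m.+2) DvS lerDr addr_ge0// mulr_ge0//; lra.
Qed.

End Solitons.

(** * Lower bounds for the modulation norm *)

Section NormLowerBounds.
Context {R : realType}.
Implicit Types (f g : R -> R[i]) (a b x y M K : R).

Local Notation mu := (@lebesgue_measure R).

Lemma Rintegral_gt0 (h : R -> R) : continuous h -> (forall x, 0 <= h x) -> 0 < h 0 ->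
  mu.-integrable [set: R] (EFin \o h) -> 0 < (\int[mu]_x h x)%R.
Proof.
move=> ch h0 hp ih.
have h2 : h 0 / 2 < h 0 by lra.
have nb : \forall x \near (0 : R), h 0 / 2 < h x by exact: (cvgr_gt (h 0) (ch 0) _ h2).
move/nbhs_ballP : nb => [r /= r0 hr].
have hr' x : x \in `[- (r / 2), r / 2] -> h 0 / 2 <= h x.
  rewrite in_itv /= => /andP[x1 x2]; apply/ltW/hr.
  rewrite /ball /= sub0r normrN ltr_norml; apply/andP; split; lra.
have r2 : 0 < r / 2 by lra.
apply: (@lt_le_trans _ _ (h 0 / 2 * r)); first by rewrite mulr_gt0//; lra.
rewrite -lee_fin fineK; last exact: integrable_fin_num.
have le1 : ((h 0 / 2 * r)%:E <= \int[mu]_(x in `[(- (r / 2))%R, (r / 2)%R]) (h 0 / 2)%:E)%E.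
  rewrite integral_cst//= lebesgue_measure_itv /= lte_fin.
  rewrite ifT; last by lra.
  by rewrite -EFinB -EFinM lee_fin; lra.
apply: (le_trans le1).
have le2 : (\int[mu]_(x in `[(- (r / 2))%R, (r / 2)%R]) (h 0 / 2)%:E <=
    \int[mu]_(x in `[(- (r / 2))%R, (r / 2)%R]) (h x)%:E)%E.
  apply: ge0_le_integral => //.
  - by move=> x _; rewrite lee_fin; lra.
  - apply/measurable_EFinP; apply: measurable_funTS; exact: continuous_measurable_fun.
apply: (le_trans le2); apply: ge0_subset_integral => //.
- by apply/measurable_EFinP; exact: continuous_measurable_fun.
- by move=> x _; rewrite lee_fin.
Qed.

(** Hölder's inequality for each function representing [u], which bounds the infimum from below; if
    there is none, the norm is infinite. The 2 is the one of [cabs_cint_le]. *)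
Lemma L2norm_ge (u : functional R) (phi : schwartz R) K : 0 < K ->
  (fun_L2norm phi <= K%:E)%E -> ((cabs (u phi) / (2 * K))%:E <= L2norm u)%E.
Proof.
move=> K0 phiK; apply: le_ereal_inf_tmp => _ [f [mf foo ->] <-].
have mphi := ccontinuous_measurable (schwartz_continuous (schwartzP phi)).
have maf := measurable_cabs mf; have maphi := measurable_cabs mphi.
have := @hoelder _ _ _ mu (cabs \o f) (cabs \o phi) 2 2 maf maphi.
move=> /(_ ltac:(by []) ltac:(by []) ltac:(by field)).
rewrite -/(fun_L2norm f) -/(fun_L2norm phi) Lnorm1.
have F0 : (0 <= fun_L2norm f)%E by exact: Lnorm_ge0.
have P0 : (0 <= fun_L2norm phi)%E by exact: Lnorm_ge0.
move=> ho; have {}ho := le_trans ho (lee_wpmul2l F0 phiK).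
have [r fr] : exists r, fun_L2norm f = r%:E.
  by exists (fine (fun_L2norm f)); rewrite fineK// ge0_fin_numE.
rewrite fr -EFinM in ho; rewrite fr lee_fin.
pose k x := cabs (f x) * cabs (phi x).
have k0 x : 0 <= k x by rewrite mulr_ge0 ?cabs_ge0.
have kE : (\int[mu]_x (k x)%:E <= (r * K)%:E)%E.
  apply: le_trans ho; rewrite le_eqVlt; apply/orP; left; apply/eqP.
  by apply: eq_integral => x _; rewrite /= ger0_norm// mulr_ge0 ?cabs_ge0.
have mk : measurable_fun [set: R] k by exact: measurable_funM.
have ik : mu.-integrable [set: R] (EFin \o k).
  apply/integrableP; split; first exact/measurable_EFinP.
  apply: (@le_lt_trans _ _ (\int[mu]_x (k x)%:E)%E); last exact: le_lt_trans kE (ltry _).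
  rewrite le_eqVlt; apply/orP; left; apply/eqP.
  by apply: eq_integral => x _; rewrite /= ger0_norm.
have mfp : cmeasurable (fun x => f x * phi x).
  have [fr' fi] := mf; have [pr pi'] := mphi; split.
    rewrite (_ : re _ = fun x => re f x * re phi x - im f x * im phi x).
      by apply: measurable_funB; exact: measurable_funM.
    by apply/funext => x; rewrite /re cReM.
  rewrite (_ : im _ = fun x => re f x * im phi x + im f x * re phi x).
    by apply: measurable_funD; exact: measurable_funM.
  by apply/funext => x; rewrite /im cImM.
have := cabs_cint_le mfp (fun x => _) ik; rewrite -/(distr f phi) => le.
rewrite ler_pdivrMr ?mulr_gt0//.
apply: (le_trans (le _)); first by move=> x; rewrite cabsM.
rewrite mulrCA ler_pM2l// -lee_fin fineK//; exact: integrable_fin_num.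
Qed.

Lemma lpnorm_ge (p : \bar R) (b : int -> \bar R) (n : int) : (2%:E <= p)%E ->
  (forall n, 0 <= b n)%E -> (b n <= lpnorm p b)%E.
Proof.
case: p => [p||] //= p2 b0; last by apply: ereal_sup_ubound; exists n.
have {}p2 : 2 <= p by rewrite -lee_fin.
have p0 : p != 0 by rewrite gt_eqF//; lra.
have -> : b n = ((b n `^ p) `^ p^-1)%E by rewrite -poweRrM mulfV// poweRe1.
have es0 : (0 <= \esum_(n in [set: int]) (b n `^ p))%E.
  by apply: esum_ge0 => m _; exact: poweR_ge0.
apply: gt0_ler_poweR; first by rewrite invr_ge0; lra.
- by rewrite in_itv /= leey andbT poweR_ge0.
- by rewrite in_itv /= leey andbT.
- rewrite (esumID [set n]); last by move=> m _; exact: poweR_ge0.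
  rewrite setTI esum_set1 ?poweR_ge0// leeDl//.
  by apply: esum_ge0 => m _; exact: poweR_ge0.
Qed.

Lemma Mnorm_ge (psi : R -> R) (s : R) (p : \bar R) (u : functional R) (n : int) : (2%:E <= p)%E ->
  ((japanese n `^ s)%:E * L2norm (box psi n u) <= Mnorm psi s p u)%E.
Proof.
move=> p2; apply: (@lpnorm_ge p (fun n => ((japanese n `^ s)%:E * L2norm (box psi n u))%E)) => // m.
rewrite mule_ge0 ?lee_fin ?powR_ge0//.
by apply: le_ereal_inf_tmp => _ [f _ <-]; exact: Lnorm_ge0.
Qed.

End NormLowerBounds.

(** * The Fourier transform of a soliton *)

Section SolitonTransform.
Context {R : realType}.
Implicit Types (N a kap V t xi : R).

Definition csech (y : R) : R[i] := (sech y)%:C%C.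
Definition sech_hat : R -> R[i] := fourier csech.

Lemma schwartz_csech : is_schwartz csech.
Proof. exact: schwartz_sech. Qed.

Lemma schwartz_sech_hat : is_schwartz sech_hat.
Proof. exact/schwartz_fourier/schwartz_csech. Qed.

Lemma schwartz_wave N a kap V t : a != 0 -> is_schwartz (wave kap V (profile N a) t).
Proof.
move=> a0; apply: schwartzZ.
have := schwartz_affine (- (V * t)) (oner_neq0 R) (schwartz_profile N a0).
by under [X in is_schwartz X]eq_fun do rewrite mul1r.
Qed.

Lemma fourierZ z (f : R -> R[i]) xi : is_schwartz f ->
  fourier (fun x => z * f x) xi = z * fourier f xi.
Proof.
move=> sf; rewrite !fourierE [RHS]mulrCA; congr (_ * _); rewrite /fkernel -cintZ.
  by apply: eq_cint => x; rewrite mulrCA.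
by apply: schwartz_integrable; exact: schwartz_integrand.
Qed.

Lemma fourierB (f g : R -> R[i]) xi : is_schwartz f -> is_schwartz g ->
  fourier (fun x => f x - g x) xi = fourier f xi - fourier g xi.
Proof.
move=> sf sg; rewrite !fourierE -mulrBr /fkernel -cintB; last 2 first.
- by apply: schwartz_integrable; exact: schwartz_integrand.
- by apply: schwartz_integrable; exact: schwartz_integrand.
by congr (_ * _); apply: eq_cint => x; rewrite mulrBr.
Qed.

(** Time enters only through a unimodular factor. For two solitons the difference of speeds becomes
    a relative oscillation in [xi]. *)
Lemma fourier_wave N a kap V t xi : 0 < a ->
  fourier (wave kap V (profile N a) t) xi =
  cexpi (kap * t - V * t * xi) * sech_hat ((xi - N) / a).
Proof.
move=> a0; set y := V * t.
have an0 : a != 0 by rewrite gt_eqF.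
have sb : is_schwartz (fun x => a%:C%C * csech (a * (x - y))).
  have := schwartzZ a%:C%C (schwartz_affine (- (a * y)) an0 schwartz_csech).
  by under [X in is_schwartz X]eq_fun do rewrite -mulrBr.
have sm : is_schwartz (fun x => cexpi (N * x) * (a%:C%C * csech (a * (x - y)))).
  have := schwartzM sb (tame_expi N).
  by under [X in is_schwartz X]eq_fun do rewrite mulrC.
have -> : wave kap V (profile N a) t =
    fun x => cexpi (kap * t - N * y) * (cexpi (N * x) * (a%:C%C * csech (a * (x - y)))).
  apply/funext => x; rewrite /wave /profile /csech -/y -real_complexM.
  clearbody y; move: (a * sech _) => b; rewrite !mulrA -!cexpiD.
  by congr (cexpi _ * _); ring.
rewrite fourierZ// fourier_modulation (fourier_affine y _ a0 schwartz_csech) mulrA -cexpiD.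
by congr (cexpi _ * _); ring.
Qed.

Lemma fourier_profile N a xi : 0 < a -> fourier (profile N a) xi = sech_hat ((xi - N) / a).
Proof.
move=> a0; have E : wave 0 0 (profile N a) 0 = profile N a.
  by apply/funext => x; rewrite /wave mul0r subr0 cexpi0 mul1r.
by rewrite -E fourier_wave// mul0r mul0r subr0 cexpi0 mul1r.
Qed.

(** The mean value theorem for the real and imaginary parts, whence the 2. The 3 compares weights at
    points at distance at most 1, as [1 + y^2 <= 3 (1 + z^2)] there. *)
Lemma schwartz_increment (g : R -> R[i]) m : is_schwartz g ->
  exists2 C : R, 0 <= C & forall eta y : R, 0 <= eta <= 1 ->
    cabs (g y - g (y - eta)) <= C * eta * weight y ^+ m.
Proof.
move=> sg; have [C C0 hC] := rapid_weight m (schwartz_rapid (schwartz_cderiv 1 sg)).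
exists (2 * (C * 3 ^+ m)); first by rewrite !mulr_ge0 ?exprn_ge0.
move=> eta y /andP[e0 e1].
have wy (z : R) : y - eta <= z <= y -> weight z ^+ m <= 3 ^+ m * weight y ^+ m.
  move=> /andP[z1 z2]; rewrite -exprMn lerXn2r ?nnegrE ?mulr_ge0 ?weight_ge0// /weight.
  rewrite ler_pdivlMr ?ltr_pwDl ?sqr_ge0// mulrC ler_pdivrMr ?ltr_pwDl ?sqr_ge0//.
  have h1 : (y - z) ^+ 2 <= 1.
    by rewrite exprn_ile1//; lra.
  by have := sqr_ge0 (2 * z - y); rewrite !expr2 in h1 *; nra.
have mvt (h : R -> R) (h' : R -> R) : (forall x : R, is_derive x 1 h (h' x)) ->
    (forall x, `|h' x| <= C * weight x ^+ m) ->
    `|h y - h (y - eta)| <= C * 3 ^+ m * eta * weight y ^+ m.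
  move=> dh hh'; move: e0; rewrite le_eqVlt => /predU1P[<-|e0].
    by rewrite subr0 subrr normr0 mulr0 mul0r.
  have lt : y - eta < y by lra.
  have [c cin ->] := MVT lt (fun x _ => dh x) (continuous_subspaceT (is_derive_continuous dh)).
  rewrite opprB addrCA subrr addr0 normrM (gtr0_norm e0).
  move: cin; rewrite in_itv /= => /andP[c1 c2].
  have := le_trans (hh' c) (ler_wpM2l C0 (wy c _)); rewrite (ltW c1) (ltW c2) => /(_ isT) le.
  rewrite [leRHS](_ : _ = C * (3 ^+ m * weight y ^+ m) * eta); last by ring.
  by rewrite ler_wpM2r// ltW.
rewrite (le_trans (cabs_le_ReIm _))//.
rewrite [leRHS](_ : _ = C * 3 ^+ m * eta * weight y ^+ m + C * 3 ^+ m * eta * weight y ^+ m); last by ring.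
have dg x := csmooth_has x (schwartz_smooth sg).
rewrite lerD// ?cReD ?cImD ?cReN ?cImN.
  apply: (mvt (re g) (re (cderiv 1 g))) => x; first exact: (dg x).1.
  exact: le_trans (le_cRe_cabs _) (hC x).
apply: (mvt (im g) (im (cderiv 1 g))) => x; first exact: (dg x).2.
exact: le_trans (le_cIm_cabs _) (hC x).
Qed.

End SolitonTransform.

(** * Lower bound for the difference of two separated solitons *)

Section SolitonSeparation.
Context {R : realType}.
Variables (psi : R -> R) (hpsi : is_cutoff psi).

Local Notation mu := (@lebesgue_measure R).

Lemma has_cderiv_cutoff_affine k (a b r y : R) :
  has_cderiv (fun y => (r * derive1n k psi (a * y + b))%:C%C) y
    (r * (a * derive1n k.+1 psi (a * y + b)))%:C%C.
Proof.
have [dpsi _ _] := hpsi; apply: has_cderiv_real; apply: is_deriveZR.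
apply: is_derive_affine; apply: DeriveDef; first exact: dpsi.
by rewrite derive1nS derive1E.
Qed.

Lemma tame_cutoff_affine (a b : R) : tame (fun y => (psi (a * y + b))%:C%C).
Proof.
pose P h := exists k r, h = fun y : R => (r * derive1n k psi (a * y + b))%:C%C.
apply: (@tame_of_class _ P); last by exists 0%N, 1; apply/funext => y; rewrite mul1r.
  move=> _ [k [r ->]]; exists (fun y => (r * a * derive1n k.+1 psi (a * y + b))%:C%C); first by exists k.+1, (r * a).
  by move=> x; rewrite -mulrA; exact: has_cderiv_cutoff_affine.
move=> _ [k [r ->]]; have [M _ hM] := cutoff_bounded hpsi k; exists 0%N, (`|r| * M) => x.
by rewrite expr0 mulr1 cabs_real normrM ler_wpM2l.
Qed.

Lemma cutoff_eq1 (x : R) : 0 <= x <= 1 -> psi x = 1.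
Proof. by case: hpsi => _ _; apply. Qed.

Definition sech_hat_mass : R := (\int[mu]_y (cabs (sech_hat y) ^+ 2))%R.

Lemma continuous_sqr_cabs (f : R -> R[i]) : ccontinuous f -> continuous (fun y => cabs (f y) ^+ 2).
Proof.
move=> [fr fi]; rewrite (_ : (fun y => _) = fun y => re f y ^+ 2 + im f y ^+ 2); last first.
  by apply/funext => y; rewrite sqr_cabs.
by move=> x; apply: cvgD; rewrite /GRing.exp /=; apply: cvgM; (exact: fr || exact: fi).
Qed.

Lemma sqr_cabs_weight (f : R -> R[i]) C y : 0 <= C -> cabs (f y) <= C * weight y ->
  cabs (f y) ^+ 2 <= C ^+ 2 * weight y ^+ 2.
Proof.
by move=> C0 h; rewrite -exprMn lerXn2r ?nnegrE ?cabs_ge0 ?mulr_ge0 ?weight_ge0.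
Qed.

Lemma sqr_cabs_weight1 (f : R -> R[i]) C y : 0 <= C -> cabs (f y) <= C * weight y ->
  cabs (f y) ^+ 2 <= C ^+ 2 * weight y.
Proof.
move=> C0 /(sqr_cabs_weight C0)/le_trans; apply; rewrite ler_wpM2l ?sqr_ge0//.
by rewrite expr2 ler_piMl ?weight_ge0// weight_le1.
Qed.

Lemma integrable_sqr_cabs (f : R -> R[i]) : is_schwartz f ->
  mu.-integrable [set: R] (EFin \o (fun y => cabs (f y) ^+ 2)).
Proof.
move=> sf; have [C C0 hC] := schwartz_weight sf.
apply: (@integrable_le _ _ _ _ _ (integrable_weightZ (C ^+ 2))).
  apply: continuous_measurable_fun; apply: continuous_sqr_cabs; exact: schwartz_continuous.
by move=> y; rewrite ger0_norm ?sqr_ge0// sqr_cabs_weight1.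
Qed.

(** At 0 the transform is a positive multiple of the integral of [sech], so the continuous integrand
    is positive there. *)
Lemma sech_hat_mass_gt0 : 0 < sech_hat_mass.
Proof.
apply: Rintegral_gt0.
- exact/continuous_sqr_cabs/schwartz_continuous/schwartz_sech_hat.
- by move=> y; rewrite sqr_ge0.
- rewrite exprn_gt0// /sech_hat fourierE cabsM /fconst cabs_real gtr0_norm ?fconst_real//.
  rewrite mulr_gt0 ?fconst_real//.
  apply: (@lt_le_trans _ _ `|cRe (fkernel (-1) csech (0 : R))|); last exact: le_cRe_cabs.
  have -> : fkernel (-1) csech (0 : R) = cint csech.
    by apply: eq_cint => x; rewrite mulr0 mulr0 cexpi0 mul1r.
  rewrite normr_gt0 gt_eqF//; apply: (@Rintegral_gt0 _ (re csech)).
  + by have [] := schwartz_continuous (@schwartz_csech R).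
  + by move=> x; exact/ltW/sech_gt0.
  + exact: sech_gt0.
  + by have [] := schwartz_integrable (@schwartz_csech R).
- exact/integrable_sqr_cabs/schwartz_sech_hat.
Qed.

Lemma distrB (f h : R -> R[i]) : is_schwartz f -> is_schwartz h ->
  (distr f - distr h)%R = distr (fun x => f x - h x).
Proof.
move=> sf sh; apply/funext => phi; rewrite /GRing.add /GRing.opp /= /distr.
have st := schwartz_tame (schwartzP phi).
rewrite -cintB; last 2 first.
- exact/schwartz_integrable/schwartzM.
- exact/schwartz_integrable/schwartzM.
by apply: eq_cint => x; rewrite mulrBl.
Qed.

(** Only box [n] is kept, paired with the conjugate of the first soliton. The result is the mass of
    that soliton in the box minus a cross term oscillating at the rate [z = a (V1 - V2) t], the
    distance of the centres in units of the width [1 / a]. Small [a] keeps the mass, large [|z|]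
    kills the cross term. *)
Lemma soliton_separation (s : R) (p : \bar R) : (2%:E <= p)%E ->
  exists a0 c0 Z : R, [/\ 0 < a0 <= 1, 0 < c0 &
    forall (a eta : R) (n : int) (kap1 V1 kap2 V2 t : R),
      0 < a <= a0 -> 0 <= eta <= 1 -> Z <= `|a * (V1 - V2) * t| ->
      ((c0 * (japanese n `^ s * Num.sqrt a))%:E <=
       Mnorm psi s p (distr (wave kap1 V1 (profile (n%:~R + 1 / 2) a) t) -
                      distr (wave kap2 V2 (profile (n%:~R + 1 / 2 + eta * a) a) t))%R)%E].
Proof.
move=> p2; have sg := @schwartz_sech_hat R.
have [Cg1 Cg10 hg1] := schwartz_weight sg.
have [Cg2 Cg20 hg2] := schwartz_weight (schwartz_cderiv 1 sg).
pose Cg := Cg1 + Cg2; have Cg0 : 0 <= Cg by rewrite addr_ge0.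
have hg y : cabs (sech_hat y) <= Cg * weight y.
  by rewrite (le_trans (hg1 y))// ler_wpM2r ?weight_ge0// lerDl.
have hg' y : cabs (cderiv 1 sech_hat y) <= Cg * weight y.
  by rewrite (le_trans (hg2 y))// ler_wpM2r ?weight_ge0// lerDr.
have hgb y : cabs (sech_hat y) <= Cg by rewrite (le_trans (hg y))// ler_piMr// weight_le1.
have hgb' y : cabs (cderiv 1 sech_hat y) <= Cg by rewrite (le_trans (hg' y))// ler_piMr// weight_le1.
have [M0 M00 hM0] := cutoff_bounded hpsi 0; have [M1 M10 hM1] := cutoff_bounded hpsi 1.
have [Cs' Cs'0 hs'] := schwartz_weight (@schwartz_csech R).
pose Cs := Cs' + 1; have Cs0 : 0 < Cs by rewrite ltr_wpDl.
have hs y : sech y <= Cs * weight y.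
  have := hs' y; rewrite /csech cabs_real gtr0_norm ?sech_gt0// => /le_trans; apply.
  by rewrite ler_wpM2r ?weight_ge0// lerDl.
have c10 := sech_hat_mass_gt0; set c1 := sech_hat_mass in c10.
have pi0 : 0 < pi :> R by exact: pi_gt0.
pose K0 := (1 + M0) * Cg ^+ 2; have K00 : 0 <= K0 by rewrite mulr_ge0 ?addr_ge0 ?sqr_ge0.
pose Cp := (M1 + 2 * M0) * Cg ^+ 2.
have Cp0 : 0 <= Cp by rewrite mulr_ge0 ?addr_ge0 ?mulr_ge0 ?sqr_ge0.
have KP : 0 <= 16 * K0 * pi by apply: mulr_ge0 (ltW pi0); exact: mulr_ge0.
have D0 : 0 < c1 + 16 * K0 * pi by exact: ltr_wpDr.
(* With [a <= a0] the mass lost by the cutoff, at most [4 a^2 K0 pi], is at most [c1 / 4]; with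
   [|z| >= Z] the cross term, at most [2 Cp pi / |z|], is at most [c1 / 4] too. *)
pose a0 := c1 / (c1 + 16 * K0 * pi); pose Z := 8 * Cp * pi / c1 + 1.
pose c0 := c1 / (4 * Cs * Num.sqrt pi).
have sp0 : 0 < Num.sqrt (pi : R) by rewrite sqrtr_gt0.
exists a0, c0, Z; split.
- by rewrite divr_gt0// ler_pdivrMr// mul1r lerDl.
- by rewrite divr_gt0// !mulr_gt0.
move=> a eta n kap1 V1 kap2 V2 t /andP[ap aa0] /andP[e0 e1] hZ.
have a01 : a0 <= 1 by rewrite ler_pdivrMr// mul1r lerDl.
have a1 : a <= 1 by exact: le_trans a01.
have an0 : a != 0 by rewrite gt_eqF.
set N1 := n%:~R + 1 / 2; set N2 := N1 + eta * a.
set w1 := wave kap1 V1 _ t; set w2 := wave kap2 V2 _ t.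
have sw1 : is_schwartz w1 by exact: schwartz_wave.
have sw2 : is_schwartz w2 by exact: schwartz_wave.
rewrite distrB//; set w := fun x => w1 x - w2 x.
have sw : is_schwartz w by exact: schwartzB.
apply: le_trans (Mnorm_ge psi s _ n p2).
rewrite (_ : c0 * _ = japanese n `^ s * (c0 * Num.sqrt a)); last by ring.
rewrite EFinM; apply: lee_wpmul2l; first by rewrite lee_fin powR_ge0.
pose phi := to_schwartz (fun x => (w1 x)^*%C).
have sJ := schwartzJ sw1.
have phiE : phi = (fun x => (w1 x)^*%C) :> (R -> R[i]) by exact: to_schwartzE.
pose B := Cs * Num.sqrt a * Num.sqrt pi.
have sa0 : 0 < Num.sqrt a by rewrite sqrtr_gt0.
have B0 : 0 < B by rewrite !mulr_gt0.
have phiB : (fun_L2norm phi <= B%:E)%E.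
  apply: (@fun_L2norm_le _ _ a (- (a * (V1 * t))) (Cs * Num.sqrt a)) => //.
  - by rewrite mulr_ge0 ?ltW.
  - apply: measurable_cabs; apply: ccontinuous_measurable; apply: schwartz_continuous; exact: schwartzP.
  - move=> x; rewrite phiE cabsJ /w1 /wave /profile !cabsM !cabs_expi !mul1r cabs_real.
    rewrite -mulrBr real_normK ?num_real//; set y := a * (x - _).
    have h1 : sech y ^+ 2 <= (Cs * weight y) ^+ 2.
      by rewrite lerXn2r ?nnegrE ?mulr_ge0 ?weight_ge0 ?(ltW Cs0) ?(ltW (sech_gt0 y)).
    have h2 : (Cs * weight y) ^+ 2 <= Cs ^+ 2 * weight y.
      rewrite exprMn ler_wpM2l ?sqr_ge0// expr2 ler_piMl ?weight_ge0// weight_le1//.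
    move: (sech y) (le_trans h1 h2) => q hq.
    rewrite !exprMn sqr_sqrtr ?(ltW ap)//.
    rewrite [leRHS](_ : _ = a ^+ 2 * (Cs ^+ 2 * weight y)); last by ring.
    by rewrite ler_wpM2l ?sqr_ge0.
apply: le_trans (L2norm_ge _ B0 phiB).
rewrite box_distr//; last exact: tame_cutoff.
pose G xi := (psi (xi - n%:~R))%:C%C * fourier w xi.
have sG : is_schwartz G.
  have := schwartzM (schwartz_fourier sw) (tame_cutoff hpsi n%:~R).
  by under [X in is_schwartz X]eq_fun do rewrite mulrC.
rewrite -/G /distr phiE -cint_fourier_inv//.
pose F xi := G xi * (fourier w1 xi)^*%C.
rewrite (eq_cint (g := F)); last by move=> xi; rewrite fourier_inv_conj.
have sF : is_schwartz F.
  apply: schwartzM => //; apply: schwartz_tame; apply: schwartzJ; exact: schwartz_fourier.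
rewrite (cint_affine N1 ap (schwartz_continuous sF) (schwartz_integrable sF)).
(* In the variable [y = (xi - N1) / a]: [A] is the mass density of the first soliton seen through
   the cutoff, [P] the cross term without its oscillation, [e] a constant phase. *)
pose z := a * (V1 - V2) * t.
pose e := cexpi ((kap2 - kap1) * t + (V1 - V2) * t * N1).
pose P y := (psi (a * y + 1 / 2))%:C%C * (sech_hat (y - eta) * (sech_hat y)^*%C).
pose A y := (psi (a * y + 1 / 2) * cabs (sech_hat y) ^+ 2)%:C%C.
have FE y : F (a * y + N1) = A y - e * (cexpi (1 * (y * z)) * P y).
  rewrite /F /G /w fourierB// !fourier_wave// /A /P /e.
  rewrite (_ : a * y + N1 - N2 = (y - eta) * a); last by rewrite /N2; ring.
  rewrite (_ : a * y + N1 - N1 = y * a); last by ring.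
  rewrite (_ : a * y + N1 - n%:~R = a * y + 1 / 2); last by rewrite /N1; ring.
  rewrite !mulfK// conjcM real_complexM -mulcJ.
  rewrite (_ : kap2 * t - V2 * t * (a * y + N1) =
      kap1 * t - V1 * t * (a * y + N1) + ((kap2 - kap1) * t + (V1 - V2) * t * N1 + 1 * (y * z))).
    set X1 := kap1 * t - _; set X2 := _ + _ * N1; set X3 := 1 * (y * z).
    rewrite (cexpiD X1) (cexpiD X2).
    set E1 := cexpi X1; set E2 := cexpi X2; set E3 := cexpi X3.
    move: (sech_hat y) (sech_hat (y - eta)) => u v.
    have E1E : E1 * E1^*%C = 1 by rewrite mulcJ cabs_expi expr1n.
    rewrite [RHS](_ : _ = E1 * E1^*%C * ((psi (a * y + 1 / 2))%:C%C * (u * u^*%C) -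
      E2 * (E3 * ((psi (a * y + 1 / 2))%:C%C * (v * u^*%C))))); last by rewrite E1E [RHS]mul1r.
    by clearbody E1 E2 E3; ring.
  by rewrite /z; ring.
have sgs : is_schwartz (fun y => sech_hat (y - eta)).
  have := schwartz_affine (- eta) (oner_neq0 R) sg.
  by under [X in is_schwartz X]eq_fun do rewrite mul1r.
have sP : is_schwartz P.
  have := schwartzM (schwartzM sgs (schwartz_tame (schwartzJ sg))) (tame_cutoff_affine a (1 / 2)).
  by under [X in is_schwartz X]eq_fun do rewrite mulrC.
have sA : is_schwartz A.
  have := schwartzM (schwartzM sg (schwartz_tame (schwartzJ sg))) (tame_cutoff_affine a (1 / 2)).
  by under [X in is_schwartz X]eq_fun do rewrite mulcJ mulrC -real_complexM.
have dP y : has_cderiv P y ((1 * (a * derive1n 1 psi (a * y + 1 / 2)))%:C%C * (sech_hat (y - eta) * (sech_hat y)^*%C) +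
    (psi (a * y + 1 / 2))%:C%C * (cderiv 1 sech_hat (y - eta) * (sech_hat y)^*%C +
      sech_hat (y - eta) * (cderiv 1 sech_hat y)^*%C)).
  apply: has_cderivM.
    have := has_cderiv_cutoff_affine 0 a (1 / 2) 1 y.
    by under [X in has_cderiv X]eq_fun do rewrite mul1r.
  apply: has_cderivM.
    by apply: has_cderiv_shift; exact: (csmooth_has _ (schwartz_smooth sg)).
  by apply: has_cderivJ; exact: (csmooth_has _ (schwartz_smooth sg)).
(* The bound has to be uniform in [a] and [eta]: [a <= 1] absorbs the chain rule factor, and the
   unshifted factor alone supplies the decay. *)
have P'b y : cabs (cderiv 1 P y) <= Cp * weight y.
  rewrite (has_cderiv_ext1 dP) (le_trans (cabsD _ _))// mul1r.
  have psi0 : `|psi (a * y + 1 / 2)| <= M0 := hM0 _; have psi1 := hM1 (a * y + 1 / 2).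
  have w0 := weight_ge0 y.
  have prod_le (u v : R[i]) : cabs u <= Cg -> cabs v <= Cg * weight y ->
      cabs (u * v^*%C) <= Cg ^+ 2 * weight y.
    by move=> hu hv; rewrite cabsM cabsJ expr2 -mulrA ler_pM ?cabs_ge0.
  rewrite [leRHS](_ : _ = M1 * (Cg ^+ 2 * weight y) + M0 * (Cg ^+ 2 * weight y + Cg ^+ 2 * weight y)); last by rewrite /Cp; ring.
  rewrite lerD// cabsM cabs_real ler_pM ?cabs_ge0//.
  - by rewrite normrM (gtr0_norm ap) (le_trans _ psi1)// ler_piMl.
  - exact: prod_le.
  - by rewrite (le_trans (cabsD _ _))// lerD// prod_le.
(* One integration by parts gains the factor [1 / |z|]. *)
have fkb : cabs (fkernel 1 P z) <= c1 / 4.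
  have Z0 : 0 < Z by rewrite ltr_wpDl// divr_ge0 ?(ltW c10)// mulr_ge0 ?(ltW pi0)// mulr_ge0.
  have z0 : 0 < `|z| by exact: lt_le_trans hZ.
  have h := cabs_fkernel_cderivn z 1 (normr1 R) sP.
  have h2 := cabs_fkernel 1 z (schwartz_continuous (schwartz_cderiv 1 sP)) P'b.
  rewrite -h expr1 in h2.
  have h3 := le_trans (ler_wpM2r (cabs_ge0 (fkernel 1 P z)) hZ) h2.
  rewrite -(ler_pM2l Z0) (le_trans h3)//.
  rewrite (_ : Z * _ = 2 * (Cp * pi) + c1 / 4); last by rewrite /Z; clear -c10; move: pi => q; field; rewrite gt_eqF.
  by rewrite lerDl; lra.
have Ab : 3 / 4 * c1 <= cRe (cint A).
  (* The frequency [N1] is the midpoint of [n, n+1], so the cutoff is 1 when [|a y| <= 1/2]. Beyond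
     that [weight y <= 4 a^2], and of the two weights in the bound on the squared transform one
     becomes this small factor. *)
  pose h y := cabs (sech_hat y) ^+ 2 - 4 * a ^+ 2 * K0 * weight y.
  have hA y : h y <= re A y.
    have hq := sqr_cabs_weight Cg0 (hg y); have w0 := weight_ge0 y.
    rewrite /h /re /A /=; move: (cabs (sech_hat y) ^+ 2) (sqr_ge0 (cabs (sech_hat y))) hq => q q0 hq.
    have [ay|ay] := leP `|a * y| (1 / 2).
      rewrite cutoff_eq1 ?mul1r.
        rewrite lerBlDr lerDl; apply: mulr_ge0 w0; apply: mulr_ge0 K00.
        by rewrite mulr_ge0 ?sqr_ge0.
      by move: ay; rewrite ler_norml => /andP[? ?]; apply/andP; split; lra.
    have wa : weight y <= 4 * a ^+ 2.
      have h1 : (1 / 2) ^+ 2 <= (a * y) ^+ 2.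
        by rewrite -[leRHS]real_normK ?num_real// lerXn2r ?nnegrE// ltW.
      rewrite /weight -(ler_pM2r (ltr_pwDl ltr01 (sqr_ge0 y))) mulVf ?gt_eqF ?ltr_pwDl ?sqr_ge0//.
      by have := sqr_ge0 a; rewrite !expr2 in h1 *; lra.
    have psi0 : `|psi (a * y + 1 / 2)| <= M0 := hM0 _.
    have h1 : - (M0 * q) <= psi (a * y + 1 / 2) * q.
      by rewrite -mulNr ler_wpM2r//; move: psi0; rewrite ler_norml => /andP[].
    have h2 : (1 + M0) * q <= K0 * weight y * (4 * a ^+ 2).
      apply: (@le_trans _ _ (K0 * weight y * weight y)); last first.
        by apply: ler_wpM2l => //; exact: mulr_ge0.
      rewrite [leRHS](_ : _ = (1 + M0) * (Cg ^+ 2 * weight y ^+ 2)); last by rewrite /K0; ring.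
      by rewrite ler_wpM2l ?addr_ge0.
    by clear -h1 h2; move: (psi _) (K0) (weight y) h1 h2 => P' K w h1 h2; lra.
  have ih1 := integrable_sqr_cabs sg.
  have ih2 := integrable_weightZ (4 * a ^+ 2 * K0).
  have ih : mu.-integrable [set: R] (EFin \o h).
    by rewrite (_ : EFin \o h = (fun y => (cabs (sech_hat y) ^+ 2)%:E - (4 * a ^+ 2 * K0 * weight y)%:E)%E)//; exact: integrableB.
  have [iA _] := schwartz_integrable sA.
  apply: (@le_trans _ _ (\int[mu]_y h y)%R); last first.
    exact: le_Rintegral.
  rewrite RintegralB// Rintegral_weightZ -/sech_hat_mass -/c1.
  have h1 : a * (c1 + 16 * K0 * pi) <= c1 by rewrite -ler_pdivlMr.
  have h2 : a * (16 * K0 * pi * a) <= a * (16 * K0 * pi).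
    by rewrite ler_wpM2l ?(ltW ap)// ler_piMr.
  have h3 : 0 <= a * c1 by rewrite mulr_ge0 ?ltW.
  by clear -h1 h2 h3; move: pi K0 h1 h2 => q K h1 h2; rewrite expr2; lra.
have -> : cint (fun x => F (a * x + N1)) = cint A - e * fkernel 1 P z.
  rewrite (eq_cint FE) cintB ?cintZ//.
  - by apply: schwartz_integrable; exact: schwartz_integrand.
  - exact: schwartz_integrable.
  - by apply: schwartz_integrable; apply: schwartzZ; exact: schwartz_integrand.
rewrite cabsM cabs_real gtr0_norm// lee_fin.
have lb : c1 / 2 <= cabs (cint A - e * fkernel 1 P z).
  have h1 : cRe (cint A) <= cabs (cint A) by rewrite (le_trans (ler_norm _))// le_cRe_cabs.
  have h2 : cabs (cint A) <= cabs (cint A - e * fkernel 1 P z) + cabs (e * fkernel 1 P z).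
    by rewrite -{1}(subrK (e * fkernel 1 P z) (cint A)) cabsD.
  rewrite cabsM cabs_expi mul1r in h2; lra.
rewrite ler_pdivlMr ?mulr_gt0// /c0 /B.
apply: (@le_trans _ _ (a * (c1 / 2))); last by rewrite ler_pM2l.
rewrite le_eqVlt; apply/orP; left; apply/eqP.
rewrite [RHS](_ : _ = Num.sqrt a ^+ 2 * (c1 / 2)); last by rewrite sqr_sqrtr ?(ltW ap).
clearbody c1 Cs; move: (Num.sqrt a) (Num.sqrt (pi : R)) sp0 => u v v0.
by field; rewrite !gt_eqF.
Qed.

End SolitonSeparation.

(** * Two separating solitons *)

Section Assembly.
Context {R : realType}.
Implicit Types (s kappa eta t Z : R).

Lemma japanese_ge (n : nat) : n%:R <= japanese n :> R.
Proof.
by rewrite -[leLHS](ger0_norm (ler0n R n)) -sqrtr_sqr ler_sqrt ?addr_ge0 ?sqr_ge0// lerDr.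
Qed.

Lemma japanese_le2 (n : nat) : (0 < n)%N -> japanese n <= 2 * n%:R :> R.
Proof.
move=> n0; have n1 : (1 : R) <= n%:R by rewrite ler1n.
rewrite -[leRHS]ger0_norm ?mulr_ge0// -sqrtr_sqr ler_sqrt ?sqr_ge0//.
by rewrite -pmulrn expr2; nra.
Qed.

(* The amplitude for which the solitons have the size [sqrt kappa] in the modulation space. *)
Definition amplitude kappa s (n : int) : R := kappa * japanese n `^ (- (2 * s)).

Lemma amplitude_sqrt kappa s n : 0 <= kappa ->
  japanese n `^ s * Num.sqrt (amplitude kappa s n) = Num.sqrt kappa.
Proof.
move=> k0; have j0 := japanese_gt0 n : 0 < japanese n :> R.
rewrite /amplitude sqrtrM// mulrCA -[in X in _ * X](_ : (japanese n `^ (- s)) ^+ 2 = japanese n `^ (- (2 * s))).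
  rewrite sqrtr_sqr ger0_norm ?powR_ge0// powRN mulfV ?mulr1//.
  by rewrite gt_eqF// powR_gt0.
by rewrite expr2 -powRD ?(gt_eqF j0) ?implybT//; congr (_ `^ _); ring.
Qed.

Lemma amplitude_bounds kappa s (n : int) : 0 < kappa -> 0 <= s -> 0 < amplitude kappa s n <= kappa.
Proof.
move=> k0 s0; rewrite mulr_gt0 ?powR_gt0 ?japanese_gt0//= ler_piMr ?(ltW k0)//.
rewrite -[leRHS](powRr0 (japanese n : R)); apply: ler_powR; first exact: japanese_ge1.
by rewrite oppr_le0 mulr_ge0.
Qed.

(** The rescaled distance is at least [c] times [japanese n] to the power [th = 2 j - 2 - 4 s]: the
    velocity gap gives [2 j - 2], and each of the two factors [a] costs [2 s]. The assumption on [s]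
    says exactly that [th > 0], so [n] can be chosen after [eta] and [t]. *)
Lemma soliton_drift (j : nat) s kappa eta t Z : (2 <= j)%N -> 0 <= s -> s < (j%:R - 1) / 2 ->
  0 < kappa <= 1 -> 0 < eta -> 0 < t ->
  exists n : nat, let a := amplitude kappa s n in let N : R := (n : int)%:~R + 1 / 2 in
    Z <= `|a * (zim N a (2 * j) - zim (N + eta * a) a (2 * j)) * t|.
Proof.
move=> j2 s0 sj /andP[k0 k1] e0 t0.
pose m := (2 * j - 2)%N; have m2 : m.+2 = (2 * j)%N by rewrite /m; clear -j2; lia.
pose th : R := m%:R - 4 * s.
have th0 : 0 < th.
  have E : (m%:R : R) = 2 * j%:R - 2 by rewrite /m natrB ?natrM//; lia.
  by rewrite /th E; lra.
pose c : R := kappa ^+ 2 * eta * t / 4 ^+ m.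
have c0 : 0 < c by rewrite divr_gt0 ?exprn_gt0// !mulr_gt0// exprn_gt0.
pose L := (`|Z| / c) `^ th^-1.
have [n [n1 nL nj]] : exists n : nat, [/\ (0 < n)%N, L <= n%:R & (2 * (2 * j).+1 <= n)%N].
  (* The second argument makes the frequency large enough for [velocity_gap] at the power [2 j]. *)
  exists (maxn (Num.truncn L).+1 (2 * (2 * j).+1)); rewrite leq_maxr; split=> //.
    by rewrite leq_max.
  apply: ltW; apply: (lt_le_trans (truncnS_gt L)); rewrite ler_nat leq_maxl//.
exists n => a N.
have /andP[a0 ak] : 0 < a <= kappa by exact: amplitude_bounds.
have a1 : a <= 1 by exact: le_trans k1.
have x1 := japanese_ge1 n : 1 <= japanese n :> R; set x : R := japanese n in x1.
have x0 : 0 < x by exact: lt_le_trans x1.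
have NE : N = n%:R + 1 / 2 by rewrite /N -pmulrn.
have hN : 2 * (2 * j).+1%:R <= N.
  by move: nj; rewrite -(ler_nat R) natrM NE; lra.
have h0 : 0 <= eta * a by rewrite mulr_ge0 ?ltW.
have a01 : 0 < a <= 1 by rewrite a0.
have := @velocity_gap R (2 * j) N a (eta * a) hN a01 h0 m.
rewrite m2; move=> /(_ (leqnn _)) gap.
have xN : x / 4 <= N / 2.
  by have := japanese_le2 n1; rewrite -/x NE; lra.
have gap' : eta * a * (x / 4) ^+ m <= zim (N + eta * a) a (2 * j) - zim N a (2 * j).
  apply: le_trans gap; rewrite ler_wpM2l// lerXn2r// nnegrE; first by rewrite divr_ge0 ?ltW.
  by rewrite NE; lra.
rewrite -normrN -mulNr -mulrN opprB.
have D0 : 0 <= eta * a * (x / 4) ^+ m by rewrite mulr_ge0// exprn_ge0// divr_ge0// ltW.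
apply: le_trans (ler_norm _).
have at0 : 0 < a * t by rewrite mulr_gt0.
rewrite mulrAC; apply: le_trans (ler_wpM2l (ltW at0) gap').
have -> : a * t * (eta * a * (x / 4) ^+ m) = c * x `^ th.
  have -> : x `^ th = x ^+ m * (x `^ (- (2 * s))) ^+ 2.
    rewrite -powR_mulrn ?(ltW x0)// expr2 -!powRD ?(gt_eqF x0) ?implybT//.
    by congr (_ `^ _); rewrite /th; ring.
  rewrite /a /amplitude -/x /c expr_div_n; move: (x ^+ m) (x `^ _) => u v.
  by field; rewrite gt_eqF// exprn_gt0.
rewrite mulrC -ler_pdivrMr//.
apply: (@le_trans _ _ (`|Z| / c)); first by rewrite ler_wpM2r ?invr_ge0 ?(ltW c0)// ler_norm.
have Lx : L <= x by exact: le_trans nL (japanese_ge n).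
have -> : `|Z| / c = L `^ th.
  by rewrite /L -powRrM mulVf ?gt_eqF// powRr1// divr_ge0// ltW.
by apply: ge0_ler_powR; rewrite ?nnegrE ?powR_ge0// ltW.
Qed.

End Assembly.

Theorem theorem3p7 (R : realType) (psi : R -> R) (hpsi : is_cutoff psi)
    (j : nat) (hj : (2 <= j)%N) (p : \bar R) (hp : (2%:E <= p)%E)
    (s : R) (hs0 : 0 <= s) (hs : s < (j%:R - 1) / 2) :
  exists c : coefficients R j,
    forall T : R, 0 < T ->
    forall S : functional R -> R -> functional R,
      flow_map psi s p c T S -> ~ unif_continuous_on_bounded psi s p T S.
Proof.
have [c csol] := @soliton_solution R j; exists c => T T0 S [_ Ssol] unif.
have [a0 [c0 [Z [/andP[a00 a01] c00 sep]]]] := soliton_separation hpsi s hp.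
have [m [C C0 normle]] := Mnorm_le hpsi hs0.
have sg := @schwartz_sech_hat R; have sg' := schwartz_cderiv 1 sg.
have [A1 A10 hA1] := rapid_weight m (schwartz_rapid sg).
have [A2 A20 hA2] := rapid_weight m (schwartz_rapid sg').
have [D1 D10 hD1] := schwartz_increment m sg.
have [D2 D20 hD2] := schwartz_increment m sg'.
have sk0 : 0 < Num.sqrt a0 by rewrite sqrtr_gt0.
have wm y : 0 <= weight y ^+ m :> R by rewrite exprn_ge0 ?weight_ge0.
have amp n : 0 < amplitude a0 s n <= 1.
  by have /andP[-> h] := amplitude_bounds n a00 hs0; exact: le_trans a01.
have ampn n : amplitude a0 s n != 0 by have /andP[h _] := amp n; rewrite gt_eqF.
(* The bounded set must be fixed before [d] is known, so it contains the initial data for all [n]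
   and all frequencies in [n, n+1], with [kappa = a0]. *)
pose B u := exists n (N : R), n%:~R <= N <= n%:~R + 1 /\ u = distr (profile N (amplitude a0 s n)).
have Bnorm u : B u -> (Mnorm psi s p u <= (C * (A1 + A2) * Num.sqrt a0)%:E)%E.
  move=> [n [N [hN ->]]]; rewrite -(amplitude_sqrt s n (ltW a00)).
  have /andP[ap a1] := amp n.
  apply: (normle _ _ _ _ _ _ _ hp (amp n) hN (addr_ge0 A10 A20) (schwartz_profile N (ampn n)) sg).
  - by move=> xi; rewrite fourier_profile.
  - by move=> y; rewrite (le_trans (hA1 y))// ler_wpM2r// lerDl.
  - by move=> y; rewrite (le_trans (hA2 y))// ler_wpM2r// lerDr.
have BM u : B u -> Mspace psi s p u.
  move=> Bu; split; last exact: le_lt_trans (Bnorm u Bu) (ltry _).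
  by case: Bu => n [N [_ ->]]; apply: tempered_distr; exact: schwartz_profile.
have [d d0 hd] := unif B BM (ex_intro _ _ Bnorm) (c0 * Num.sqrt a0) (mulr_gt0 c00 sk0).
pose K := C * (D1 + D2) * Num.sqrt a0.
have K0 : 0 <= K by rewrite mulr_ge0 ?(ltW sk0)// mulr_ge0 ?addr_ge0.
(* The second value brings the initial data within [d]; the first keeps the frequency [N2] below
   [n + 1], hence the second datum in [B]. *)
pose eta := Num.min (1 / 2) (d / (2 * (K + 1))).
have eta0 : 0 < eta by rewrite lt_min !divr_gt0// mulr_gt0// ltr_wpDl.
have eta2 : eta <= 1 / 2 by rewrite ge_min lexx.
have etad : K * eta < d.
  have : eta <= d / (2 * (K + 1)) by rewrite ge_min lexx orbT.
  by rewrite ler_pdivlMr ?mulr_gt0 ?ltr_wpDl//; nra.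
have t0 : 0 < T / 2 by rewrite divr_gt0.
have tT : `|T / 2| < T by rewrite gtr0_norm//; lra.
have a0b : 0 < a0 <= 1 by rewrite a00.
have [n drift] := soliton_drift Z hj hs0 hs a0b eta0 t0.
have an0 := ampn n; have /andP[ap a1] := amp n.
have /andP[_ aa0] := amplitude_bounds n a00 hs0.
move: (amplitude_sqrt s n (ltW a00)) drift => /=.
set a := amplitude a0 s n in an0 ap a1 aa0 *; set N1 : R := _ + 1 / 2.
set V1 := zim N1 a _; set V2 := zim _ a _ => ampE drift.
pose N2 := N1 + eta * a.
have ea : 0 <= eta * a <= 1 / 2.
  by rewrite mulr_ge0 ?(ltW eta0) ?(ltW ap)//= (le_trans _ eta2)// ler_piMr// ltW.
have B1 : B (distr (profile N1 a)) by exists n, N1; split=> //; apply/andP; split; rewrite /N1; lra.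
have B2 : B (distr (profile N2 a)).
  by exists n, N2; split=> //; move: ea => /andP[? ?]; apply/andP; split; rewrite /N2 /N1; lra.
have sp1 := schwartz_profile N1 an0; have sp2 := schwartz_profile N2 an0.
have close : (Mnorm psi s p (distr (profile N1 a) - distr (profile N2 a))%R < d%:E)%E.
  rewrite distrB//; apply: le_lt_trans (_ : (K * eta)%:E < _)%E; last by rewrite lte_fin.
  have sh f : is_schwartz f -> is_schwartz (fun y : R => f (y - eta)).
    move=> sf; have := schwartz_affine (- eta) (oner_neq0 R) sf.
    by under [X in is_schwartz X]eq_fun do rewrite mul1r.
  have d1 y : has_cderiv (fun y => sech_hat y - sech_hat (y - eta)) y
      (cderiv 1 sech_hat y - cderiv 1 sech_hat (y - eta)).
    apply: has_cderivB; first exact: (csmooth_has _ (schwartz_smooth sg)).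
    by apply: has_cderiv_shift; exact: (csmooth_has _ (schwartz_smooth sg)).
  have e01 : 0 <= eta <= 1 by rewrite (ltW eta0)/= (le_trans eta2)//; lra.
  have D0 : 0 <= (D1 + D2) * eta by rewrite mulr_ge0 ?addr_ge0 ?(ltW eta0).
  have hN : (n : int)%:~R <= N1 <= (n : int)%:~R + 1 by apply/andP; split; rewrite /N1; lra.
  rewrite [K * eta](_ : _ = C * ((D1 + D2) * eta) * (japanese n `^ s * Num.sqrt a)); last first.
    by rewrite ampE /K; ring.
  (* In the rescaled frequency the two data differ by a translation by [eta], whatever [n] is; this
     is why the second frequency is shifted by [eta * a]. *)
  apply: (normle _ _ _ _ _ _ _ hp (amp n) hN D0 (schwartzB sp1 sp2) (schwartzB sg (sh _ sg))).
  - move=> xi; rewrite fourierB// !fourier_profile// -/a; congr (_ - sech_hat _).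
    by rewrite /N2; field.
  - move=> y; rewrite (le_trans (hD1 eta y e01))// ler_wpM2r// ler_wpM2r ?(ltW eta0)// lerDl//.
  - move=> y; rewrite (has_cderiv_ext1 d1) (le_trans (hD2 eta y e01))// ler_wpM2r//.
    by rewrite ler_wpM2r ?(ltW eta0)// lerDr.
have wave0 k V g : wave k V g 0 = g :> (R -> R[i]).
  by apply/funext => x; rewrite /wave !mulr0 subr0 cexpi0 mul1r.
have := Ssol _ (csol T N1 a an0) (T / 2) tT; rewrite wave0 => S1.
have := Ssol _ (csol T N2 a an0) (T / 2) tT; rewrite wave0 => S2.
(* The supremum is at least the value at the time T/2 for which [n] was chosen, and there the flow
   map agrees with the two solitons. *)
have := hd _ _ B1 B2 close; apply/negP; rewrite -leNgt.
apply: le_ereal_sup_tmp; exists (Mnorm psi s p (S (distr (profile N1 a)) (T / 2) - S (distr (profile N2 a)) (T / 2))).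
  by exists (T / 2).
rewrite S1 S2 -ampE; apply: sep => //; first by rewrite ap.
by rewrite (ltW eta0)/= (le_trans eta2)//; lra.
Qed.
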